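(* Fix a positive integer $k$ and let \[ f(h,k) := \frac{k+1}{k^2}\cdot \sqrt[k+1]{k}\cdot\left(\frac{h^k}{\log h}\right)^{\frac{1}{k+1}}. \] Then, as $h\to\infty$: (i) $E(h,k)\gtrsim f(h,k)$; (ii) the number $\underline{R}(k)$ satisfies $\underline{R}(k)\in(1/e,1]$, and \[ E(h,k)\lesssim \left(\frac{1}{\underline{R}(k)}\right)^{\frac{k}{k+1}} f(h,k). \]
   Context: Let $\mathbb{N}$ denote the set of positive integers. For a subset $A$ of an additive semigroup and a positive integer $h$, $hA$ is the set of all sums of exactly $h$ not necessarily distinct elements of $A$. We write $hA\sim\mathbb{N}$ if all but finitely many positive integers lie in $hA$. A set $A\subseteq\mathbb{N}$ is a basis of order $h$ if $hA\sim\mathbb{N}$ but $(h-1)A\not\sim\mathbb{N}$; $A$ is a basis if it is a basis of some order. If $A$ is a basis, a finite subset $E\subseteq A$ is an essential subset of $A$ if $A\setminus E$ is not a basis of any order and $E$ is minimal with this property. $E(h,k)$ denotes the maximum possible number of essential subsets of size $k$ in a basis of order $h$ (this is finite). For integers $N>k\ge 1$, let $h(N,k)$ be the smallest positive integer $h$ such that there is a $k$-element subset $A\subseteq\mathbb{Z}_N\setminus\{0\}$ with $h(A\cup\{0\})=\mathbb{Z}_N$. Define $\underline{R}(k):=\liminf_{N\to\infty} \frac{h(N,k)}{k\sqrt[k]{N}}$. For positive functions, $F(h)\gtrsim G(h)$ means $\liminf_{h\to\infty}F(h)/G(h)\ge 1$, and $F(h)\lesssim G(h)$ means $\limsup_{h\to\infty}F(h)/G(h)\le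 1$. *)

(* Defs.v *)
From HB Require Import structures.
From mathcomp Require Import all_boot all_order all_algebra.
From mathcomp Require Import all_classical all_reals all_analysis.
Set Implicit Arguments. Unset Strict Implicit. Unset Printing Implicit Defensive.
Import Order.TTheory GRing.Theory Num.Theory.
Local Open Scope classical_set_scope.
Local Open Scope ring_scope.

Definition sumset (h : nat) (A : set nat) : set nat :=
  [set n | exists f : 'I_h -> nat, (forall i, A (f i)) /\ n = (\sum_(i < h) f i)%N].

Definition cofinite_in_N (X : set nat) : Prop :=
  exists M : nat, forall n : nat, (M <= n)%N -> X n.

Definition basis_of_order (h : nat) (A : set nat) : Prop :=
  cofinite_in_N (sumset h A) /\ ~ cofinite_in_N (sumset h.-1 A).

Definition is_basis (A : set nat) : Prop := exists h : nat, basis_of_order h A.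

(* finite subsets of N are represented by strictly increasing lists *)
Definition fsub (E : seq nat) : Prop := sorted ltn E.

Definition essential (A : set nat) (E : seq nat) : Prop :=
  fsub E /\ (forall x, x \in E -> A x) /\
  ~ is_basis (A `\` [set x | x \in E]) /\
  (forall E' : seq nat, {subset E' <= E} -> (exists2 x, x \in E & x \notin E') ->
      is_basis (A `\` [set x | x \in E'])).

Definition at_least_ess (A : set nat) (k n : nat) : Prop :=
  exists s : seq (seq nat), [/\ uniq s, size s = n &
    forall E, E \in s -> essential A E /\ size E = k].

Definition Eess (R : realType) (h k : nat) : R :=
  sup [set (n%:R : R) | n in [set n : nat | exists A : set nat,
        A `<=` [set m | (0 < m)%N] /\ basis_of_order h A /\ at_least_ess A k n]].

Definition covers_ZN (N h : nat) (s : seq nat) : Prop :=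
  forall x : nat, (x < N)%N ->
    exists f : 'I_h -> nat, (forall i, f i = 0%N \/ f i \in s) /\
                           x = ((\sum_(i < h) f i) %% N)%N.

Definition hNk (R : realType) (N k : nat) : R :=
  inf [set (h%:R : R) | h in [set h : nat | (0 < h)%N /\
        exists s : seq nat, [/\ uniq s, size s = k,
            (forall a, a \in s -> (0 < a < N)%N) & covers_ZN N h s]]].

Definition Rlow (R : realType) (k : nat) : \bar R :=
  limn_einf (fun N : nat =>
    ((hNk R N k / (k%:R * powR (N%:R) (k%:R)^-1))%:E)).

Definition asym_ge (R : realType) (F G : nat -> R) : Prop :=
  (1%:E <= limn_einf (fun h => (F h / G h)%:E))%E.
Definition asym_le (R : realType) (F G : nat -> R) : Prop :=
  (limn_esup (fun h => (F h / G h)%:E) <= 1%:E)%E.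

Definition fhk (R : realType) (h k : nat) : R :=
  (k.+1%:R / (k%:R ^+ 2)) * powR (k%:R) (k.+1%:R)^-1 *
  powR ((h%:R ^+ k) / ln (h%:R)) (k.+1%:R)^-1.

(* Main.v *)
(* If [E] is an essential subset of [A], some residue class modulo a prime [p] contains
   [A \ E], and by minimality [E] is exactly the part of [A] outside this class; distinct
   essential subsets belong to distinct primes.  A sum of [h] elements reaches the worst
   residue modulo each of these primes, which takes at least [h(p, k)] summands from every
   [E] disjoint from the others; the overlapping ones are negligible, as they contain too
   few elements to reach all residues modulo the product of their primes.  Hence [h] is at
   least about [R k (p_1^(1/k) + ... + p_n^(1/k))] for the first [n] primes.  Conversely,
   for the first primes, elements divisible by all primes but one and forming a digit
   system modulo the remaining one, together with a multiple of a basis with long gaps,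
   form a basis of any prescribed order [> k (p_1^(1/k) + ... + p_n^(1/k))].

   The asymptotics of these sums is equivalent to the prime number theorem when [k = 1].
   Its proof here is elementary: by the Turan-Kubilius inequality, the mean [g(N)] of the
   Moebius function satisfies [g(N / p) = - g(N)] approximately for most primes [p].
   Iterating this along pairs of primes with ratio close to 1, [g] is almost constant and
   equal to [+- g(N)] on a long multiplicative interval; one more application inside that
   interval gives [g(N) = - g(N)] approximately.  So the mean tends to 0, and Moebius
   inversion of [ln N!] against the divisor sum gives [psi(N) ~ N]. *)
Require Import Defs.
From HB Require Import structures.
From mathcomp Require Import all_boot all_order all_algebra zify ring lra.
From mathcomp Require Import all_classical all_reals all_analysis.
Set Implicit Arguments. Unset Strict Implicit. Unset Printing Implicit Defensive.
Import Order.TTheory GRing.Theory Num.Theory.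
Local Open Scope ring_scope.

(** * Chebyshev estimates *)

Section PrimeCounts.
Local Open Scope nat_scope.

(** The sum of [p^(1/k)] over the first [n] primes is asymptotic to
    [k / (k + 1) * n^(1 + 1/k) * (ln n)^(1/k)]. Up to the factor [R], the order is thus about [k^2 /
    (k + 1) * n^(1 + 1/k) * (ln n)^(1/k)], and [fhk] is the inverse of this function, as [ln n] is
    then about [k / (k + 1) * ln h]. The strict bound [1/e < R] rests on [k! >= e * (k/e)^k], whose
    factor [e] survives the [k]-th root for fixed [k].

    For the Moebius mean the obstacle is that every step along a prime costs an error, while many
    steps are needed to cover a long interval. The relative gap in a pair of close primes is
    therefore bounded below as well, independently of the error: the number of steps is fixed first,
    the error afterwards. All moduli of a chain are products of the same number of primes, so that
    their signs agree.

    In the construction the order must be any prescribed number, not only one dictated by the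
    primes: the gaps of the multiples make each surplus summand indispensable. *)

Lemma prod_uniq_primes_dvd (s : seq nat) n : uniq s ->
  (forall p, p \in s -> prime p /\ p %| n) -> \prod_(p <- s) p %| n.
Proof.
elim: s => [|p s IHs] /=; first by rewrite big_nil dvd1n.
move=> /andP[ps us] hs; rewrite big_cons Gauss_dvd.
  by rewrite (hs p _).2 ?mem_head //= IHs // => q qs; apply: hs; rewrite inE qs orbT.
rewrite prime_coprime ?(hs p _).1 ?mem_head //; apply: contra ps.
rewrite Euclid_dvd_prod ?(hs p _).1 ?mem_head // big_has => /hasP[q qs] /=.
rewrite dvdn_prime2 ?(hs p _).1 ?(hs q _).1 ?mem_head ?inE ?qs ?orbT //.
by move=> /eqP->.
Qed.

Definition primes_in a b := [seq p <- index_iota a.+1 b.+1 | prime p].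

Lemma mem_primes_in a b p : (p \in primes_in a b) = [&& prime p, a < p & p <= b].
Proof. by rewrite mem_filter mem_index_iota ltnS. Qed.

Lemma uniq_primes_in a b : uniq (primes_in a b).
Proof. by rewrite filter_uniq ?iota_uniq. Qed.

Lemma leq_size_prod c (s : seq nat) : (forall p, p \in s -> c <= p) ->
  c ^ size s <= \prod_(p <- s) p.
Proof.
elim: s => [|p s IHs] hs; first by rewrite big_nil.
rewrite big_cons expnS leq_mul ?hs ?mem_head // IHs // => q qs.
by rewrite hs // inE qs orbT.
Qed.

Lemma leq_prod_size c (s : seq nat) (f : nat -> nat) : (forall p, p \in s -> f p <= c) ->
  \prod_(p <- s) f p <= c ^ size s.
Proof.
elim: s => [|p s IHs] hs; first by rewrite big_nil.
rewrite big_cons expnS leq_mul ?hs ?mem_head // IHs // => q qs.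
by rewrite hs // inE qs orbT.
Qed.

Lemma prime_dvd_fact p n : prime p -> p %| n`! -> p <= n.
Proof.
move=> pp; elim: n => [|n IHn]; first by rewrite dvdn1 => /eqP p1; rewrite p1 in pp.
rewrite factS Euclid_dvdM // => /orP[/dvdn_leq->//|/IHn]; lia.
Qed.

(** The primes in question divide [(X + Y)!] but neither [X!] nor [Y!], hence their product divides
    the binomial coefficient. *)
Lemma exp_card_primes_in X Y : Y <= X ->
  X.+1 ^ size (primes_in X (X + Y)) <= 'C(X + Y, Y).
Proof.
move=> leYX; apply: (@leq_trans (\prod_(p <- primes_in X (X + Y)) p)).
  by apply: leq_size_prod => p; rewrite mem_primes_in => /and3P[].
apply: dvdn_leq; first by rewrite bin_gt0 leq_addl.
apply: prod_uniq_primes_dvd (uniq_primes_in _ _) _ => p.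
rewrite mem_primes_in => /and3P[pp ltXp lep]; split=> //.
have := bin_fact (leq_addl X Y); rewrite addnK => E.
have : p %| (X + Y)`! by rewrite dvdn_fact // prime_gt0.
rewrite -E !Euclid_dvdM // => /orP[//|/orP[]] /(prime_dvd_fact pp); lia.
Qed.

(** By Legendre's formula the exponent is the sum over [k] of [m.*2 %/ p ^ k - 2 * (m %/ p ^ k)].
    Each term is at most 1 and vanishes for [p ^ k > m.*2], which leaves at most [trunc_log p m.*2]
    of them. *)
Lemma pfactor_bin_leq p m : prime p -> 0 < m -> p ^ logn p 'C(m.*2, m) <= m.*2.
Proof.
move=> pp m0; have p1 := prime_gt1 pp.
have le2 : m <= m.*2 by lia.
have := bin_fact le2; rewrite (_ : m.*2 - m = m); last by lia.
move=> /(congr1 (logn p)).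
rewrite !lognM ?muln_gt0 ?fact_gt0 ?bin_gt0 // !logn_fact //.
rewrite (big_cat_nat (m := 1) (n := m.+1) (p := m.*2.+1)) //=.
set S := \sum_(1 <= k < m.+1) m.*2 %/ _; set S' := \sum_(m.+1 <= k < _) _.
set U := \sum_(1 <= k < m.+1) _ => E.
pose t := trunc_log p m.*2.
have small k : t < k -> m.*2 %/ p ^ k = 0.
  by move=> tk; rewrite divn_small // ltnNge; apply/negP => /(trunc_log_max p1); lia.
have leE : logn p 'C(m.*2, m) <= t; last first.
  by apply: leq_trans (trunc_logP p1 _); rewrite ?leq_exp2l //; lia.
have S'0 : S' = 0.
  apply: big1_seq => k /andP[_]; rewrite mem_index_iota => /andP[mk _].
  rewrite divn_small //; apply: leq_trans (_ : 2 ^ k <= _); last by rewrite leq_exp2r; lia.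
  by elim: k mk => // k IH; rewrite ltnS leq_eqVlt expnS => /orP[/eqP<-|/IH]; [have := ltn_expl m (ltnSn 1)|]; lia.
have : S <= U + U + t.
  rewrite /S /U -big_split /=.
  suff H n : \sum_(1 <= k < n.+1) m.*2 %/ p ^ k <=
     \sum_(1 <= k < n.+1) (m %/ p ^ k + m %/ p ^ k) + minn n t.
    by apply: leq_trans (H m) _; rewrite leq_add2l geq_minr.
  elim: n => [|n IHn]; first by rewrite !big_nil.
  rewrite [leqLHS]big_nat_recr //= [X in _ <= X + _]big_nat_recr //=; move: IHn.
  move: (\sum_(1 <= k < n.+1) _) (\sum_(1 <= k < n.+1) _) => A B IHn.
  have [tn|nt] := ltnP t n.+1.
    by rewrite small //; move: (m %/ p ^ _) => x; lia.
  have : m.*2 %/ p ^ n.+1 <= (m %/ p ^ n.+1).*2.+1.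
    have q0 : 0 < p ^ n.+1 by rewrite expn_gt0; lia.
    rewrite -ltnS ltn_divLR //; have := ltn_ceil m q0; nia.
  by move: (m %/ p ^ _) (_ %/ p ^ _) => x y; lia.
by lia.
Qed.

Lemma bin_leq_exp_primes m : 0 < m -> 'C(m.*2, m) <= m.*2 ^ size (primes_in 0 m.*2).
Proof.
move=> m0; have C0 : 0 < 'C(m.*2, m) by rewrite bin_gt0; lia.
rewrite [leqLHS]prod_prime_decomp // prime_decompE big_map /=.
rewrite (eq_big_seq (fun p => p ^ logn p 'C(m.*2, m))) //.
apply: leq_trans (leq_prod_size (c := m.*2) _) _.
  by move=> p; rewrite mem_primes => /and3P[pp _ _]; apply: pfactor_bin_leq.
rewrite leq_pexp2l ?double_gt0 // uniq_leq_size ?primes_uniq // => p.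
rewrite mem_primes mem_primes_in => /and3P[pp _ pd]; rewrite pp prime_gt0 //=.
apply: (prime_dvd_fact pp); apply: dvdn_trans pd _.
by rewrite -(bin_fact (_ : m <= m.*2)) ?dvdn_mulr //; lia.
Qed.

Lemma leq_exp2_bin m : 2 ^ m <= 'C(m.*2, m).
Proof.
elim: m => // m IHm; rewrite expnS doubleS binS.
have : 'C(m.*2, m) <= 'C(m.*2.+1, m.+1) by rewrite binS leq_addl.
have : 'C(m.*2, m) <= 'C(m.*2.+1, m) by case: (m) => // n; rewrite binS leq_addr.
by lia.
Qed.

Lemma bin_leq_exp2 n m : 'C(n, m) <= 2 ^ n.
Proof.
have [le|lt] := leqP m n; last by rewrite bin_small.
rewrite -[2]/(1 + 1) expnDn.
rewrite (bigD1 (Ordinal (le : m < n.+1))) //= !exp1n !muln1; lia.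
Qed.

Lemma primes_in_cat a b c : a <= b -> b <= c ->
  primes_in a c = primes_in a b ++ primes_in b c.
Proof.
move=> ab bc; rewrite -filter_cat /primes_in /index_iota.
rewrite (_ : c.+1 - a.+1 = (b.+1 - a.+1) + (c.+1 - b.+1)); last by lia.
by rewrite iotaD; congr [seq _ <- _ ++ iota _ _ | _]; lia.
Qed.

(** Doubling: the new primes add 2 to the constant 6, and the change of [j] costs a factor at most
    [3/2]. The constant 6 is the one with [(6 + 2) * 3/2 = 2 * 6]. *)
Lemma card_primes_exp2_leq j : 0 < j -> j * size (primes_in 0 (2 ^ j)) <= 6 * 2 ^ j.
Proof.
elim: j => // -[_ _|j IHj _]; first by [].
have {IHj} := IHj isT; set a := size _ => IHj.
rewrite (@primes_in_cat 0 (2 ^ j.+1)) ?leq_exp2l // size_cat -/a.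
rewrite [2 ^ j.+2]expnS mul2n -addnn; set b := size _.
have : 2 ^ (j.+1 * b) <= 2 ^ (2 ^ j.+1 + 2 ^ j.+1).
  rewrite expnM; apply: leq_trans (bin_leq_exp2 _ (2 ^ j.+1)).
  apply: leq_trans (exp_card_primes_in (leqnn _)).
  by rewrite -/b; case: (b) => // b'; rewrite leq_exp2r.
rewrite leq_exp2l // => Hb.
have [j0|j0] := posnP j; last by nia.
have a1 : a <= 1 by rewrite /a j0; vm_compute.
have b2 : b <= 2 by rewrite /b j0; vm_compute.
by rewrite j0 /=; lia.
Qed.

Lemma card_primes_exp2_geq j : 0 < j -> 2 ^ j <= 2 * (j * size (primes_in 0 (2 ^ j))).
Proof.
case: j => // j _; have := bin_leq_exp_primes (_ : 0 < 2 ^ j).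
rewrite expn_gt0 => /(_ isT) /(leq_trans (leq_exp2_bin _)).
by rewrite -mul2n -expnS -expnM leq_exp2l // expnS; lia.
Qed.

(* The base 32 is large enough for crude Chebyshev bounds to give many primes in every block. *)
Definition block n := primes_in (32 ^ n) (32 ^ n.+1).

(** The bounds give at least [1.6 * 32 ^ n / n] primes up to the upper end, as [n + 1 <= 2 * n], and
    at most [1.2 * 32 ^ n / n] up to the lower end. *)
Lemma card_block n : 0 < n -> 2 * 32 ^ n <= 5 * (n * size (block n)).
Proof.
move=> n0; have := @card_primes_exp2_geq (5 * n.+1) isT.
have := @card_primes_exp2_leq (5 * n); rewrite muln_gt0 n0 => /(_ isT).
rewrite !expnM -[2 ^ 5]/32.
rewrite (@primes_in_cat 0 (32 ^ n) (32 ^ n.+1)) ?leq_exp2l // size_cat -/(block n).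
by rewrite [32 ^ n.+1]expnS; nia.
Qed.
End PrimeCounts.

(** * The Moebius function and the Turan-Kubilius inequality *)

Section Moebius.
Variable R : realType.
Implicit Types (N n m p : nat) (s t B : seq nat).

Lemma ler_sum_subset s t (F : nat -> R) : uniq s -> uniq t -> {subset s <= t} ->
  (forall x, x \in t -> 0 <= F x) -> \sum_(x <- s) F x <= \sum_(x <- t) F x.
Proof.
move=> us ut sst F0; rewrite [leRHS](bigID (mem s)) /= -[leLHS]addr0 lerD //.
  have perm : perm_eq [seq x <- t | x \in s] s.
    apply: uniq_perm; rewrite ?filter_uniq // => x.
    by rewrite mem_filter; case: (boolP (x \in s)) => // /sst ->.
  by rewrite -(perm_big _ perm) /= big_filter.
by rewrite big_seq_cond sumr_ge0 // => x /andP[xt _]; apply: F0.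
Qed.

Lemma sum_dvd (N d : nat) (F : nat -> R) : (0 < d)%N ->
  \sum_(1 <= n < N.+1 | (d %| n)%N) F n = \sum_(1 <= m < (N %/ d).+1) F (d * m)%N.
Proof.
move=> d0; elim: N => [|N IHN]; first by rewrite div0n !big_nil.
rewrite big_mkcond big_nat_recr //= -big_mkcond IHN divnS //.
have [dN|_] := boolP (d %| N.+1)%N; last by rewrite addr0.
rewrite [RHS]big_nat_recr //=; congr (_ + F _).
by have /eqP := dN; move: (divn_eq N.+1 d); rewrite divnS // dN; lia.
Qed.

Definition squarefree n := all (fun p => logn p n == 1%N) (primes n).

Definition mu n : R := if squarefree n then (-1) ^+ size (primes n) else 0.

Lemma mu1 : mu 1 = 1.
Proof. by rewrite /mu /squarefree /= expr0. Qed.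

Lemma normr_mu n : `|mu n| <= 1.
Proof. by rewrite /mu; case: ifP; rewrite ?normr0 // normrX normrN1 expr1n. Qed.

Lemma mu_prime_mul p m : prime p -> (0 < m)%N -> ~~ (p %| m)%N ->
  mu (p * m) = - mu m.
Proof.
move=> pp m0 pm; have p0 := prime_gt0 pp.
have pnm : p \notin primes m by rewrite mem_primes pp m0.
have perm : perm_eq (primes (p * m)) (p :: primes m).
  apply: uniq_perm => [||q]; rewrite ?primes_uniq //= ?pnm ?primes_uniq //.
  by rewrite primesM // primes_prime // !inE.
rewrite /mu /squarefree (perm_all _ perm) (perm_size perm) /=.
rewrite lognM // lognE pp p0 dvdnn divnn p0 logn1 lognE pp m0 /= (negbTE pm) eqxx /=.
rewrite (eq_in_all (a2 := fun q => logn q m == 1%N)); first by case: ifP; rewrite ?oppr0 // exprS mulN1r.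
move=> q qm /=; have qp : q != p by apply: contraNneq pnm => <-.
by rewrite lognM // logn_prime // (negbTE qp).
Qed.

Lemma mu_sqr_dvd p n : prime p -> (0 < n)%N -> (p * p %| n)%N -> mu n = 0.
Proof.
move=> pp n0 pn; rewrite /mu ifF //; apply/negbTE/allPn; exists p.
  by rewrite mem_primes pp n0 (dvdn_trans _ pn) ?dvdn_mulr.
have : (2 <= logn p n)%N by rewrite -pfactor_dvdn // expnS expn1.
by case: logn => [|[]].
Qed.

(** For [n > 1], multiplication by [p := pdiv n] pairs the divisors prime to [p] with those
    divisible by [p] exactly once and flips the sign; multiples of [p ^ 2] contribute 0. The range
    ends at [N], not [n], so that sums over [a] and [n] can be exchanged. *)
Lemma sum_mu_divisors N n : (0 < n <= N)%N ->
  \sum_(1 <= a < N.+1 | (a %| n)%N) mu a = (n == 1%N)%:R.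
Proof.
move=> /andP[n0 nN]; have [->|n1] := eqVneq n 1%N.
  have N1 : (1 < N.+1)%N by lia.
  rewrite (big_ltn_cond N1) dvd1n mu1 big1_seq ?addr0 // => a /andP[].
  by rewrite dvdn1 mem_index_iota => /eqP ->.
have pp : prime (pdiv n) by apply: pdiv_prime; lia.
move: (pdiv_dvd n) pp; set p := pdiv n => pn pp; have p0 := prime_gt0 pp.
pose F a := if (a %| n)%N then mu a else 0.
rewrite big_mkcond (bigID (fun a => (p %| a)%N)) /= sum_dvd //.
rewrite (eq_big_seq (fun m => if ~~ (p %| m)%N then - F m else 0)); last first.
  move=> m; rewrite mem_index_iota => /andP[m0 _]; rewrite /F.
  case: (boolP (p %| m)%N) => pm /=.
    by rewrite (@mu_sqr_dvd p) ?dvdn_mul // ?muln_gt0 ?p0 //; case: ifP.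
  rewrite mu_prime_mul // Gauss_dvd ?prime_coprime // pn /=.
  by case: ifP; rewrite ?oppr0.
rewrite -big_mkcond sumrN /=.
have le1 : (1 <= (N %/ p).+1)%N by [].
have le2 : ((N %/ p).+1 <= N.+1)%N by rewrite ltnS leq_div.
rewrite (big_cat_nat (m := 1%N) (n := (N %/ p).+1) (p := N.+1)) //=.
rewrite [X in _ + (_ + X)]big1_seq ?addr0 ?addNr // => a /andP[pa].
rewrite mem_index_iota ltn_divLR // => /andP[Na _]; rewrite /F; case: ifP => // an.
have := dvdn_leq n0 (_ : p * a %| n)%N.
by rewrite Gauss_dvd ?prime_coprime // pn an => /(_ isT); lia.
Qed.

Definition mertens N : R := \sum_(1 <= n < N.+1) mu n.

Lemma mertensS N : mertens N.+1 = mertens N + mu N.+1.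
Proof. by rewrite /mertens big_nat_recr. Qed.

Lemma normr_mertens N : `|mertens N| <= N%:R.
Proof.
elim: N => [|N IHN]; first by rewrite /mertens big_nil normr0.
by rewrite mertensS -natr1 (le_trans (ler_normD _ _)) // lerD // normr_mu.
Qed.

Lemma normr_mertensB a b : (a <= b)%N -> `|mertens b - mertens a| <= b%:R - a%:R.
Proof.
move=> ab; rewrite -(subnKC ab); elim: (b - a)%N => [|d IHd].
  by rewrite addn0 !subrr normr0.
rewrite addnS mertensS -natr1 addrAC (le_trans (ler_normD _ _)) //.
by rewrite [leRHS]addrAC lerD // normr_mu.
Qed.

Definition mean_mu N : R := mertens N / N%:R.

Lemma normr_mean_mu N : `|mean_mu N| <= 1.
Proof.
case: N => [|N]; first by rewrite /mean_mu invr0 mulr0 normr0.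
rewrite /mean_mu normrM normfV [`|_%:R|]ger0_norm ?ler0n //.
by rewrite ler_pdivrMr ?ltr0Sn // mul1r normr_mertens.
Qed.

(** This slow variation carries information from the moduli of a chain to all points between
    consecutive ones. *)
Lemma mean_mu_lipschitz a b : (0 < a)%N -> (a <= b)%N ->
  `|mean_mu a - mean_mu b| <= 2 * (1 - a%:R / b%:R).
Proof.
move=> a0 ab; have a0' : 0 < a%:R :> R by rewrite ltr0n.
have b0 : 0 < b%:R :> R by rewrite ltr0n (leq_trans a0).
have := normr_mean_mu a; have := normr_mertensB ab; rewrite /mean_mu => Hd Hm.
have -> : mertens a / a%:R - mertens b / b%:R =
  (mertens a / a%:R) * (1 - a%:R / b%:R) - (mertens b - mertens a) / b%:R.
  by field; rewrite !gt_eqF.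
apply: le_trans (ler_normB _ _) _; rewrite [leRHS]mulrDl !mul1r lerD //.
  have h0 : 0 <= 1 - a%:R / b%:R :> R by rewrite subr_ge0 ler_pdivrMr // mul1r ler_nat.
  by rewrite normrM (ger0_norm h0) ler_piMl.
rewrite normrM normfV (gtr0_norm b0) ler_pdivrMr //.
by rewrite mulrBl mul1r divfK ?gt_eqF.
Qed.

Lemma sum_inv_sqr s : uniq s -> (forall p, p \in s -> (1 < p)%N) ->
  \sum_(p <- s) (p%:R ^- 2 : R) <= 1.
Proof.
move=> us s2; pose M := (\max_(p <- s) p).+2.
have sM : {subset s <= index_iota 2 M}.
  by move=> p ps; rewrite mem_index_iota s2 // ltnW // ltnS ltnS; apply: leq_bigmax_seq.
apply: le_trans (ler_sum_subset us (iota_uniq _ _) sM _) _.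
  by move=> x _; rewrite invr_ge0 exprn_ge0.
suff H n : \sum_(2 <= p < n.+2) (p%:R ^- 2 : R) <= 1 - n.+1%:R^-1.
  by apply: le_trans (H _) _; rewrite gerBl invr_ge0.
elim: n => [|n IHn]; first by rewrite big_nil invr1 subrr.
rewrite big_nat_recr //= (le_trans (lerD IHn (lexx _))) //.
have n1 : 0 < n.+1%:R :> R by [].
rewrite -[n.+2]addn1 natrD; move: (n.+1%:R) n1 => x x0.
rewrite -subr_ge0; have -> : 1 - (x + 1)^-1 - (1 - x^-1 + (x + 1) ^- 2) = (x * (x + 1) ^+ 2)^-1.
  by field; rewrite !gt_eqF // addr_gt0.
by rewrite invr_ge0 mulr_ge0 ?exprn_ge0 ?addr_ge0 // ltW.
Qed.


Lemma sum_dvd_cst N d : (0 < d)%N ->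
  \sum_(1 <= n < N.+1) (d %| n)%:R = (N %/ d)%:R :> R.
Proof.
move=> d0; have := @sum_dvd N d (fun=> 1) d0; rewrite sumr_const_nat subn1 => <-.
by rewrite [RHS]big_mkcond; apply: eq_bigr => n _; case: (d %| n)%N.
Qed.

Lemma ler_divn N d : (N %/ d)%:R <= N%:R / d%:R :> R.
Proof.
have [->|d0] := posnP d; first by rewrite divn0 invr0 mulr0.
by rewrite ler_pdivlMr ?ltr0n // -natrM ler_nat leq_divM.
Qed.

Lemma ltr_divn N d : (0 < d)%N -> N%:R / d%:R - 1 < (N %/ d)%:R :> R.
Proof.
move=> d0; rewrite ltrBlDr natr1 ltr_pdivrMr ?ltr0n // -natrM ltr_nat.
exact: ltn_ceil.
Qed.

End Moebius.

Section TuranKubilius.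
Variable R : realType.
Implicit Types (N n m p : nat) (s t B : seq nat).

(** The main terms [N / (p * q)] cancel, and only the fractional parts of [N / (p * q)], [N / p] and
    [N / q] remain, the last two with weights at most [1/2]. *)
Lemma covar_dvd N p q : prime p -> prime q -> p != q ->
  `|\sum_(1 <= n < N.+1) ((p %| n)%:R - p%:R^-1) * ((q %| n)%:R - q%:R^-1)| <= 1 :> R.
Proof.
move=> pp qq pq; have p0 := prime_gt0 pp; have q0 := prime_gt0 qq.
have -> : \sum_(1 <= n < N.+1) ((p %| n)%:R - p%:R^-1) * ((q %| n)%:R - q%:R^-1) =
  \sum_(1 <= n < N.+1) ((p * q %| n)%:R - q%:R^-1 * (p %| n)%:R
     - p%:R^-1 * (q %| n)%:R + p%:R^-1 * q%:R^-1) :> R.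
  apply: eq_bigr => n _; rewrite Gauss_dvd; last first.
    by rewrite prime_coprime // dvdn_prime2.
  by rewrite -mulnb natrM; ring.
rewrite big_split /= !sumrB -!mulr_sumr !sum_dvd_cst ?muln_gt0 ?p0 //.
rewrite sumr_const_nat subn1 /=.
have p2 : p%:R^-1 <= 2^-1 :> R by rewrite lef_pV2 ?posrE ?ltr0n // ler_nat prime_gt1.
have q2 : q%:R^-1 <= 2^-1 :> R by rewrite lef_pV2 ?posrE ?ltr0n // ler_nat prime_gt1.
have := ler_divn R N (p * q); have := @ltr_divn R N (p * q).
rewrite muln_gt0 p0 q0 => /(_ isT).
have := ler_divn R N p; have := @ltr_divn R N p p0.
have := ler_divn R N q; have := @ltr_divn R N q q0.
rewrite (_ : q%:R^-1 *+ N = N%:R * q%:R^-1); last by rewrite mulr_natl.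
rewrite natrM invfM.
have ip : 0 < p%:R^-1 :> R by rewrite invr_gt0 ltr0n.
have iq : 0 < q%:R^-1 :> R by rewrite invr_gt0 ltr0n.
move: (_ %/ _)%:R (_ %/ _)%:R (_ %/ _)%:R ip iq p2 q2 => /= a b c.
move: p%:R^-1 q%:R^-1 => x y x0 y0 x2 y2 h1 h2 h3 h4 h5 h6.
rewrite ler_norml; apply/andP; split; nra.
Qed.

Lemma var_dvd N p : prime p ->
  \sum_(1 <= n < N.+1) ((p %| n)%:R - p%:R^-1) ^+ 2 <= N%:R / p%:R :> R.
Proof.
move=> pp; have p0 := prime_gt0 pp.
have -> : \sum_(1 <= n < N.+1) ((p %| n)%:R - p%:R^-1) ^+ 2 =
  \sum_(1 <= n < N.+1) ((1 - 2 * p%:R^-1) * (p %| n)%:R + p%:R^-1 ^+ 2) :> R.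
  by apply: eq_bigr => n _; case: (p %| n)%N => /=; ring.
rewrite big_split /= -!mulr_sumr !sum_dvd_cst ?p0 // sumr_const_nat subn1 /=.
have p2 : p%:R^-1 <= 2^-1 :> R by rewrite lef_pV2 ?posrE ?ltr0n // ler_nat prime_gt1.
have := ler_divn R N p; have ip : 0 < p%:R^-1 :> R by rewrite invr_gt0 ltr0n.
rewrite (_ : p%:R^-1 *+ N = N%:R * p%:R^-1); last by rewrite mulr_natl.
have : 0 <= N%:R :> R by [].
move: (_ %/ _)%:R N%:R p%:R^-1 ip p2 => a b x x0 x2 b0 h.
have : 0 <= (1 - 2 * x) * (b * x - a) by rewrite mulr_ge0 // ?subr_ge0 //; lra.
have : 0 <= b * x ^+ 2 by rewrite mulr_ge0 ?sqr_ge0.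
by lra.
Qed.

(** Expansion of the square: the diagonal is controlled by [var_dvd], and each of the at most
    [size B ^ 2] covariances by 1. The weights [c] leave room for a later choice of signs. *)
Lemma turan_kubilius N B (c : nat -> R) : uniq B -> (forall p, p \in B -> prime p) ->
  (forall p, `|c p| <= 1) ->
  \sum_(1 <= n < N.+1) (\sum_(p <- B) c p * ((p %| n)%:R - p%:R^-1)) ^+ 2
  <= N%:R * (\sum_(p <- B) p%:R^-1) + (size B)%:R ^+ 2.
Proof.
move=> uB pB c1.
have -> : \sum_(1 <= n < N.+1) (\sum_(p <- B) c p * ((p %| n)%:R - p%:R^-1)) ^+ 2 =
  \sum_(p <- B) \sum_(q <- B) c p * c q *
    \sum_(1 <= n < N.+1) ((p %| n)%:R - p%:R^-1) * ((q %| n)%:R - q%:R^-1).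
  under eq_bigr do rewrite expr2 big_distrl /=.
  rewrite exchange_big /=; apply: eq_bigr => p _.
  under eq_bigr do rewrite big_distrr /=.
  rewrite exchange_big /=; apply: eq_bigr => q _.
  by rewrite big_distrr /=; apply: eq_bigr => n _; ring.
apply: (@le_trans _ _ (\sum_(p <- B) (N%:R / p%:R + (size B)%:R))); last first.
  rewrite big_split /= -mulr_sumr lerD // big_const_seq count_predT.
  by rewrite iter_addr_0 expr2 mulr_natr.
rewrite big_seq [leRHS]big_seq; apply: ler_sum => p pinB.
rewrite (bigD1_seq p) //= lerD //.
  rewrite -[leRHS]mul1r; under eq_bigr do rewrite -expr2.
  have := @var_dvd N p (pB p pinB); set S := bigop _ _ _ => hS.
  have S0 : 0 <= S by apply: sumr_ge0 => n _; rewrite sqr_ge0.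
  apply: le_trans (ler_norm _) _; rewrite !normrM (ger0_norm S0).
  by rewrite ler_pM // ?mulr_ge0 // mulr_ile1.
apply: le_trans (ler_norm _) _; apply: le_trans (ler_norm_sum _ _ _) _.
apply: (@le_trans _ _ (\sum_(q <- B) (1 : R))); last first.
  by rewrite big_const_seq count_predT iter_addr_0.
rewrite big_mkcond /= big_seq [leRHS]big_seq; apply: ler_sum => q qinB.
case: ifP => // qp; rewrite !normrM mulr_ile1 ?mulr_ge0 ?mulr_ile1 //.
by rewrite covar_dvd ?pB // eq_sym.
Qed.

(** [mu (p * m) = - mu m] unless [p] divides [m]; the exceptions correspond to the multiples of
    [p ^ 2] up to [N]. *)
Lemma sum_mu_multiples N p : prime p ->
  `|\sum_(1 <= n < N.+1) mu R n * (p %| n)%:R + mertens R (N %/ p)| <= N%:R * p%:R ^- 2.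
Proof.
move=> pp; have p0 := prime_gt0 pp.
have -> : \sum_(1 <= n < N.+1) mu R n * (p %| n)%:R =
   \sum_(1 <= m < (N %/ p).+1) mu R (p * m).
  rewrite -sum_dvd // [RHS]big_mkcond; apply: eq_bigr => n _.
  by case: ifP => _; rewrite ?mulr1 ?mulr0.
rewrite /mertens -big_split /=; apply: (@le_trans _ _ (N %/ p %/ p)%:R); last first.
  by rewrite -divnMA expr2 -natrM ler_divn.
rewrite -sum_dvd_cst //; apply: le_trans (ler_norm_sum _ _ _) _.
rewrite big_seq [leRHS]big_seq; apply: ler_sum => m; rewrite mem_index_iota => /andP[m0 _].
have [pm|pm] := boolP (p %| m)%N; last by rewrite mu_prime_mul // addNr normr0.
by rewrite (@mu_sqr_dvd R p) ?dvdn_mul // ?muln_gt0 ?p0 // add0r normr_mu.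
Qed.

Lemma sum_mertens_div N B : uniq B -> (forall p, p \in B -> prime p) ->
  (size B ^ 2 <= N)%N ->
  \sum_(p <- B) `|mertens R N / p%:R + mertens R (N %/ p)| <=
  N%:R * (Num.sqrt (\sum_(p <- B) p%:R^-1 + 1) + 1).
Proof.
move=> uB pB BN; set L : R := \sum_(p <- B) p%:R^-1; set t := Num.sqrt _.
have L0 : 0 <= L by apply: sumr_ge0.
have t0 : 0 < t by rewrite sqrtr_gt0; lra.
have t2 : t ^+ 2 = L + 1 by rewrite sqr_sqrtr //; lra.
pose X p := mertens R N / p%:R + mertens R (N %/ p).
(* Duality: with these signs the sum of absolute values becomes a single correlation of [mu] with
   [w], up to the error of [sum_mu_multiples]. *)
pose c p := - Num.sg (X p).
pose w n : R := \sum_(p <- B) c p * ((p %| n)%:R - p%:R^-1).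
pose S p := \sum_(1 <= n < N.+1) mu R n * (p %| n)%:R.
have c1 p : `|c p| <= 1 by rewrite normrN normr_sg; case: (X p != 0).
have muw : \sum_(1 <= n < N.+1) mu R n * w n <= N%:R * t.
  have Hw := @turan_kubilius N B c uB pB c1.
  (* The inequality [|w| <= t / 2 + w ^ 2 / (2 * t)] replaces Cauchy-Schwarz; [t] is the bound of
     Turan-Kubilius for the root mean square of [w]. *)
  apply: (@le_trans _ _ (\sum_(1 <= n < N.+1) (t / 2 + w n ^+ 2 / (2 * t)))).
    apply: ler_sum => n _; apply: (@le_trans _ _ `|w n|).
      by apply: le_trans (ler_norm _) _; rewrite normrM ler_piMl ?normr_mu.
    rewrite -[w n ^+ 2]real_normK ?num_real // -subr_ge0.
    have -> : t / 2 + `|w n| ^+ 2 / (2 * t) - `|w n| = (t - `|w n|) ^+ 2 / (2 * t).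
      by field; rewrite gt_eqF.
    by rewrite divr_ge0 ?sqr_ge0 // mulr_ge0 // ltW.
  rewrite big_split /= sumr_const_nat subn1 /=.
  have : \sum_(1 <= n < N.+1) w n ^+ 2 / (2 * t) <= N%:R * t / 2.
    rewrite -mulr_suml ler_pdivrMr; last by rewrite mulr_gt0.
    have -> : N%:R * t / 2 * (2 * t) = N%:R * t ^+ 2 by field.
    rewrite t2 mulrDr mulr1; apply: le_trans Hw _; rewrite lerD // -natrX ler_nat //.
  rewrite (_ : t / 2 *+ N = N%:R * (t / 2)); last by rewrite mulr_natl.
  by move: (bigop _ _ _) => a; lra.
have -> : \sum_(p <- B) `|mertens R N / p%:R + mertens R (N %/ p)| =
   \sum_(1 <= n < N.+1) mu R n * w n - \sum_(p <- B) c p * (S p + mertens R (N %/ p)).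
  have -> : \sum_(1 <= n < N.+1) mu R n * w n =
      \sum_(p <- B) c p * (S p - mertens R N / p%:R).
    under eq_bigr do rewrite big_distrr /=.
    rewrite exchange_big /=; apply: eq_bigr => p _.
    rewrite /S /mertens [_ / p%:R]mulr_suml -sumrB big_distrr /=.
    by apply: eq_bigr => n _; ring.
  rewrite -sumrB; apply: eq_bigr => p _; rewrite -/(X p) normrEsg /c /X; ring.
rewrite mulrDr mulr1 -[X in _ <= _ + X]opprK lerB //.
rewrite -[N%:R]mulr1; apply: le_trans (_ : - (N%:R * \sum_(p <- B) p%:R ^- 2) <= _).
  by rewrite lerN2 ler_wpM2l // sum_inv_sqr // => p /pB /prime_gt1.
rewrite lerNl mulr_sumr -sumrN big_seq [leRHS]big_seq; apply: ler_sum => p /pB pp.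
apply: le_trans (ler_norm _) _; rewrite normrN normrM.
by apply: le_trans (sum_mu_multiples N pp); rewrite ler_piMl.
Qed.

(** Passing from [N / p] to its integer part costs at most [1 / N] for each prime, altogether at
    most 1. *)
Lemma sum_mean_mu_div N B : (0 < N)%N -> uniq B -> (forall p, p \in B -> prime p) ->
  (size B ^ 2 <= N)%N ->
  \sum_(p <- B) p%:R^-1 * `|mean_mu R N + mean_mu R (N %/ p)| <=
  Num.sqrt (\sum_(p <- B) p%:R^-1 + 1) + 2.
Proof.
move=> N0 uB pB BN; have N0' : 0 < N%:R :> R by rewrite ltr0n.
have := sum_mertens_div uB pB BN; rewrite mulrC -ler_pdivrMr // mulr_suml => H.
apply: le_trans (_ : \sum_(p <- B) (`|mertens R N / p%:R + mertens R (N %/ p)| / N%:R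
   + N%:R^-1) <= _); last first.
  rewrite big_split /= [2]mulr2n addrA lerD // big_const_seq count_predT iter_addr_0.
  rewrite -[leLHS]mulr_natl ler_pdivrMr // mul1r ler_nat.
  by apply: leq_trans BN; case: (size B) => // b; rewrite expnS expn1 leq_pmulr.
rewrite big_seq [leRHS]big_seq; apply: ler_sum => p /pB pp; have p0 := prime_gt0 pp.
have p0' : 0 < p%:R :> R by rewrite ltr0n.
rewrite -[p%:R^-1 in leLHS]ger0_norm ?invr_ge0 // -normrM.
have -> : `|mertens R N / p%:R + mertens R (N %/ p)| / N%:R =
  `|(mertens R N / p%:R + mertens R (N %/ p)) / N%:R|.
  by rewrite normrM normfV (gtr0_norm N0').
have -> : p%:R^-1 * (mean_mu R N + mean_mu R (N %/ p)) =
  (mertens R N / p%:R + mertens R (N %/ p)) / N%:R +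
   mean_mu R (N %/ p) * (N%:R / p%:R - (N %/ p)%:R) / N%:R.
  have [E|q0] := posnP (N %/ p)%N.
    rewrite E /mean_mu /mertens big_nil !mul0r; field.
    by rewrite !gt_eqF.
  by rewrite /mean_mu; field; rewrite !gt_eqF // ltr0n.
apply: le_trans (ler_normD _ _) _; rewrite lerD // normrM normfV (gtr0_norm N0').
rewrite ler_piMl ?invr_ge0 // normrM.
rewrite mulr_ile1 ?normr_mean_mu // ger0_norm ?subr_ge0 ?ler_divn //.
by rewrite lerBlDl -lerBlDr ltW // ltr_divn.
Qed.
End TuranKubilius.

(** * Primes in short intervals *)

Section ShortIntervals.
Variable R : realType.

Lemma ln2_ge : 2^-1 <= ln 2 :> R.
Proof.
have -> : ln 2 = - ln (1 + (- 2^-1)) :> R.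
  have -> : 1 + - 2^-1 = 2^-1 :> R by field.
  by rewrite lnV ?opprK // posrE.
by rewrite lerNr le_ln1Dx //; lra.
Qed.

(** The right-hand side is [D ^ Y] times the expansion of [(1 + 1/D) ^ a], of which one term is
    kept. *)
Lemma bin_leq_pow (a Y D : nat) : (0 < D)%N -> 
  'C(a, Y)%:R <= (1 + D%:R^-1) ^+ a * D%:R ^+ Y :> R.
Proof.
move=> D0; have D0' : 0 < D%:R :> R by rewrite ltr0n.
have [le|lt] := leqP Y a; last by rewrite bin_small // mulr_ge0 ?exprn_ge0 ?addr_ge0.
rewrite -ler_pdivrMr ?exprn_gt0 // exprDn (bigD1 (Ordinal (le : Y < a.+1)%N)) //=.
rewrite expr1n mul1r -[leLHS]addr0 lerD //.
  by rewrite exprVn -[leRHS]mulr_natl.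
by rewrite sumr_ge0 // => i _; rewrite mulrn_wge0 // mulr_ge0 ?exprn_ge0.
Qed.

Lemma ln_natr_le (m : nat) : (0 < m)%N -> ln m%:R <= m%:R - 1 :> R.
Proof.
move=> m0; have := @le_ln1Dx R (m%:R - 1); rewrite (addrC 1) subrK; apply.
by rewrite ltrBrDr addNr ltr0n.
Qed.

(** A bound of Brun-Titchmarsh type from the binomial coefficient. The interval has relative length
    [1 / m ^ 2] so that the logarithmic loss, estimated by [ln m <= m - 1], still leaves a saving of
    [m]. *)
Lemma card_short_interval m n X : (0 < m)%N -> (0 < n)%N ->
  (32 ^ n <= X <= 32 ^ n.+1)%N ->
  (n * size (primes_in X (X + X %/ m ^ 2)) * m <= 128 * 32 ^ n)%N.
Proof.
move=> m0 n0 /andP[Xl Xu]; set s := size _.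
have X0 : (0 < X)%N by apply: leq_trans Xl; rewrite expn_gt0.
have D0 : (0 < m ^ 2)%N by rewrite expn_gt0 m0.
have m0' : 0 < m%:R :> R by rewrite ltr0n.
have X0' : 0 < X%:R :> R by rewrite ltr0n.
have := exp_card_primes_in (leq_div X (m ^ 2)); rewrite -/s; set Y := (X %/ _)%N.
rewrite -(ler_nat R) => /le_trans/(_ (bin_leq_pow _ _ D0)) H.
have : (s%:R * (n%:R * ln 32)) <= X%:R / (m ^ 2)%:R * (2 + 2 * ln m%:R) :> R.
  apply: (@le_trans _ _ (ln ((X.+1 ^ s)%:R))).
    rewrite natrX lnXn ?ltr0Sn // -[leRHS]mulr_natl ler_wpM2l //.
    rewrite mulr_natl -lnXn // -natrX ler_ln ?posrE ?ltr0n ?expn_gt0 // ler_nat.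
    by apply: leq_trans Xl _.
  move: H; set d : R := (m ^ 2)%:R => H.
  have d0 : 0 < d by rewrite ltr0n.
  have d1 : 0 < 1 + d^-1 by rewrite addr_gt0 // invr_gt0.
  have lnd : ln d = 2 * ln m%:R by rewrite /d natrX lnXn // mulr_natl.
  apply: (@le_trans _ _ (ln ((1 + d^-1) ^+ (X + Y) * d ^+ Y))).
    by rewrite ler_ln ?posrE ?ltr0n ?expn_gt0 // mulr_gt0 ?exprn_gt0.
  rewrite lnM ?posrE ?exprn_gt0 // !lnXn // lnd.
  rewrite -[_ *+ (X + Y)]mulr_natl -[_ *+ Y]mulr_natl.
  have Y1 : Y%:R <= X%:R / d :> R by apply: ler_divn.
  have Y2 : (X + Y)%:R <= 2 * X%:R :> R.
    by rewrite -natrM ler_nat mulSn mul1n leq_add2l leq_div.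
  have lnm : 0 <= ln m%:R :> R by rewrite ln_ge0 // ler1n.
  have l1 : ln (1 + d^-1) <= d^-1.
    by rewrite le_ln1Dx //; apply: (@lt_trans _ _ 0); rewrite ?ltrN10 ?invr_gt0.
  have : (X + Y)%:R * ln (1 + d^-1) <= 2 * X%:R * d^-1.
    apply: le_trans (_ : (X + Y)%:R * d^-1 <= _); first by rewrite ler_wpM2l.
    by rewrite ler_wpM2r // invr_ge0 ltW.
  have : Y%:R * (2 * ln m%:R) <= X%:R / d * (2 * ln m%:R).
    by rewrite ler_wpM2r // mulr_ge0.
  move=> h1 h2; apply: le_trans (lerD h2 h1) _.
  by rewrite le_eqVlt; apply/orP; left; apply/eqP; ring.
have := @ln_natr_le m m0; have := ln2_ge; rewrite (natrX R m 2).
have -> : ln 32 = 5 * ln 2 :> R.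
  by rewrite mulr_natl -lnXn //; congr ln; rewrite -natrX.
move=> l2 lm H2; rewrite -(ler_nat R) !natrM.
have H3 : s%:R * n%:R * (5 / 2) <= X%:R / m%:R ^+ 2 * (2 * m%:R) :> R.
  apply: le_trans (_ : s%:R * (n%:R * (5 * ln 2)) <= _).
    by rewrite -mulrA ler_wpM2l // ler_wpM2l //; lra.
  apply: le_trans H2 _; rewrite ler_wpM2l ?divr_ge0 ?exprn_ge0 //; lra.
have : X%:R <= 32 * 32 ^+ n :> R by rewrite -exprS -natrX ler_nat.
move: H3; have -> : X%:R / m%:R ^+ 2 * (2 * m%:R) = 2 * X%:R / m%:R :> R.
  by field; rewrite gt_eqF.
by rewrite ler_pdivlMr // natrX; move: (32 ^+ n) => a; lra.
Qed.
End ShortIntervals.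

(** * Pairs of primes with ratio close to 1 *)

Section Clusters.
Variable R : realType.
Local Open Scope nat_scope.

Lemma size_sum_filter (s : seq nat) (t : nat -> nat) T :
  (forall p, p \in s -> t p < T) ->
  size s = \sum_(i < T) size [seq p <- s | t p == i].
Proof.
elim: s => [|p s IHs] tT; first by rewrite big1.
under eq_bigr do rewrite /= (fun_if size) /=.
have pT : t p < T by rewrite tT ?mem_head.
rewrite (bigD1 (Ordinal pT)) //= eqxx IHs; last by move=> q qs; rewrite tT // inE qs orbT.
rewrite [in LHS](bigD1 (Ordinal pT)) //= addSn; congr (_ + _).+1.
by apply: eq_bigr => i; rewrite eq_sym -val_eqE /= => /negbTE->.
Qed.

(* Cut the block into intervals of length [32 ^ n / E]: one of them contains many
   elements of [G], too many for all of them to be very close to the smallest one. *)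
Lemma exists_close_primes E : 0 < E -> exists D n0, [/\ 0 < D, 0 < n0 &
  forall n (G : seq nat), n0 <= n -> uniq G -> {subset G <= block n} ->
    32 ^ n <= 5 * n * size G ->
  exists p q, [/\ p \in G, q \in G, p < q, E * (q - p) <= p & p <= D * (q - p)]].
Proof.
(* There are [(32 * E).+1] intervals. With this [m], the bounds for all of them together account for
   only half of the [32 ^ n / (5 * n)] elements of [G], apart from one element in each interval;
   these are too few once [10 * (32 * E).+1 * n < 32 ^ n]. *)
move=> E0; pose m := 10 * (32 * E).+1 * 128; exists (m ^ 2), (maxn E 3).
split; rewrite ?expn_gt0 // ?leq_max ?orbT //.
move=> n G; rewrite geq_max => /andP[En n3] uG Gn nG; apply: contrapT => nex.
have blockP p : p \in G -> [/\ prime p, 32 ^ n < p & p <= 32 * 32 ^ n].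
  by move/Gn; rewrite mem_primes_in expnS => /and3P[].
pose t p := (p * E) %/ 32 ^ n.
have X0 : 0 < 32 ^ n by rewrite expn_gt0.
have tT p : p \in G -> t p < (32 * E).+1.
  by move/blockP => [_ _ pu]; rewrite ltnS /t -(mulnK (32 * E) X0) leq_div2r //; nia.
have Gi i : n * size [seq p <- G | t p == i] * m <= n * m + 128 * 32 ^ n.
  set Gt := [seq p <- G | t p == i].
  have [->|[x0 x0G]] : Gt = [::] \/ exists x0, x0 \in Gt.
  - by case: (Gt) => [|x0 s]; [left | right; exists x0; rewrite mem_head].
  - by rewrite muln0.
  have exG : exists x, x \in Gt by exists x0.
  case: (ex_minnP exG) => x xGt xmin.
  have {x0 x0G exG}: size Gt <= size (x :: primes_in x (x + x %/ m ^ 2)).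
    rewrite uniq_leq_size ?filter_uniq // => q qGt; rewrite inE.
    have [//|qx] := eqVneq q x; rewrite /= mem_primes_in.
    have := xGt; have := qGt; rewrite !mem_filter => /andP[/eqP tq qG] /andP[/eqP tx xG].
    have xq : x < q by have := xmin _ qGt; lia.
    have [qp ql qu] := blockP q qG; have [_ xl xu] := blockP x xG.
    rewrite qp xq /= leqNgt; apply/negP => far; apply: nex; exists x, q.
    split => //.
      have := ltn_ceil (q * E) X0; rewrite -/(t q) tq.
      have := leq_divM (x * E) (32 ^ n); rewrite -/(t x) tx mulnBr; nia.
    have : x %/ m ^ 2 < q - x by lia.
    by rewrite ltn_divLR ?expn_gt0 // mulnC; apply: ltnW.
  have := @card_short_interval R m n x isT (leq_trans (isT : 0 < 3) n3).
  have := xGt; rewrite mem_filter => /andP[_ /blockP[_ xl xu]].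
  rewrite (ltnW xl) expnS xu => /(_ isT) /=; set u := size (primes_in _ _).
  by move=> h1 h2; nia.
have : n * size G * m <= (32 * E).+1 * (n * m + 128 * 32 ^ n).
  rewrite (size_sum_filter tT) big_distrr big_distrl /=.
  apply: leq_trans (_ : \sum_(i < (32 * E).+1) (n * m + 128 * 32 ^ n) <= _).
    by apply: leq_sum => i _; apply: Gi.
  by rewrite sum_nat_const card_ord.
have : 10 * (32 * E).+1 * n < 32 ^ n.
  apply: (@leq_ltn_trans (330 * n * n)); first by nia.
  have -> : n = (n - 3) + 3 by lia.
  elim: (n - 3) => // j IHj; rewrite addSn expnS; nia.
rewrite /m; set X := 32 ^ n in nG *; set W := (32 * E).+1; set g := size G in nG * => h1 h2.
have : n * g * 10 * 128 <= n * (10 * W * 128) + 128 * X.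
  by rewrite -(leq_pmul2l (ltn0Sn (32 * E))) -/W; nia.
nia.
Qed.
End Clusters.

(** * Divergence of the sum of the reciprocals of the primes *)

Section Divergence.
Variable R : realType.

Lemma ln_succB_le n : (0 < n)%N -> ln n.+1%:R - ln n%:R <= n%:R^-1 :> R.
Proof.
move=> n0; have n0' : 0 < n%:R :> R by rewrite ltr0n.
rewrite -ln_div ?posrE ?ltr0n // -natr1 mulrDl divff ?gt_eqF // mul1r le_ln1Dx //.
by apply: (@lt_trans _ _ 0); rewrite ?ltrN10 ?invr_gt0.
Qed.

Lemma ln_succB_ge n : (0 < n)%N -> n.+1%:R^-1 <= ln n.+1%:R - ln n%:R :> R.
Proof.
move=> n0; have n0' : 0 < n%:R :> R by rewrite ltr0n.
rewrite -opprB lerNr -ln_div ?posrE ?ltr0n //.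
have -> : n%:R / n.+1%:R = 1 + - n.+1%:R^-1 :> R.
  by rewrite -natr1; field; rewrite natr1 pnatr_eq0.
by rewrite le_ln1Dx // ltrN2 invf_lt1 ?ltr0n // ltr1n.
Qed.

Lemma sum_inv_ge_ln a b : (0 < a)%N -> (a <= b)%N ->
  ln b%:R - ln a%:R <= \sum_(a <= n < b) n%:R^-1 :> R.
Proof.
move=> a0 ab; rewrite -(subnKC ab); elim: (b - a)%N => [|d IHd].
  by rewrite addn0 subrr big_geq.
rewrite addnS big_nat_recr ?leq_addr //=.
have := @ln_succB_le (a + d); rewrite addn_gt0 a0 => /(_ isT); lra.
Qed.

Lemma sum_inv_block_ge n : (0 < n)%N -> (80 * n)%:R^-1 <= \sum_(p <- block n) p%:R^-1 :> R.
Proof.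
move=> n0; have := card_block n0; set s := size _ => Hs.
apply: le_trans (_ : \sum_(p <- block n) (32 ^ n.+1)%:R^-1 <= _); last first.
  rewrite big_seq [leRHS]big_seq; apply: ler_sum => p; rewrite mem_primes_in => /and3P[pp _ pu].
  by rewrite lef_pV2 ?posrE ?ltr0n ?expn_gt0 ?(prime_gt0 pp) // ler_nat.
rewrite big_const_seq count_predT iter_addr_0 -[leRHS]mulr_natl -/s.
rewrite -(@ler_pM2r _ ((80 * n)%:R * (32 ^ n.+1)%:R)) ?mulr_gt0 ?ltr0n ?muln_gt0 ?n0 ?expn_gt0 //.
rewrite mulKf ?pnatr_eq0 ?muln_eq0; last by rewrite -lt0n n0.
rewrite mulrCA divfK ?pnatr_eq0 ?expn_eq0 // -natrM ler_nat expnS; nia.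
Qed.

Lemma sum_inv_primes_in n0 n1 (F : nat -> R) : (n0 <= n1)%N ->
  \sum_(p <- primes_in (32 ^ n0) (32 ^ n1)) F p =
  \sum_(n0 <= n < n1) \sum_(p <- block n) F p.
Proof.
move=> le; rewrite -(subnKC le); elim: (n1 - n0)%N => [|d IHd].
  rewrite addn0 [RHS]big_geq // big1_seq // => p /andP[_].
  by rewrite mem_primes_in => /and3P[_ ?]; lia.
rewrite addnS big_nat_recr ?leq_addr //= -IHd.
by rewrite (@primes_in_cat _ (32 ^ (n0 + d))) ?leq_exp2l ?leq_addr ?leqnSn // big_cat.
Qed.

(** The block of index [n] contributes at least [1 / (80 * n)], and the harmonic series diverges. *)
Lemma sum_inv_primes_unbounded n0 (L : R) : (0 < n0)%N -> exists n1, (n0 <= n1)%N /\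
  L <= \sum_(p <- primes_in (32 ^ n0) (32 ^ n1)) p%:R^-1.
Proof.
move=> n00; pose x := expR (80 * `|L| + ln n0%:R).
have x0 : 0 < x by apply: expR_gt0.
pose n1 := maxn n0 (Num.truncn x).+1; exists n1; rewrite leq_maxl; split => //.
rewrite sum_inv_primes_in ?leq_maxl //.
apply: le_trans (_ : \sum_(n0 <= n < n1) 80^-1 * n%:R^-1 <= _); last first.
  rewrite big_seq [leRHS]big_seq; apply: ler_sum => n.
  rewrite mem_index_iota => /andP[nn _]; rewrite -invfM -natrM.
  by apply: sum_inv_block_ge; apply: leq_trans nn.
rewrite -mulr_sumr -ler_pdivrMl // invrK.
apply: le_trans (sum_inv_ge_ln n00 (leq_maxl _ _)); rewrite lerBrDr.
apply: le_trans (_ : 80 * `|L| + ln n0%:R <= _).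
  by rewrite lerD // ler_wpM2l // ler_norm.
rewrite -[leLHS]expRK ler_ln ?posrE ?expR_gt0 ?ltr0n ?leq_max ?n00 //.
apply: le_trans (_ : (Num.truncn x).+1%:R <= _); last by rewrite ler_nat leq_maxr.
by rewrite ltW // truncnS_gt.
Qed.

Lemma sqrt_linear_lt (a L : R) : 0 < a -> (1 + 4 / a) ^+ 2 <= L + 1 ->
  Num.sqrt (L + 1) + 2 < a * L.
Proof.
move=> a0 HL; set s := Num.sqrt _.
have b0 : 0 < 4 / a by rewrite divr_gt0.
have L0 : 0 <= L + 1 by apply: le_trans HL; rewrite sqr_ge0.
have s2 : s ^+ 2 = L + 1 by rewrite sqr_sqrtr.
have sb : 1 + 4 / a <= s.
  by rewrite -(@ler_pXn2r _ 2) // ?nnegrE ?sqrtr_ge0 ?s2 // addr_ge0 // ltW.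
have -> : L = s ^+ 2 - 1 by rewrite s2 addrK.
have := sb; rewrite -subr_ge0 -(pmulr_rge0 _ a0).
have -> : a * (s - (1 + 4 / a)) = a * s - a - 4 by field; rewrite gt_eqF.
by move=> h; nra.
Qed.
End Divergence.

(** * The mean of the Moebius function *)

Section MeanMu.
Variable R : realType.
Local Notation g := (mean_mu R).

Lemma count_bad_gt (s : seq nat) (P : pred nat) :
  (size s < 2 * size [seq p <- s | P p] \/ size s <= 2 * size [seq p <- s | ~~ P p])%N.
Proof.
have : (size [seq p <- s | P p] + size [seq p <- s | ~~ P p] = size s)%N.
  by rewrite !size_filter count_predC.
by move: (size _) (size _) (size s) => a b c; lia.
Qed.

(* By the Turan-Kubilius inequality, [mean_mu] changes sign at [v %/ p] for most primes [p],
   so most primes of some block work for all of the given points simultaneously. *)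
Lemma exists_flipping_primes E : (0 < E)%N -> exists D, (0 < D)%N /\
  forall K (eta : R), 0 < eta -> exists Q, forall vs : seq nat, (size vs <= K)%N ->
    (forall v, v \in vs -> (Q <= v)%N) ->
  exists p q, [/\ (0 < p)%N, (p < q <= Q)%N, (E * (q - p) <= p)%N, (p <= D * (q - p))%N &
    forall v, v \in vs -> `|g v + g (v %/ p)| <= eta /\ `|g v + g (v %/ q)| <= eta].
Proof.
move=> E0; have [D [n0 [D0 n00 close]]] := exists_close_primes R E0.
exists D; split => // K eta eta0.
(* Here [64 = 2 * 32]: if more than half of every block were bad, the bad primes would carry at
   least [1/64] of the sum of reciprocals, since reciprocals in one block differ by a factor at most
   32. *)
pose a : R := eta / (64 * K.+1%:R).
have a0 : 0 < a by rewrite divr_gt0 // mulr_gt0.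
have [n1 [n01 HL]] := sum_inv_primes_unbounded ((1 + 4 / a) ^+ 2 - 1) n00.
pose B := primes_in (32 ^ n0) (32 ^ n1).
pose L : R := \sum_(p <- B) p%:R^-1.
have {HL} HL : Num.sqrt (L + 1) + 2 < a * L by apply: sqrt_linear_lt => //; rewrite -lerBlDr.
have BQ : (size B <= 32 ^ n1)%N by rewrite size_filter (leq_trans (count_size _ _)) // size_iota; lia.
have Q0 : (0 < 32 ^ n1)%N by rewrite expn_gt0.
exists ((32 ^ n1) ^ 2)%N => vs vsK vsQ.
pose dev p : R := \sum_(v <- vs) `|g v + g (v %/ p)|.
have dev0 p : 0 <= dev p by apply: sumr_ge0.
have sumdev : \sum_(p <- B) p%:R^-1 * dev p < eta / 64 * L.
  apply: le_lt_trans (_ : K%:R * (Num.sqrt (L + 1) + 2) < _).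
    under eq_bigr do rewrite /dev big_distrr /=.
    rewrite exchange_big /=.
    apply: le_trans (_ : \sum_(v <- vs) (Num.sqrt (L + 1) + 2) <= _).
      rewrite big_seq [leRHS]big_seq; apply: ler_sum => v /vsQ vQ.
      apply: sum_mean_mu_div; rewrite ?uniq_primes_in //.
      - by apply: leq_trans vQ; rewrite expn_gt0 Q0.
      - by move=> p; rewrite mem_primes_in => /and3P[].
      - by apply: leq_trans vQ; rewrite leq_exp2r.
    rewrite big_const_seq count_predT iter_addr_0 -[leLHS]mulr_natl.
    by rewrite ler_wpM2r ?addr_ge0 ?sqrtr_ge0 // ler_nat.
  apply: le_lt_trans (_ : K.+1%:R * (Num.sqrt (L + 1) + 2) < _).
    by rewrite ler_wpM2r ?addr_ge0 ?sqrtr_ge0 // ler_nat.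
  have -> : eta / 64 * L = K.+1%:R * (a * L).
    have : 0 < K.+1%:R :> R by [].
    by rewrite /a; move: K.+1%:R => k k0; field; rewrite gt_eqF.
  by rewrite ltr_pM2l.
have [n [nn good]] : exists n, (n0 <= n < n1)%N /\
    (size (block n) <= 2 * size [seq p <- block n | ~~ (eta < dev p)%R])%N.
  apply: contrapT => nex; move: sumdev; apply/negP; rewrite -leNgt /L.
  rewrite !sum_inv_primes_in // mulr_sumr big_seq [leRHS]big_seq.
  apply: ler_sum => n; rewrite mem_index_iota => nn.
  have bad : (size (block n) < 2 * size [seq p <- block n | (eta < dev p)%R])%N.
    have [//|good] := count_bad_gt (block n) (fun p => eta < dev p).
    by case: nex; exists n.
  have X0 : 0 < (32 ^ n)%:R :> R by rewrite ltr0n expn_gt0.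
  apply: le_trans (_ : eta / 64 * ((size (block n))%:R / (32 ^ n)%:R) <= _).
    rewrite ler_wpM2l ?divr_ge0 ?(ltW eta0) //.
    apply: le_trans (_ : \sum_(p <- block n) (32 ^ n)%:R^-1 <= _); last first.
      by rewrite big_const_seq count_predT iter_addr_0 mulr_natl.
    rewrite big_seq [leRHS]big_seq; apply: ler_sum => p.
    rewrite mem_primes_in => /and3P[pp pl _].
    by rewrite lef_pV2 ?posrE ?ltr0n ?expn_gt0 ?(prime_gt0 pp) // ler_nat ltnW.
  rewrite (bigID (fun p => eta < dev p)) /= -[leLHS]addr0 lerD //; last first.
    by apply: sumr_ge0 => p _; rewrite mulr_ge0.
  apply: le_trans (_ : \sum_(p <- block n | eta < dev p) (32 ^ n.+1)%:R^-1 * eta <= _).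
    rewrite big_const_seq iter_addr_0 -size_filter.
    rewrite -[leRHS]mulr_natl expnS natrM invfM.
    have -> : eta / 64 * ((size (block n))%:R / (32 ^ n)%:R) =
      eta / (32 * (32 ^ n)%:R) * (2^-1 * (size (block n))%:R).
      by field; rewrite gt_eqF.
    rewrite -invfM mulrC -(mulrC eta) ler_wpM2r ?divr_ge0 ?mulr_ge0 ?(ltW eta0) ?(ltW X0) //.
    by rewrite ler_pdivrMl // -natrM ler_nat ltnW.
  rewrite big_seq_cond [leRHS]big_seq_cond; apply: ler_sum => p.
  rewrite mem_primes_in => /andP[/and3P[pp _ pu] de].
  apply: ler_pM; rewrite ?(ltW eta0) ?(ltW de) ?invr_ge0 //.
  by rewrite lef_pV2 ?posrE ?ltr0n ?expn_gt0 ?(prime_gt0 pp) // ler_nat.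
have := card_block (leq_trans n00 (andP nn).1) => Hblock.
pose G := [seq p <- block n | ~~ (eta < dev p)%R].
have [] := close n G (andP nn).1.
- by rewrite filter_uniq ?uniq_primes_in.
- by move=> p; rewrite mem_filter => /andP[].
- by rewrite -/G in good *; nia.
move=> p [q [pG qG pq Epq Dpq]].
have Gdev r v : r \in G -> v \in vs -> `|g v + g (v %/ r)| <= eta.
  rewrite mem_filter -leNgt => /andP[dr _] vvs; apply: le_trans dr.
  rewrite /dev (big_rem v) //= -[leLHS]addr0 lerD //; exact: sumr_ge0.
exists p, q; split => //; last by move=> v vvs; split; apply: Gdev.
  by move: pG; rewrite mem_filter mem_primes_in => /and4P[_ /prime_gt0].
rewrite pq /=; move: qG; rewrite mem_filter mem_primes_in => /and4P[_ _ _ qu].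
apply: leq_trans qu _; apply: (@leq_trans (32 ^ n1)).
  by rewrite leq_exp2l //; case/andP: nn.
by rewrite expnS expn1 leq_pmulr.
Qed.
End MeanMu.

Section MeanMuLimit.
Variable R : realType.
Local Notation g := (mean_mu R).

(* Each step multiplies all moduli by a prime [p] and appends the multiple of
   the last one by a slightly larger prime [q], so that [k] steps produce a
   fine chain of moduli reaching over an arbitrarily long range. *)
Lemma exists_chain E D : (forall K (eta : R), 0 < eta ->
    exists Q, forall vs : seq nat, (size vs <= K)%N ->
    (forall v, v \in vs -> (Q <= v)%N) ->
  exists p q, [/\ (0 < p)%N, (p < q <= Q)%N, (E * (q - p) <= p)%N, (p <= D * (q - p))%N &
    forall v, v \in vs -> `|g v + g (v %/ p)| <= eta /\ `|g v + g (v %/ q)| <= eta]) ->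
  forall k (eta : R), 0 < eta -> exists Z, forall N, (Z <= N)%N ->
  exists m : nat -> nat, [/\ forall j, (j <= k)%N -> (0 < m j <= Z)%N,
    forall j, (j < k)%N -> [/\ (m j < m j.+1)%N, (E * (m j.+1 - m j) <= m j)%N &
       (m j <= D * (m j.+1 - m j))%N] &
    forall j, (j <= k)%N -> `|g (N %/ m j) - (-1) ^+ k * g N| <= k%:R * eta].
Proof.
move=> flip k eta eta0; elim: k => [|k [Z IHk]].
  exists 1%N => N _; exists (fun=> 1%N); split => // j _.
  by rewrite divn1 expr0 mul1r subrr normr0 mul0r.
have [Q HQ] := flip k.+1 eta eta0.
exists (Z * Q.+1)%N => N NZ; have [m [m0 mstep mg]] := IHk N ltac:(nia).
have vsE v : v \in [seq (N %/ m j)%N | j <- iota 0 k.+1] -> exists2 j, (j <= k)%N & v = (N %/ m j)%N.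
  by move=> /mapP[j]; rewrite mem_iota add0n ltnS => /andP[_ jk] ->; exists j.
have vsI j : (j <= k)%N -> (N %/ m j)%N \in [seq (N %/ m j)%N | j <- iota 0 k.+1].
  by move=> jk; apply/mapP; exists j => //; rewrite mem_iota add0n ltnS.
have [||p [q [p0 /andP[pq qQ] Epq Dpq gpq]]] := HQ [seq (N %/ m j)%N | j <- iota 0 k.+1].
- by rewrite size_map size_iota.
- by move=> v /vsE[j jk ->]; have /andP[mj0 mjZ] := m0 j jk; rewrite leq_divRL //; nia.
have step (v : nat) r : `|g v - (-1) ^+ k * g N| <= k%:R * eta -> `|g v + g (v %/ r)| <= eta ->
    `|g (v %/ r) - (-1) ^+ k.+1 * g N| <= k.+1%:R * eta.
  move=> h1 h2; have -> : g (v %/ r) - (-1) ^+ k.+1 * g N =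
     (g v + g (v %/ r)) - (g v - (-1) ^+ k * g N) by rewrite exprS; ring.
  by apply: le_trans (ler_normB _ _) _; rewrite -natr1 mulrDl mul1r addrC lerD.
exists (fun j => if (j <= k)%N then (m j * p)%N else (m k * q)%N); split.
- move=> j jk1; case: ifP => [jk|_]; [have := m0 j jk|have := m0 k (leqnn k)]; nia.
- move=> j; rewrite ltnS; case: (ltngtP j k) => // [jk _|-> _].
    by have [h1 h2 h3] := mstep j jk; rewrite -mulnBl; split; nia.
  by rewrite -mulnBr; have /andP[mk0 _] := m0 k (leqnn k); split; nia.
- move=> j jk1; case: (leqP j k) => [jk|kj].
    by rewrite divnMA; apply: step; [exact: mg | apply: (gpq _ (vsI _ jk)).1].
  rewrite divnMA; apply: step; first exact: mg.
  by apply: (gpq _ (vsI _ (leqnn k))).2.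
Qed.

Lemma chain_bracket (m : nat -> nat) k x : (m 0 <= x)%N -> (x <= m k)%N -> (0 < k)%N ->
  exists2 j, (j < k)%N & (m j <= x <= m j.+1)%N.
Proof.
elim: k => // k IHk m0 xk _; have [mk|mk] := leqP (m k) x; first by exists k; rewrite ?mk.
case: k IHk xk mk => [|k] IHk xk mk; first by lia.
by have [j jk h] := IHk m0 (ltnW mk) isT; exists j => //; apply: ltnW.
Qed.

(** Since [m' <= (1 + 1/E) * m], the quotients agree up to a relative error of order [1/E]; the
    factor 2 also pays for the integer parts, which are small because [E <= N %/ m]. *)
Lemma divn_close E N m m' x : (2 < E)%N -> (0 < m)%N -> (E * (m' - m) <= m)%N ->
  (0 < x)%N -> (x <= m')%N -> (E <= N %/ m)%N ->
  (E * (N %/ m) <= E * (N %/ x) + 2 * (N %/ m))%N /\ (0 < N %/ x)%N.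
Proof.
move=> E3 m0 Em x0 xm; have hb := leq_divM N m; have ha := ltn_ceil N x0.
move: hb ha; set b := (N %/ m)%N; set a := (N %/ x)%N => hb ha Eb.
have h4 : (E * m' <= E.+1 * m)%N by move: Em; rewrite mulnBr mulSn; lia.
have : (E * b * m < a.+1 * E.+1 * m)%N.
  apply: (@leq_trans (E * (a.+1 * m'))); last by rewrite mulnCA -mulnA leq_mul2l h4 orbT.
  rewrite -mulnA ltn_pmul2l; last by apply: leq_trans E3.
  by apply: leq_ltn_trans hb _; apply: leq_trans ha _; rewrite leq_mul2l xm orbT.
rewrite ltn_pmul2r // => h; have Eab : (E * b <= E * a + 2 * b)%N.
  have [ba|ab] := leqP b a; first by apply: leq_trans (leq_addr _ _); rewrite leq_mul2l ba orbT.
  by rewrite mulSn mulnS in h; lia.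
split=> //; rewrite lt0n; apply/eqP => a0; move: Eab; rewrite a0 muln0 add0n.
by rewrite leq_pmul2r ?(leq_trans _ Eb) //; lia.
Qed.

Lemma mean_mu_cvg0 (delta : R) : 0 < delta ->
  exists N0, forall N, (N0 <= N)%N -> `|g N| <= delta.
Proof.
move=> d0.
have [E E3 Ed] : exists2 E, (2 < E)%N & 4 / E%:R <= delta / 4.
  pose E := (Num.truncn (16 / delta)).+3; exists E => //.
  have : 16 / delta <= E%:R.
    by apply: le_trans (ltW (truncnS_gt _)) _; rewrite ler_nat ltnS ltnW.
  by rewrite !ler_pdivrMr ?ltr0n // => h; lra.
have E0 : (0 < E)%N by apply: leq_trans E3.
have E0' : 0 < E%:R :> R by rewrite ltr0n.
have [D [D0 flip]] := exists_flipping_primes R E0.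
(* The primes of the final application depend on [delta] only, so the length of interval that the
   chain has to cover is known in advance. *)
have [n1 [n11 HL]] := sum_inv_primes_unbounded ((1 + 4 / (delta / 4)) ^+ 2 - 1) (isT : (0 < 1)%N).
pose B := primes_in (32 ^ 1) (32 ^ n1); pose L : R := \sum_(p <- B) p%:R^-1.
have {}HL : Num.sqrt (L + 1) + 2 < delta / 4 * L.
  by apply: sqrt_linear_lt; rewrite ?divr_gt0 // -lerBlDr.
(* Each step adds at least [m 0 / D] to the modulus. After [k] steps the chain has passed [m 0 * p]
   for every [p] in [B]. *)
pose k := (D * 32 ^ n1)%N.
pose eta := delta / (8 * k.+1%:R).
have eta0 : 0 < eta by rewrite divr_gt0 // mulr_gt0.
have keta : k%:R * eta <= delta / 8.
  apply: le_trans (_ : k.+1%:R * eta <= _); first by rewrite ler_pM2r // ler_nat.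
  have : 0 < k.+1%:R :> R by [].
  rewrite /eta; move: k.+1%:R => x x0; rewrite le_eqVlt; apply/orP; left; apply/eqP.
  by field; rewrite gt_eqF.
have [Z HZ] := exists_chain flip k eta0.
pose N0 := (Z * (maxn (E * Z) (size B ^ 2)).+1)%N.
exists N0 => N NN; have [m [m0 mstep mg]] := HZ N ltac:(rewrite /N0 in NN; nia).
have /andP[m00 m0Z] := m0 0%N isT.
have msub j : (j <= k)%N -> (m 0 * (D + j) <= m j * D)%N.
  elim: j => [|j IHj] jk; first by rewrite addn0.
  have [h1 h2 h3] := mstep j jk; have := IHj (ltnW jk).
  have : (m 0 <= m j)%N.
    elim: (j) jk => // i IHi ik; have [h _ _] := mstep i (ltnW ik).
    by apply: leq_trans (IHi (ltnW ik)) (ltnW h).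
  rewrite mulnBr in h3; nia.
pose T := (N %/ m 0)%N; pose g' := (-1) ^+ k * g N.
have NgE : `|g'| = `|g N| by rewrite normrM normrX normrN1 expr1n mul1r.
have gT : `|g T - g'| <= delta / 8 by apply: le_trans (mg 0%N isT) keta.
have TB : (maxn (E * Z) (size B ^ 2) < T)%N.
  by rewrite leq_divRL // (leq_trans _ NN) // /N0 mulnC leq_mul.
have T0 : (0 < T)%N by apply: leq_ltn_trans TB.
have pB p : p \in B -> prime p by rewrite mem_primes_in => /and3P[].
have := sum_mean_mu_div R T0 (uniq_primes_in _ _) pB; rewrite -/L.
have BT : (size B ^ 2 <= T)%N by move: TB; rewrite gtn_max => /andP[_ /ltnW].
move=> /(_ BT) /le_lt_trans/(_ HL) H; rewrite leNgt; apply/negP => gN.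
move: H; apply/negP; rewrite -leNgt mulrC /L mulr_suml big_seq [leRHS]big_seq.
apply: ler_sum => p pinB; rewrite ler_wpM2l ?invr_ge0 //.
have pp := pB p pinB; have p0 := prime_gt0 pp.
have pu : (p <= 32 ^ n1)%N by move: pinB; rewrite mem_primes_in => /and3P[].
have k0 : (0 < k)%N by rewrite muln_gt0 D0 expn_gt0.
have [j jk /andP[jl ju]] : exists2 j, (j < k)%N & (m j <= m 0 * p <= m j.+1)%N.
  apply: chain_bracket => //; first by rewrite leq_pmulr.
  rewrite -(leq_pmul2r D0); apply: leq_trans (msub k (leqnn k)).
  by rewrite -mulnA leq_mul2l mulnC (leq_trans _ (leq_addl _ _)) ?orbT // leq_mul2l pu orbT.
have [h1 h2 h3] := mstep j jk; have /andP[mj0 mjZ] := m0 j (ltnW jk).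
have gj := le_trans (mg j (ltnW jk)) keta.
have -> : g (T %/ p) = g (N %/ (m 0 * p)) by rewrite divnMA.
set a := (N %/ (m 0 * p))%N; set b := (N %/ m j)%N in gj *.
have mp0 : (0 < m 0 * p)%N by rewrite muln_gt0 m00 p0.
have ab : (a <= b)%N by rewrite leq_div2l.
have Eb : (E <= b)%N.
  rewrite leq_divRL // (leq_trans _ NN) // /N0.
  apply: (@leq_trans (E * Z)); first by rewrite leq_mul.
  apply: leq_trans (_ : (maxn (E * Z) (size B ^ 2)).+1 <= _)%N.
    by apply: leqW; rewrite leq_maxl.
  by rewrite leq_pmull // (leq_trans m00).
have [Eab a0] : (E * b <= E * a + 2 * b)%N /\ (0 < a)%N.
  exact: (@divn_close E N (m j) (m j.+1) (m 0 * p)).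
have b0 : (0 < b)%N by apply: leq_trans Eb.
have gab : `|g a - g b| <= delta / 4.
  apply: le_trans (mean_mu_lipschitz R a0 ab) _; apply: le_trans Ed.
  have b0' : 0 < b%:R :> R by rewrite ltr0n.
  rewrite ler_pdivlMr // -subr_ge0 -(pmulr_rge0 _ b0').
  have -> : b%:R * (4 - 2 * (1 - a%:R / b%:R) * E%:R) =
    2 * ((E * a + 2 * b)%:R - (E * b)%:R) :> R.
    by rewrite natrD !natrM; field; rewrite gt_eqF.
  by rewrite mulr_ge0 // subr_ge0 ler_nat.
(* Both [g T] and [g a] are close to [g'], so [g T + g (T %/ p)] stays away from 0 for every [p] in
   [B], against the small weighted sum over [B]. *)
have : `|2 * g'| <= `|g T + g a| + (delta / 8 + delta / 8 + delta / 4).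
  have -> : 2 * g' = (g T + g a) - (g T - g') - (g b - g') - (g a - g b) by ring.
  have := ler_normB (g T + g a - (g T - g') - (g b - g')) (g a - g b).
  have := ler_normB (g T + g a - (g T - g')) (g b - g').
  have := ler_normB (g T + g a) (g T - g').
  by move: gT gj gab; clear; lra.
by rewrite normrM NgE ger0_norm //; move: gN d0; clear; lra.
Qed.
End MeanMuLimit.

(** * The prime number theorem *)

Section Chebyshev.
Variable R : realType.
Implicit Types (N n m p : nat).

(** Chebyshev's function, with the powers of each prime grouped. *)
Definition psi n : R := \sum_(p <- primes_in 0 n) ln p%:R * (trunc_log p n)%:R.

Lemma ln_prod (s : seq nat) (f : nat -> nat) : (forall p, p \in s -> (0 < f p)%N) ->
  ln (\prod_(p <- s) f p)%:R = \sum_(p <- s) ln (f p)%:R :> R.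
Proof.
elim: s => [|p s IHs] f0; first by rewrite !big_nil ln1.
rewrite !big_cons natrM lnM ?posrE ?ltr0n ?f0 ?mem_head //.
  by rewrite IHs // => q qs; rewrite f0 // inE qs orbT.
by rewrite big_seq prodn_cond_gt0 // => q qs; rewrite f0 // inE qs orbT.
Qed.

Lemma ln_fact N : ln N`!%:R =
  \sum_(p <- primes_in 0 N) ln p%:R * (logn p N`!)%:R :> R.
Proof.
rewrite {1}[N`!]prod_prime_decomp ?fact_gt0 // prime_decompE big_map /= ln_prod; last first.
  by move=> p; rewrite mem_primes => /and3P[pp _ _]; rewrite expn_gt0 prime_gt0.
have perm : perm_eq (primes N`!) (primes_in 0 N).
  apply: uniq_perm; rewrite ?primes_uniq ?uniq_primes_in // => p.
  rewrite mem_primes mem_primes_in fact_gt0; have [pp|//] := boolP (prime p).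
  rewrite prime_gt0 //=; apply/idP/idP => [/(prime_dvd_fact pp)//|pN].
  by rewrite dvdn_fact // prime_gt0.
rewrite (perm_big _ perm) /= big_seq [RHS]big_seq; apply: eq_bigr => p.
rewrite mem_primes_in => /and3P[pp _ _].
by rewrite natrX lnXn ?ltr0n ?prime_gt0 // mulr_natr.
Qed.

Lemma psi_widen n N : (n <= N)%N ->
  psi n = \sum_(p <- primes_in 0 N) ln p%:R * (trunc_log p n)%:R.
Proof.
move=> nN; rewrite (@primes_in_cat 0 n) // big_cat /= [X in _ + X]big1_seq ?addr0 //.
move=> p; rewrite mem_primes_in => /andP[_ /and3P[pp np _]].
have -> : trunc_log p n = 0%N.
  by apply/eqP; rewrite trunc_log_eq0; apply/orP; right; case: (p) np.
by rewrite mulr0.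
Qed.

Lemma trunc_log_sum p n N : (1 < p)%N -> (n <= N)%N ->
  trunc_log p n = (\sum_(1 <= j < N.+1) (p ^ j <= n))%N.
Proof.
move=> p1 nN; have [->|n0] := posnP n.
  rewrite trunc_log0 big1_seq // => j _; rewrite leqn0 expn_eq0.
  by case: p p1.
have tN : (trunc_log p n <= N)%N.
  apply: leq_trans nN; apply: ltnW; apply: leq_trans (trunc_logP p1 n0).
  exact: ltn_expl.
rewrite (big_cat_nat (n := (trunc_log p n).+1)) //= (eq_big_seq (fun=> 1%N)); last first.
  move=> j; rewrite mem_index_iota ltnS => /andP[_ jt].
  by rewrite (leq_trans _ (trunc_logP p1 n0)) // leq_exp2l.
rewrite sum_nat_const_nat subn1 muln1 /= big1_seq ?addn0 // => j.
rewrite mem_index_iota => /andP[_ /andP[tj _]].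
by rewrite leqNgt (leq_trans (trunc_log_ltn n p1)) // leq_exp2l.
Qed.

(** Legendre's formula for the exponents of [N!]: both sides count the pairs of a prime power
    [p ^ j] and an [m] with [p ^ j * m <= N], with weight [ln p]. *)
Lemma ln_fact_psi N : ln N`!%:R = \sum_(1 <= m < N.+1) psi (N %/ m).
Proof.
rewrite ln_fact [RHS](eq_big_seq (fun m => \sum_(p <- primes_in 0 N)
   ln p%:R * (trunc_log p (N %/ m))%:R)); last first.
  by move=> m _; apply: psi_widen; apply: leq_div.
rewrite exchange_big /= big_seq [RHS]big_seq; apply: eq_bigr => p.
rewrite mem_primes_in => /and3P[pp _ _]; rewrite -mulr_sumr; congr (_ * _).
rewrite -natr_sum logn_fact //; congr (_%:R).
under [RHS]eq_bigr do rewrite (@trunc_log_sum p _ N) ?prime_gt1 ?leq_div //.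
rewrite exchange_big /=; apply: eq_big_nat => j _.
have q0 : (0 < p ^ j)%N by rewrite expn_gt0 prime_gt0.
have le : (N %/ p ^ j <= N)%N by rewrite leq_div.
rewrite (big_cat_nat (n := (N %/ p ^ j).+1)) //= (eq_big_seq (fun=> 1%N)); last first.
  move=> m; rewrite mem_index_iota ltnS => /andP[m0 mN].
  by rewrite leq_divRL // mulnC -leq_divRL // mN.
rewrite sum_nat_const_nat subn1 muln1 /= big1_seq ?addn0 // => m.
rewrite mem_index_iota => /andP[_ /andP[m1 m2]].
have m0 : (0 < m)%N by apply: leq_ltn_trans m1.
by rewrite leq_divRL // mulnC -leq_divRL // leqNgt m1.
Qed.

(** Grouping by [n = a * m], where [N %/ a %/ m = N %/ n], leaves the divisor sum of [mu], which
    singles out [n = 1]. *)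
Lemma moebius_inversion (F G : nat -> R) N : (0 < N)%N ->
  (forall n, F n = \sum_(1 <= m < n.+1) G (n %/ m)%N) ->
  G N = \sum_(1 <= a < N.+1) mu R a * F (N %/ a)%N.
Proof.
move=> N0 FG.
have -> : \sum_(1 <= a < N.+1) mu R a * F (N %/ a)%N =
   \sum_(1 <= n < N.+1) (n == 1%N)%:R * G (N %/ n)%N.
  rewrite (eq_big_seq (fun a => \sum_(1 <= n < N.+1)
     (if (a %| n)%N then mu R a * G (N %/ n)%N else 0))); last first.
    move=> a; rewrite mem_index_iota => /andP[a0 _].
    rewrite FG -big_mkcond sum_dvd // big_distrr /=.
    by apply: eq_bigr => m _; rewrite divnMA.
  rewrite exchange_big /=; apply: eq_big_seq => n; rewrite mem_index_iota => nN.
  by rewrite -big_mkcond -mulr_suml sum_mu_divisors.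
rewrite big_ltn // eqxx mul1r divn1 big1_seq ?addr0 // => n /andP[_].
by rewrite mem_index_iota => /andP[]; case: n => [|[]] // n _ _; rewrite mul0r.
Qed.

Definition divisor_sum n := (\sum_(1 <= a < n.+1) n %/ a)%N.

Lemma sum_leq_divn n a b : (0 < a)%N -> (n %/ a <= b)%N ->
  (\sum_(1 <= c < b.+1) (a * c <= n) = n %/ a)%N.
Proof.
move=> a0 le; rewrite (big_cat_nat (n := (n %/ a).+1)) //= (eq_big_seq (fun=> 1%N)); last first.
  by move=> m; rewrite mem_index_iota ltnS => /andP[m0]; rewrite leq_divRL // mulnC => ->.
rewrite sum_nat_const_nat subn1 muln1 /= big1_seq ?addn0 // => m.
rewrite mem_index_iota => /andP[_ /andP[m1 m2]].
by rewrite mulnC -leq_divRL // leqNgt m1.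
Qed.

(** Dirichlet's hyperbola method: in a pair with [a * c <= n] one factor is at most [r], and the
    [r ^ 2] pairs with both factors at most [r] are counted twice. *)
Lemma divisor_sum_hyperbola n r : (r ^ 2 <= n < r.+1 ^ 2)%N ->
  (divisor_sum n + r ^ 2 = 2 * \sum_(1 <= a < r.+1) n %/ a)%N.
Proof.
move=> /andP[rn nr]; have lern : (r <= n)%N by nia.
have -> : divisor_sum n = (\sum_(1 <= a < n.+1) \sum_(1 <= c < n.+1) (a * c <= n))%N.
  by apply: eq_big_nat => a /andP[a0 _]; rewrite sum_leq_divn ?leq_div.
rewrite (big_cat_nat (n := r.+1)) //=.
rewrite (eq_big_nat _ _ (F2 := fun a => n %/ a)%N); last first.
  by move=> a /andP[a0 _]; rewrite sum_leq_divn ?leq_div.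
rewrite mul2n -addnn -addnA; congr addn.
rewrite [X in (X + _ = _)%N](eq_big_nat _ _ (F2 := fun a => \sum_(1 <= c < r.+1) (a * c <= n))%N); last first.
  move=> a /andP[ra _]; rewrite (big_cat_nat (n := r.+1)) //= [X in (_ + X)%N]big1_seq ?addn0 //.
  by move=> c; rewrite mem_index_iota => /andP[_ /andP[rc _]]; apply/eqP; rewrite eqb0 -ltnNge; nia.
rewrite exchange_big /=.
rewrite (_ : r ^ 2 = \sum_(1 <= c < r.+1) r)%N; last first.
  by rewrite sum_nat_const_nat subn1.
rewrite -big_split /=; apply: eq_big_nat => c /andP[c0 cr].
rewrite -[RHS](@sum_leq_divn n c n) ?leq_div //.
rewrite [RHS](big_cat_nat (n := r.+1)) //= addnC; congr addn; last first.
  by apply: eq_bigr => a _; rewrite mulnC.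
rewrite (eq_big_nat _ _ (F2 := fun=> 1%N)); first by rewrite sum_nat_const_nat subn1 muln1.
by move=> a /andP[a0 ar]; rewrite (_ : (c * a <= n)%N = true) //; nia.
Qed.
End Chebyshev.

(** * Comparison of [ln n!] with the divisor sum, and the asymptotics of [psi] *)

Section PsiAsymptotics.
Variable R : realType.
Implicit Types (N n m p r : nat).

Definition harmonic_sum n : R := \sum_(1 <= i < n.+1) i%:R^-1.

(** The sequence [a] decreases, [b] increases, and their difference is at most [1 / (n + 1)]; the
    constant is caught between them. *)
Lemma euler_constant : exists gamma : R, 0 <= gamma <= 1 /\
  forall n, (0 < n)%N -> `|harmonic_sum n - ln n%:R - gamma| <= n%:R^-1.
Proof.
pose a n := harmonic_sum n.+1 - ln n.+1%:R : R.
pose b n := harmonic_sum n.+1 - ln n.+2%:R : R.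
have HS n : harmonic_sum n.+2 = harmonic_sum n.+1 + n.+2%:R^-1 by rewrite /harmonic_sum big_nat_recr.
have aS n : a n.+1 <= a n by have := @ln_succB_ge R n.+1 isT; rewrite /a HS; move: (_^-1) (ln _) (ln _) (harmonic_sum _) => *; lra.
have bS n : b n <= b n.+1 by have := @ln_succB_le R n.+2 isT; rewrite /b HS; move: (_^-1) (ln _) (ln _) (harmonic_sum _) => *; lra.
have ba n : b n <= a n.
  by rewrite lerD2l lerN2 ler_ln ?posrE ?ltr0n // ler_nat.
have am n d : a (n + d)%N <= a n.
  by elim: d => [|d IHd]; rewrite ?addn0 // addnS (le_trans (aS _)).
have bm n d : b n <= b (n + d)%N.
  by elim: d => [|d IHd]; rewrite ?addn0 // addnS (le_trans IHd).
have bla n m : b n <= a m by apply: le_trans (bm n m) _; apply: le_trans (ba _) _; rewrite addnC.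
have ub m : ubound (range b) (a m) by move=> _ [n _ <-].
have hs : has_sup (range b) by split; [exists (b 0%N), 0%N | exists (a 0%N)].
exists (sup (range b)); split.
  apply/andP; split.
    apply: le_trans (_ : b 0%N <= _); last by apply: sup_ubound; [case: hs|exists 0%N].
    rewrite /b /harmonic_sum big_nat1 invr1 subr_ge0.
    have := @ln_natr_le R 2 isT; lra.
  apply: le_trans (_ : a 0%N <= _); first by apply: ge_sup; [case: hs | exact: ub].
  by rewrite /a /harmonic_sum big_nat1 invr1 ln1 subr0.
move=> [//|n] _; rewrite -/(a n).
have h1 : b n <= sup (range b) by apply: sup_ubound; [case: hs|exists n].
have h2 : sup (range b) <= a n by apply: ge_sup; [case: hs | exact: ub].
rewrite ger0_norm ?subr_ge0 //; apply: le_trans (_ : a n - b n <= _); first by rewrite lerD2l lerN2.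
rewrite /a /b; have := @ln_succB_le R n.+1 isT.
by move: (_^-1) (ln _) (ln _) (harmonic_sum _) => *; lra.
Qed.

(** Induction with the two bounds of [ln (n + 1) - ln n]. The [+ 1] of the lower bound matters later
    for [n = k]: it makes the lower bound of [Rlow] strict. *)
Lemma ln_fact_bounds n : (0 < n)%N ->
  n%:R * ln n%:R - n%:R + 1 <= ln n`!%:R :> R /\
  ln n`!%:R <= (n%:R + 1) * ln n%:R - n%:R + 1 :> R.
Proof.
elim: n => // -[_ _|n IHn _].
  by rewrite factS fact0 muln1 ln1; split; lra.
have [IHl IHu] := IHn isT; rewrite factS natrM lnM ?posrE ?ltr0n ?fact_gt0 //.
have := @ln_succB_ge R n.+1 isT; have := @ln_succB_le R n.+1 isT.
have x0 : 0 < n.+1%:R :> R by [].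
rewrite -[n.+2%:R]natr1; move: IHl IHu x0; move: (ln n.+1`!%:R) (n.+1%:R) (ln n.+1%:R) => f x l.
move: (ln (x + 1)) => l' IHl IHu x0.
rewrite -(ler_pM2r x0) mulVf ?gt_eqF // => h1.
rewrite -(@ler_pM2r _ (x + 1)) ?addr_gt0 // mulVf ?gt_eqF ?addr_gt0 // => h2.
by split; lra.
Qed.

Lemma exists_nat_sqrt n : exists r, (r ^ 2 <= n < r.+1 ^ 2)%N.
Proof.
elim: n => [|n [r /andP[h1 h2]]]; first by exists 0%N.
have [h|h] := ltnP n.+1 (r.+1 ^ 2); first by exists r; rewrite h andbT (leq_trans h1).
by exists r.+1; rewrite h /=; nia.
Qed.

(* [2 * gamma] is the constant for which the remainder is [O(sqrt n)], since
   [divisor_sum n = n ln n + (2 gamma - 1) n + O(sqrt n)]. *)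
Definition psi_remainder gamma n : R :=
  ln n`!%:R - (divisor_sum n)%:R + 2 * gamma * n%:R.

(** With [r] the integer square root of [n], every error is of order [r]: the [r] integer parts in
    the hyperbola formula, [n / r] from the harmonic sum, and [n * (ln n - 2 * ln r)]. The terms
    [n * ln n] and those of order [n] cancel. *)
Lemma psi_remainder_bound gamma n : 0 <= gamma <= 1 ->
  (forall n, (0 < n)%N -> `|harmonic_sum n - ln n%:R - gamma| <= n%:R^-1) ->
  (0 < n)%N -> `|psi_remainder gamma n| <= 40 * Num.sqrt n%:R.
Proof.
move=> /andP[g0 g1] Hg n0; have [r rn] := exists_nat_sqrt n.
have r0 : (0 < r)%N by case: r rn => // /andP[_]; rewrite exp1n; case: n n0.
have r0' : 0 < r%:R :> R by rewrite ltr0n.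
apply: (@le_trans _ _ (40 * r%:R)); last first.
  rewrite ler_pM2l // -[leLHS]ger0_norm // -sqrtr_sqr.
  by rewrite ler_wsqrtr // -natrX ler_nat; case/andP: rn.
have Dh := divisor_sum_hyperbola rn; case/andP: rn => rn nr.
have [fl fu] := ln_fact_bounds n0.
have := Hg r r0; set H := harmonic_sum r => {}Hg.
have S1 : n%:R * H - r%:R <= (\sum_(1 <= a < r.+1) n %/ a)%:R.
  rewrite natr_sum /H /harmonic_sum mulr_sumr.
  rewrite (_ : r%:R = \sum_(1 <= a < r.+1) 1); last by rewrite sumr_const_nat subn1.
  rewrite -sumrB big_seq [leRHS]big_seq; apply: ler_sum => a.
  by rewrite mem_index_iota => /andP[a0 _]; rewrite ltW // ltr_divn.
have S2 : (\sum_(1 <= a < r.+1) n %/ a)%:R <= n%:R * H.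
  by rewrite natr_sum /H /harmonic_sum mulr_sumr; apply: ler_sum => a _; apply: ler_divn.
have DE : (divisor_sum n)%:R = 2 * (\sum_(1 <= a < r.+1) n %/ a)%:R - r%:R ^+ 2 :> R.
  by rewrite -natrM -Dh natrD natrX addrK.
have rn' : r%:R ^+ 2 <= n%:R :> R by rewrite -natrX ler_nat.
have nr' : n%:R <= r%:R ^+ 2 + 2 * r%:R :> R by rewrite -natrX -natrM -natrD ler_nat; move: nr; clear; nia.
have r1 : 1 <= r%:R :> R by rewrite ler1n.
have n0' : 0 < n%:R :> R by rewrite ltr0n.
have lr0 : 0 <= ln r%:R :> R by rewrite ln_ge0.
have lr1 : ln r%:R <= r%:R - 1 :> R by apply: ln_natr_le.
have ln1 : 2 * ln r%:R <= ln n%:R :> R.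
  by rewrite mulr_natl -lnXn // ler_ln ?posrE ?exprn_gt0.
have ln2 : ln n%:R <= 2 * ln r%:R + 2 / r%:R :> R.
  have -> : n%:R = r%:R ^+ 2 * (1 + (n%:R / r%:R ^+ 2 - 1)) :> R by field; rewrite gt_eqF.
  have p0 : 0 < n%:R / r%:R ^+ 2 :> R by rewrite divr_gt0 ?exprn_gt0.
  rewrite lnM ?posrE ?exprn_gt0 ?(addrC 1) ?subrK // lnXn // [2 * ln _]mulr_natl lerD2l.
  have -> : n%:R / r%:R ^+ 2 = 1 + (n%:R / r%:R ^+ 2 - 1) :> R by lra.
  apply: le_trans (le_ln1Dx _) _; first by lra.
  rewrite lerBlDr ler_pdivrMr ?exprn_gt0 //.
  by have -> : (2 / r%:R + 1) * r%:R ^+ 2 = r%:R ^+ 2 + 2 * r%:R :> R by field; rewrite gt_eqF.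
have nd : n%:R / r%:R <= 3 * r%:R :> R by rewrite ler_pdivrMr //; nra.
have nH : `|n%:R * H - n%:R * ln r%:R - n%:R * gamma| <= 3 * r%:R.
  rewrite -!mulrBr normrM (gtr0_norm n0'); apply: le_trans nd.
  by rewrite ler_pM2l.
have nln : n%:R * ln n%:R <= 2 * (n%:R * ln r%:R) + 6 * r%:R :> R.
  apply: le_trans (_ : n%:R * (2 * ln r%:R + 2 / r%:R) <= _); first by rewrite ler_pM2l.
  have -> : n%:R * (2 * ln r%:R + 2 / r%:R) = 2 * (n%:R * ln r%:R) + 2 * (n%:R / r%:R) :> R.
    by field; rewrite gt_eqF.
  by move: nd; lra.
have nln' : 2 * (n%:R * ln r%:R) <= n%:R * ln n%:R :> R by rewrite mulrCA ler_pM2l.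
have rinv : 2 / r%:R <= 2 :> R by rewrite ler_pdivrMr // ler_pMr.
move: nH; rewrite /psi_remainder DE.
have -> : 2 * gamma * n%:R = 2 * (n%:R * gamma) by ring.
rewrite !ler_norml => /andP[nH1 nH2].
move: S1 S2 fl fu nH1 nH2 nln nln' ln2 lr1 rn' nr' rinv r1.
rewrite mulrDl mul1r.
move: (n%:R * H) (n%:R * ln r%:R) (n%:R * gamma) (n%:R * ln n%:R) (2 / r%:R) => x1 x2 x3 x4 x5.
move: (ln n`!%:R) (bigop _ _ _)%:R (ln n%:R) (ln r%:R) => y1 y2 y3 y4.
move: (n%:R) (r%:R) (r%:R ^+ 2) => z1 z2 z3 *.
by apply/andP; split; lra.
Qed.

Lemma sum_inv_sqrt_le m : \sum_(1 <= a < m.+1) (Num.sqrt a%:R)^-1 <= 2 * Num.sqrt m%:R :> R.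
Proof.
elim: m => [|m IHm]; first by rewrite big_geq // sqrtr0 mulr0.
rewrite big_nat_recr //=; set x := Num.sqrt m%:R in IHm *; set y := Num.sqrt m.+1%:R.
have x0 : 0 <= x by apply: sqrtr_ge0.
have y0 : 0 < y by rewrite sqrtr_gt0.
have y2 : y ^+ 2 = x ^+ 2 + 1 by rewrite !sqr_sqrtr // natr1.
suff : y^-1 <= 2 * (y - x) by move: IHm; lra.
rewrite -(ler_pM2l y0) divff ?gt_eqF //.
by have := sqr_ge0 (y - x); rewrite sqrrB -mulr_natl; nra.
Qed.

(** In this range [N %/ a] takes only the values [1..K], and on each of them the sum of [mu] is a
    difference of two Mertens values, hence [o(N)]. The function [E] may be arbitrary, as only
    finitely many of its values occur. *)
Lemma sum_mu_tail (E : nat -> R) K (delta : R) : 0 < delta -> exists N0, forall N, (N0 <= N)%N ->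
  `|\sum_((N %/ K.+1).+1 <= a < N.+1) mu R a * E (N %/ a)%N| <= delta * N%:R.
Proof.
elim: K delta => [|K IHK] delta d0.
  by exists 0%N => N _; rewrite divn1 big_geq // normr0 mulr_ge0 // ltW.
have d2 : 0 < delta / 2 by rewrite divr_gt0.
have [N1 HN1] := IHK _ d2.
pose e := delta / (4 * (`|E K.+1| + 1)).
have E0 : 0 < `|E K.+1| + 1 by rewrite ltr_pwDr.
have e0 : 0 < e by rewrite divr_gt0 // mulr_gt0.
have [N2 HN2] := mean_mu_cvg0 e0.
exists (maxn N1 (K.+2 * N2.+1)) => N; rewrite geq_max => /andP[N1N N2N].
have small c : (0 < c <= K.+2)%N -> `|mertens R (N %/ c)| <= e * N%:R.
  move=> /andP[c0 cK]; have cN : (N2.+1 <= N %/ c)%N.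
    by rewrite leq_divRL // (leq_trans _ N2N) // mulnC leq_mul2r cK orbT.
  have x0 : 0 < (N %/ c)%:R :> R by rewrite ltr0n (leq_trans _ cN).
  have := HN2 _ (ltnW cN); rewrite /mean_mu normrM normfV (gtr0_norm x0) ler_pdivrMr //.
  move/le_trans; apply; rewrite ler_pM2l // ler_nat leq_div //.
have le1 : (N %/ K.+2 <= N %/ K.+1)%N by rewrite leq_div2l.
have le2 : ((N %/ K.+1).+1 <= N.+1)%N by rewrite ltnS leq_div.
rewrite (big_cat_nat (n := (N %/ K.+1).+1)) //=.
apply: le_trans (ler_normD _ _) _.
rewrite (_ : delta * N%:R = delta / 2 * N%:R + delta / 2 * N%:R); last by field.
rewrite lerD ?HN1 //.
rewrite (eq_big_seq (fun a => mu R a * E K.+1)); last first.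
  move=> a; rewrite mem_index_iota ltnS => /andP[a1 a2].
  have a0 : (0 < a)%N by apply: leq_ltn_trans a1.
  suff -> : (N %/ a)%N = K.+1 by [].
  apply/eqP; rewrite eqn_leq -ltnS ltn_divLR // leq_divRL //.
  by rewrite mulnC -ltn_divLR // a1 /= mulnC -leq_divRL.
rewrite -mulr_suml.
have -> : \sum_((N %/ K.+2).+1 <= a < (N %/ K.+1).+1) mu R a =
    mertens R (N %/ K.+1) - mertens R (N %/ K.+2).
  by rewrite /mertens [X in _ = X - _](big_cat_nat (n := (N %/ K.+2).+1)) //= addrAC subrr add0r.
rewrite normrM; apply: le_trans (_ : (e * N%:R + e * N%:R) * `|E K.+1| <= _).
  rewrite ler_wpM2r //; apply: le_trans (ler_normB _ _) _.
  by rewrite lerD // small ?leqnn // leqnSn.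
apply: le_trans (_ : (e * N%:R + e * N%:R) * (`|E K.+1| + 1) <= _).
  by rewrite ler_wpM2l ?lerDl // addr_ge0 // mulr_ge0 // ltW.
rewrite /e; move: (`|E K.+1| + 1) E0 => x x0.
by rewrite le_eqVlt; apply/orP; left; apply/eqP; field; rewrite gt_eqF.
Qed.

(** [key] combines three inversions, with [F n] equal to [ln n!], [divisor_sum n] and [n]. For
    [a <= N / (K + 1)] the square root bound on [E] gives [O(N / sqrt K)]; for the other [a], [K] is
    fixed and [sum_mu_tail] applies. *)
Theorem psi_asymptotic (delta : R) : 0 < delta ->
  exists N0, forall N, (N0 <= N)%N -> `|psi R N - N%:R| <= delta * N%:R.
Proof.
move=> d0; have [gamma [g01 Hg]] := euler_constant.
pose E := psi_remainder gamma.
have key N : (0 < N)%N -> psi R N - N%:R + 2 * gamma = \sum_(1 <= a < N.+1) mu R a * E (N %/ a)%N.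
  move=> N0; have h1 := moebius_inversion (F := fun n => ln n`!%:R) N0 (@ln_fact_psi R).
  have h2 : N%:R = \sum_(1 <= a < N.+1) mu R a * (divisor_sum (N %/ a))%:R.
    apply: (moebius_inversion (F := fun n => (divisor_sum n)%:R) (G := fun n => n%:R)) => // n.
    by rewrite natr_sum.
  have h3 : 1 = \sum_(1 <= a < N.+1) mu R a * (N %/ a)%:R.
    apply: (moebius_inversion (F := fun n => n%:R) (G := fun n => 1)) => // n.
    by rewrite sumr_const_nat subn1.
  transitivity (psi R N - N%:R + 2 * gamma * 1); first by rewrite mulr1.
  rewrite h1 h2 [X in _ + _ * X]h3 -sumrB mulr_sumr -big_split /=; apply: eq_bigr => a _.
  by rewrite /E /psi_remainder; ring.
(* Here [240 = 3 * 80]: the sum over small [a] is at most [80 * N / sqrt (K + 1)], and has to stay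
   below [delta / 3 * N]. *)
pose K := (Num.truncn ((240 / delta) ^+ 2)).
have K0 : 0 < K.+1%:R :> R by [].
have HK : 80 / Num.sqrt K.+1%:R <= delta / 3.
  have s0 : 0 < Num.sqrt K.+1%:R :> R by rewrite sqrtr_gt0.
  have : 240 / delta <= Num.sqrt K.+1%:R.
    rewrite -[leLHS]ger0_norm ?divr_ge0 ?(ltW d0) // -sqrtr_sqr ler_wsqrtr //.
    by rewrite ltW // truncnS_gt.
  by rewrite !ler_pdivrMr // => h; lra.
have d3 : 0 < delta / 3 by rewrite divr_gt0.
have [N1 HN1] := sum_mu_tail E K d3.
pose N2 := (Num.truncn (6 / delta)).+1.
exists (maxn (maxn N1 N2) 1) => N; rewrite !geq_max => /andP[/andP[N1N N2N] N0].
have N0' : 0 < N%:R :> R by rewrite ltr0n.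
have c3 : `|2 * gamma| <= delta / 3 * N%:R.
  have : 6 / delta <= N%:R.
    by apply: le_trans (ltW (truncnS_gt _)) _; rewrite ler_nat.
  case/andP: g01 => g0 g1; rewrite ger0_norm ?mulr_ge0 //.
  by rewrite ler_pdivrMr // => h; lra.
have -> : psi R N - N%:R = \sum_(1 <= a < N.+1) mu R a * E (N %/ a)%N - 2 * gamma.
  by rewrite -key // addrK.
apply: le_trans (ler_normB _ _) _.
have le2 : ((N %/ K.+1).+1 <= N.+1)%N by rewrite ltnS leq_div.
rewrite (big_cat_nat (n := (N %/ K.+1).+1)) //=.
have := HN1 N N1N; set T2 := bigop _ _ _ => HT2.
suff HT1 : `|\sum_(1 <= a < (N %/ K.+1).+1) mu R a * E (N %/ a)%N| <= delta / 3 * N%:R.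
  move: HT1; set T1 := bigop _ _ _ => HT1.
  by have := ler_normD T1 T2; move: HT1 HT2 c3; clear; lra.
apply: le_trans (ler_norm_sum _ _ _) _.
apply: le_trans (_ : \sum_(1 <= a < (N %/ K.+1).+1) 40 * Num.sqrt N%:R * (Num.sqrt a%:R)^-1 <= _).
  rewrite big_seq [leRHS]big_seq; apply: ler_sum => a.
  rewrite mem_index_iota ltnS => /andP[a0 a1]; rewrite normrM.
  have aN : (0 < N %/ a)%N by rewrite divn_gt0 // (leq_trans a1) // leq_div.
  apply: le_trans (_ : 1 * (40 * Num.sqrt (N %/ a)%:R) <= _).
    by rewrite ler_pM // ?normr_mu // psi_remainder_bound.
  rewrite mul1r -mulrA ler_pM2l // -sqrtrV // -sqrtrM // ler_wsqrtr //.
  exact: ler_divn.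
rewrite -mulr_sumr; apply: le_trans (_ : 40 * Num.sqrt N%:R * (2 * Num.sqrt (N%:R / K.+1%:R)) <= _).
  rewrite ler_wpM2l ?mulr_ge0 ?sqrtr_ge0 //.
  apply: le_trans (sum_inv_sqrt_le _) _; rewrite ler_pM2l // ler_wsqrtr //.
  exact: ler_divn.
rewrite sqrtrM // sqrtrV //.
have -> : 40 * Num.sqrt N%:R * (2 * (Num.sqrt N%:R / Num.sqrt K.+1%:R)) =
   80 / Num.sqrt K.+1%:R * (Num.sqrt N%:R) ^+ 2 :> R by ring.
by rewrite sqr_sqrtr // ler_wpM2r.
Qed.
End PsiAsymptotics.

(** * Sums of roots of primes *)

Section Root.
Variables (R : realType) (k : nat).
Hypothesis k0 : (0 < k)%N.
Implicit Types (x y : R).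

Definition nroot x : R := x `^ k%:R^-1.

Lemma nroot_ge0 x : 0 <= nroot x.
Proof. exact: powR_ge0. Qed.

Lemma nroot_gt0 x : 0 < x -> 0 < nroot x.
Proof. exact: powR_gt0. Qed.

Lemma nroot0 : nroot 0 = 0.
Proof. by rewrite /nroot powR0 // invr_eq0 pnatr_eq0 -lt0n. Qed.

Lemma nrootXn x : 0 <= x -> nroot x ^+ k = x.
Proof.
by move=> x0; rewrite -powR_mulrn ?nroot_ge0 // -powRrM mulVf ?powRr1 // pnatr_eq0 -lt0n.
Qed.

Lemma nrootM x y : 0 <= x -> 0 <= y -> nroot (x * y) = nroot x * nroot y.
Proof. by move=> x0 y0; rewrite /nroot powRM. Qed.

Lemma ler_nroot x y : 0 <= x -> x <= y -> nroot x <= nroot y.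
Proof.
move=> x0 xy; rewrite /nroot ge0_ler_powR ?invr_ge0 // nnegrE //.
exact: le_trans xy.
Qed.

Lemma nroot_le_of_ge1 x : 1 <= x -> nroot x <= x.
Proof.
move=> x1; have x0 : 0 <= x by apply: le_trans x1.
rewrite -(@ler_pXn2r _ k) ?nnegrE ?nroot_ge0 // nrootXn //.
by rewrite ler_eXnr.
Qed.

Lemma nroot_ge_of_le1 x : 0 <= x <= 1 -> x <= nroot x.
Proof.
move=> /andP[x0 x1]; rewrite -(@ler_pXn2r _ k) ?nnegrE ?nroot_ge0 // nrootXn //.
by rewrite ler_iXnr // x0.
Qed.

(** The tangent line inequality for [x ^ (n + 1)]. Applied with [n = k] to the roots of consecutive
    integers, it bounds the increments of [t^(1 + 1/k)] from both sides, in place of a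
    derivative. *)
Lemma weighted_amgm n x y : 0 <= x -> 0 <= y ->
  n.+1%:R * (x ^+ n * y) <= y ^+ n.+1 + n%:R * x ^+ n.+1.
Proof.
move=> x0 y0; elim: n => [|n IHn]; first by rewrite !mul1r mul0r addr0.
rewrite -subr_ge0; have := ler_wpM2r y0 IHn; rewrite -subr_ge0 => h.
have -> : y ^+ n.+2 + n.+1%:R * x ^+ n.+2 - n.+2%:R * (x ^+ n.+1 * y) =
  ((y ^+ n.+1 + n%:R * x ^+ n.+1) * y - n.+1%:R * (x ^+ n * y) * y) +
  n.+1%:R * x ^+ n * (x - y) ^+ 2.
  by rewrite -[n.+2%:R]natr1 -[n.+1%:R]natr1 !exprS; ring.
by rewrite addr_ge0 // mulr_ge0 ?sqr_ge0 // mulr_ge0 // exprn_ge0.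
Qed.

Lemma nroot_pow_succB_le n : k%:R * (nroot n.+1%:R ^+ k.+1 - nroot n%:R ^+ k.+1)
  <= k.+1%:R * nroot n.+1%:R.
Proof.
have := @weighted_amgm k (nroot n%:R) (nroot n.+1%:R) (nroot_ge0 _) (nroot_ge0 _).
rewrite ![nroot _ ^+ k.+1]exprSr !nrootXn // -[n.+1%:R]natr1 -[k.+1%:R]natr1.
by move: (nroot _) (nroot _) => x y h; lra.
Qed.

Lemma nroot_pow_succB_ge n : k.+1%:R * nroot n%:R <=
  k%:R * (nroot n.+1%:R ^+ k.+1 - nroot n%:R ^+ k.+1).
Proof.
have := @weighted_amgm k (nroot n.+1%:R) (nroot n%:R) (nroot_ge0 _) (nroot_ge0 _).
rewrite ![nroot _ ^+ k.+1]exprSr !nrootXn // -[n.+1%:R]natr1 -[k.+1%:R]natr1.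
by move: (nroot _) (nroot _) => x y h; lra.
Qed.
End Root.

Section PrimeRootSums.
Variables (R : realType) (k : nat).
Hypothesis k0 : (0 < k)%N.
Local Notation root := (@nroot R k).
Implicit Types (s : seq nat) (n m p : nat).

Lemma sum_root_le m a : k.+1%:R * \sum_(a <= i < m) root i%:R
   <= k%:R * root m%:R ^+ k.+1.
Proof.
have [am|ma] := leqP a m; last first.
  by rewrite big_geq ?(ltnW ma) // mulr0 mulr_ge0 // exprn_ge0 // nroot_ge0.
rewrite -(subnKC am); elim: (m - a)%N => [|d IHd].
  by rewrite addn0 big_geq // mulr0 mulr_ge0 // exprn_ge0 // nroot_ge0.
rewrite addnS big_nat_recr ?leq_addr //=.
by have := nroot_pow_succB_ge R k0 (a + d); move: IHd; lra.
Qed.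

Lemma sum_root_ge m : k%:R * root m%:R ^+ k.+1 <= k.+1%:R * \sum_(i < m) root i.+1%:R.
Proof.
elim: m => [|m IHm]; first by rewrite big_ord0 nroot0 // expr0n /= !mulr0.
rewrite big_ord_recr /=; have := nroot_pow_succB_le R k0 m; move: IHm; lra.
Qed.

Lemma fact_leq_sorted s : sorted ltn s -> (forall p, p \in s -> (0 < p)%N) ->
  forall i, (i < size s)%N -> (i < nth 0 s i)%N.
Proof.
move=> ss s0; elim=> [|i IHi] si; first by rewrite s0 // mem_nth.
by apply: leq_ltn_trans (IHi (ltnW si)) _; apply: (sortedP 0%N ss).
Qed.

(** The prime of rank [i] is at least [i], so the factorial is at most the product of the primes.
    With [psi q ~ q] this bounds the [n]-th prime from below by about [n * ln n]. *)
Lemma ln_fact_le_psi s q : uniq s -> (forall p, p \in s -> prime p /\ (p <= q)%N) ->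
  ln (size s)`!%:R <= psi R q.
Proof.
move=> us sp; pose t := sort leq s.
have st : sorted ltn t by rewrite ltn_sorted_uniq_leq sort_uniq us sort_sorted //; exact: leq_total.
have tp p : p \in t -> prime p /\ (p <= q)%N by rewrite mem_sort; apply: sp.
rewrite -(size_sort leq s) -/t.
apply: (@le_trans _ _ (\sum_(p <- t) ln p%:R)).
  rewrite (big_nth 0%N) fact_prod big_add1 /= ln_prod; last by [].
  rewrite big_seq [leRHS]big_seq; apply: ler_sum => i; rewrite mem_index_iota /= => it.
  have := fact_leq_sorted st (fun p pt => prime_gt0 (tp p pt).1) it => h.
  by rewrite ler_ln ?posrE ?ltr0n ?ler_nat // (leq_trans _ h).
rewrite /psi; have tP : {subset t <= primes_in 0 q}.
  by move=> p /tp[pp pq]; rewrite mem_primes_in pp prime_gt0.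
have ln0 p : p \in primes_in 0 q -> 0 <= ln p%:R :> R.
  by rewrite mem_primes_in => /and3P[pp _ _]; rewrite ln_ge0 // ler1n prime_gt0.
apply: le_trans (ler_sum_subset _ (uniq_primes_in _ _) tP ln0) _.
  by rewrite sort_uniq.
rewrite big_seq [leRHS]big_seq; apply: ler_sum => p pin; rewrite ler_peMr ?ln0 //.
move: pin; rewrite mem_primes_in ler1n => /and3P[pp _ pq].
by apply: trunc_log_max; rewrite ?prime_gt1 // expn1.
Qed.

Lemma psi_le_card q : psi R q <= (size (primes_in 0 q))%:R * ln q%:R.
Proof.
rewrite /psi; apply: (@le_trans _ _ (\sum_(p <- primes_in 0 q) ln q%:R)); last first.
  by rewrite big_const_seq count_predT iter_addr_0 mulr_natl.
rewrite big_seq [leRHS]big_seq; apply: ler_sum => p.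
rewrite mem_primes_in => /and3P[pp p0 pq]; rewrite mulr_natr -lnXn ?ltr0n // -natrX.
by rewrite ler_ln ?posrE ?ltr0n ?expn_gt0 ?p0 // ?ler_nat ?trunc_logP ?prime_gt1 // (leq_trans p0).
Qed.

Lemma exists_nat_ge (x : R) : exists n, forall m, (n <= m)%N -> x <= m%:R.
Proof.
exists (Num.truncn x).+1 => m nm; apply: le_trans (ltW (truncnS_gt x)) _.
by rewrite ler_nat.
Qed.

Lemma exists_nat_ln_ge (x : R) : exists n, forall m, (n <= m)%N -> x <= ln m%:R.
Proof.
have [n hn] := exists_nat_ge (expR x); exists n.+1 => m nm.
rewrite -[leLHS]expRK ler_ln ?posrE ?expR_gt0 ?ltr0n ?(leq_trans _ nm) //.
by apply: hn; apply: ltnW.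
Qed.

(** After sorting, the prime at index [i] is at least about [(i + 1) * ln (i + 1)], whatever the set
    of primes; the roots are then summed by [sum_root_ge]. *)
Lemma sum_root_primes_ge (c : R) : 0 < c < 1 -> exists m0, forall m s, (m0 <= m)%N ->
  uniq s -> (forall p, p \in s -> prime p) -> (m <= size s)%N ->
  c * (k%:R / k.+1%:R) * root m%:R ^+ k.+1 * root (ln m%:R) <= \sum_(p <- s) root p%:R.
Proof.
move=> /andP[c0 c1]; pose d : R := (1 - c) / 4.
have d0 : 0 < d by rewrite divr_gt0 // subr_gt0.
have d14 : d < 1 / 4 by rewrite /d; lra.
have [J0 HJ] := psi_asymptotic d0.
have [m1 hm1] := exists_nat_ge ((J0.+1)%:R / d).
have [m2 hm2] := exists_nat_ln_ge ((1 - ln d) / d).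
have [m3 hm3] := exists_nat_ln_ge 0.
exists (maxn m1 (maxn m2 (maxn m3 1))) => m s; rewrite !geq_max => /and4P[/hm1 h1 /hm2 h2 /hm3 h3 m0].
have m0' : 0 < m%:R :> R by rewrite ltr0n.
rewrite ler_pdivrMr // in h1; rewrite ler_pdivrMr // in h2.
move=> us sp ms; pose t := sort leq s.
have st : sorted ltn t by rewrite ltn_sorted_uniq_leq sort_uniq us sort_sorted //; exact: leq_total.
have tp p : p \in t -> prime p by rewrite mem_sort; apply: sp.
have tsz : (m <= size t)%N by rewrite size_sort.
have -> : \sum_(p <- s) root p%:R = \sum_(p <- t) root p%:R.
  by apply: perm_big; rewrite perm_sym perm_sort.
rewrite (big_nth 0%N).
(* Ranks below [d * m] are dropped; for the others [ln (i + 1)] falls short of [ln m] by at most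
   [- ln d], which is negligible. *)
pose j0 := Num.truncn (d * m%:R).
have dm0 : 0 <= d * m%:R by rewrite mulr_ge0 // ltW.
have j0le : j0%:R <= d * m%:R by rewrite truncn_le.
have j0m : (j0 <= m)%N.
  by rewrite -(ler_nat R) (le_trans j0le) // ger_pMl // ltW //; lra.
have big i : (j0 <= i < m)%N -> (1 - 2 * d) * (root i.+1%:R * root (ln m%:R)) <= root (nth 0%N t i)%:R.
  move=> /andP[ji im]; set p := nth 0%N t i.
  have it : (i < size t)%N by apply: leq_trans tsz.
  have dmi : d * m%:R <= i.+1%:R.
    by apply: le_trans (ltW (truncnS_gt _)) _; rewrite ler_nat ltnS.
  have pt : p \in t by rewrite mem_nth.
  have pI : (i < p)%N by apply: (fact_leq_sorted st (fun p pt => prime_gt0 (tp p pt)) it).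
  have x0 : 0 < i.+1%:R :> R by [].
  have ps : ln i.+1`!%:R <= psi R p.
    rewrite -(size_takel it); apply: ln_fact_le_psi; first by rewrite take_uniq // sort_uniq.
    move=> q qin; split; first by apply: tp; apply: mem_take qin.
    case/(nthP 0%N): qin => l; rewrite size_takel // => li <-.
    rewrite nth_take //; have [->|nli] := eqVneq l i; first by [].
    have lti : (l < i)%N by rewrite ltn_neqAle nli -ltnS.
    by apply: ltnW; apply: (sorted_ltn_nth ltn_trans 0%N st); rewrite ?inE ?(ltn_trans lti it).
  have [fl _] := ln_fact_bounds R (isT : (0 < i.+1)%N).
  have lnge : ln d + ln m%:R <= ln i.+1%:R.
    by rewrite -lnM ?posrE // ler_ln ?posrE // mulr_gt0.
  have J0p : (J0 <= p)%N.
    apply: leq_trans pI; rewrite -(ler_nat R); apply: le_trans dmi.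
    apply: le_trans (_ : J0.+1%:R <= _); first by rewrite ler_nat.
    by rewrite mulrC.
  have := HJ _ J0p; rewrite ler_norml => /andP[_ pu].
  have : (1 - 2 * d) * (i.+1%:R * ln m%:R) <= p%:R.
    have : i.+1%:R * ((1 - d) * ln m%:R) <= (1 + d) * p%:R.
      apply: le_trans (_ : i.+1%:R * (ln i.+1%:R - 1) <= _); last by move: fl ps pu; lra.
      by rewrite ler_pM2l //; move: lnge h2; lra.
    rewrite mulrCA; have := mulr_ge0 (ltW x0) h3; move: (i.+1%:R * ln m%:R) => w w0 h.
    have d1 : 0 < 1 + d by rewrite addr_gt0.
    rewrite -(ler_pM2l d1); apply: le_trans h.
    have := mulr_ge0 (ltW d0) (mulr_ge0 (ltW d0) w0).
    by move: (ltW d0); lra.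
  have y0 : 0 <= i.+1%:R * ln m%:R :> R by rewrite mulr_ge0.
  have d12 : 0 <= 1 - 2 * d <= 1 by move: d0 d14; clear => *; apply/andP; split; lra.
  move=> h; apply: le_trans (ler_nroot k (mulr_ge0 _ y0) h); last by case/andP: d12.
  rewrite nrootM ?(andP d12).1 // nrootM //.
  by rewrite ler_wpM2r ?mulr_ge0 ?nroot_ge0 // nroot_ge_of_le1.
apply: (@le_trans _ _ (\sum_(j0 <= i < m) root (nth 0%N t i)%:R)); last first.
  rewrite [leRHS](big_cat_nat (n := j0)) // ?(leq_trans j0m) //= -[leLHS]add0r lerD //.
    by apply: sumr_ge0 => i _; apply: nroot_ge0.
  rewrite [leRHS](big_cat_nat (n := m)) //= -[leLHS]addr0 lerD //.
  by apply: sumr_ge0 => i _; apply: nroot_ge0.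
apply: (@le_trans _ _ (\sum_(j0 <= i < m) (1 - 2 * d) * (root i.+1%:R * root (ln m%:R)))); last first.
  by rewrite big_seq [leRHS]big_seq; apply: ler_sum => i; rewrite mem_index_iota; apply: big.
rewrite -mulr_sumr -mulr_suml mulrA ler_wpM2r ?nroot_ge0 //.
have S1 := sum_root_ge m.
have S2 : \sum_(i < m) root i.+1%:R = \sum_(0 <= i < j0) root i.+1%:R + \sum_(j0 <= i < m) root i.+1%:R.
  by rewrite -(big_mkord xpredT (fun i => root i.+1%:R)) (big_cat_nat (n := j0)).
have S3 : \sum_(0 <= i < j0) root i.+1%:R <= d * root m%:R ^+ k.+1.
  apply: (@le_trans _ _ (\sum_(0 <= i < j0) root m%:R)).
    rewrite big_seq [leRHS]big_seq; apply: ler_sum => i; rewrite mem_index_iota => /andP[_ ij].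
    by rewrite ler_nroot // ler_nat (leq_trans ij).
  rewrite sumr_const_nat subn0 -[leLHS]mulr_natl exprSr nrootXn // mulrA.
  by rewrite ler_wpM2r ?nroot_ge0.
rewrite S2 in S1; move: S1 S3.
have K1 : 1 <= k%:R :> R by rewrite ler1n.
have Kp : 0 < k.+1%:R :> R by [].
have M0 : 0 <= root m%:R ^+ k.+1 by rewrite exprn_ge0 // nroot_ge0.
move: (\sum_(0 <= i < j0) _) (\sum_(j0 <= i < m) _) (root m%:R ^+ k.+1) M0 => A B M M0 S1 S3.
rewrite mulrAC mulrA ler_pdivrMr // -[k.+1%:R]natr1 in Kp *.
move: S1; rewrite -natr1; move: k%:R K1 => K K1 S1.
have -> : c = 1 - 4 * d by rewrite /d; field.
have e1 : K * M - (K + 1) * (d * M) <= (K + 1) * B.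
  have hA : (K + 1) * A <= (K + 1) * (d * M).
    by rewrite ler_wpM2l // addr_ge0 // (le_trans _ K1).
  by move: hA S1; clear; lra.
have : 0 <= 1 - 2 * d by lra.
move=> e0; have := ler_wpM2l e0 e1.
have K1' : 0 <= K - 1 by rewrite subr_ge0.
have dM0 : 0 <= d * M by apply: mulr_ge0 => //; apply: ltW.
have := mulr_ge0 K1' dM0; have := mulr_ge0 (ltW d0) dM0.
have := mulr_ge0 K1' (mulr_ge0 (ltW d0) dM0).
by move: dM0; clear; lra.
Qed.
End PrimeRootSums.

Section SmallPrimes.
Variables (R : realType) (k : nat).
Hypothesis k0 : (0 < k)%N.
Local Notation root := (@nroot R k).
Implicit Types (s : seq nat) (n m p : nat).

Lemma primes_in_rank a b i : (i < size (primes_in a b))%N ->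
  size (primes_in a (nth 0%N (primes_in a b) i)) = i.+1.
Proof.
move=> ib; set p := nth _ _ _.
have pin : p \in primes_in a b by rewrite mem_nth.
have := pin; rewrite mem_primes_in => /and3P[pp ap pb].
have p0 := prime_gt0 pp.
have E : primes_in a p = rcons (primes_in a p.-1) p.
  rewrite (@primes_in_cat a p.-1) ?leq_pred //; last by lia.
  rewrite -cats1; congr (_ ++ _); rewrite /primes_in prednK //.
  by rewrite /index_iota subSnn /= pp.
have : index p (primes_in a b) = i by rewrite index_uniq ?uniq_primes_in.
rewrite (@primes_in_cat a p) ?(ltnW ap) // index_cat E mem_rcons inE eqxx /= size_rcons.
rewrite -cats1 index_cat mem_primes_in /= eqxx addn0.
by case: ifP => [/and3P[_ _]|_ ->//]; lia.
Qed.

Lemma primes_in_unbounded a m : exists2 b, (a <= b)%N & (m <= size (primes_in a b))%N.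
Proof.
elim: m => [|m [b ab mb]]; first by exists a.
have [p bp pp] := prime_above b; exists p; first exact: leq_trans ab (ltnW bp).
rewrite (@primes_in_cat a b) ?(ltnW bp) // size_cat -[m.+1]addn1 leq_add //.
by rewrite -has_predT; apply/hasP; exists p; rewrite // mem_primes_in pp bp leqnn.
Qed.

(** Take logarithms and use [ln (ln p) <= d * ln p - ln d]. This replaces [ln p] by [ln m] in the
    estimate of the primes of rank at most [m]. *)
Lemma ln_prime_bound (d : R) a : 0 < d < 1 -> exists m0, forall m p, (m0 <= m)%N -> (0 < p)%N ->
  (1 - d) * p%:R <= (m + a)%:R * ln p%:R -> ln p%:R <= (1 + d) / (1 - d) * ln m%:R.
Proof.
move=> /andP[d0 d1]; pose C : R := ln 2 - ln (1 - d) - ln d.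
have [m1 hm1] := @exists_nat_ln_ge R (C / d).
have d1' : 0 < 1 - d by rewrite subr_gt0.
exists (maxn m1 (maxn a 1)) => m p; rewrite !geq_max => /and3P[/hm1 h1 am m0] p0 H.
have m0' : 0 < m%:R :> R by rewrite ltr0n.
have p0' : 0 < p%:R :> R by rewrite ltr0n.
rewrite ler_pdivrMr // in h1.
have [lp|lp] := leP (ln p%:R : R) 0.
  by apply: le_trans lp _; rewrite mulr_ge0 ?divr_ge0 ?ln_ge0 ?ler1n ?(ltW d1') // addr_ge0 // ltW.
have H2 : (1 - d) * p%:R <= 2 * m%:R * ln p%:R.
  apply: le_trans H _; rewrite ler_wpM2r ?(ltW lp) // -natrM ler_nat; lia.
have H3 : ln (1 - d) + ln p%:R <= ln 2 + ln m%:R + ln (ln p%:R).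
  rewrite -!lnM ?posrE ?mulr_gt0 // ler_ln ?posrE ?mulr_gt0 //.
have H4 : ln d + ln (ln p%:R) <= d * ln p%:R.
  rewrite -lnM ?posrE //; have := @le_ln1Dx R (d * ln p%:R - 1).
  rewrite (addrC 1) subrK => h; apply: le_trans (h _) _; last by rewrite gerBl.
  by rewrite ltrBrDr addNr mulr_gt0.
rewrite mulrAC ler_pdivlMr //; move: H3 H4 h1; rewrite /C; clear; lra.
Qed.

(** The primes are taken beyond [J0], where the estimate of [psi] holds; skipping those up to [a]
    shifts the ranks by at most [a], negligible against [m]. The bound [P0] will be [k], so that [k]
    nonzero residues exist. *)
Lemma exists_primes_sum_root_le (c : R) P0 : 1 < c -> exists m0, forall m, (m0 <= m)%N ->
  exists s, [/\ uniq s, forall p, p \in s -> prime p /\ (P0 < p)%N, size s = m &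
  \sum_(p <- s) root p%:R <= c * (k%:R / k.+1%:R) * root m%:R ^+ k.+1 * root (ln m%:R)].
Proof.
move=> c1; pose d : R := Num.min (1 / 2) ((c - 1) / 34).
have d0 : 0 < d by rewrite lt_min !divr_gt0 // subr_gt0.
have d12 : d <= 1 / 2 by rewrite ge_min lexx.
have dc : 1 + 34 * d <= c.
  have : d <= (c - 1) / 34 by rewrite ge_min lexx orbT.
  by rewrite ler_pdivlMr // => h; lra.
have [J0 HJ] := psi_asymptotic d0.
pose a := maxn P0 J0.
have [m1 hm1] := @ln_prime_bound d a ltac:(lra).
have [m2 hm2] := exists_nat_ge (a.+1%:R / d).
exists (maxn m1 (maxn m2 1)) => m; rewrite !geq_max => /and3P[hm1' /hm2 h2 m0].
rewrite ler_pdivrMr // in h2.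
have [b _ mb] := primes_in_unbounded a m.
have {hm1} hm1 p := hm1 m p hm1'.
pose s := take m (primes_in a b).
have sP p : p \in s -> prime p /\ (a < p)%N.
  by move/mem_take; rewrite mem_primes_in => /and3P[].
exists s; split.
- by rewrite take_uniq // uniq_primes_in.
- by move=> p /sP[pp ap]; split => //; apply: leq_ltn_trans ap; rewrite leq_maxl.
- by rewrite size_takel.
have m0' : 0 < m%:R :> R by rewrite ltr0n.
have lm0 : 0 <= ln m%:R :> R by rewrite ln_ge0 // ler1n.
pose kap : R := (1 + d) / (1 - d) ^+ 2.
have d1 : 0 < 1 - d by lra.
have kap1 : 1 <= kap.
  by rewrite /kap ler_pdivlMr ?exprn_gt0 // mul1r; nra.
have nthb i : (i < m)%N -> root (nth 0%N s i)%:R <= kap * (root (i.+1 + a)%:R * root (ln m%:R)).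
  move=> im; rewrite nth_take //; set p := nth _ _ _.
  have ib : (i < size (primes_in a b))%N by apply: leq_trans mb.
  have := mem_nth 0%N ib; rewrite -/p mem_primes_in => /and3P[pp ap pb].
  have := primes_in_rank ib; rewrite -/p => rk.
  have p0 := prime_gt0 pp; have p0' : 0 < p%:R :> R by rewrite ltr0n.
  have lp0 : 0 <= ln p%:R :> R by rewrite ln_ge0 // ler1n.
  have cnt : (size (primes_in 0 p) <= i.+1 + a)%N.
    rewrite (@primes_in_cat 0 a) ?(ltnW ap) // size_cat rk addnC leq_add2l.
    by rewrite size_filter (leq_trans (count_size _ _)) // size_iota subSS subn0.
  have := HJ p (leq_trans (leq_maxr P0 J0) (ltnW ap)); rewrite ler_norml => /andP[pl _].
  have psi_u := psi_le_card R p.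
  have bnd : (1 - d) * p%:R <= (i.+1 + a)%:R * ln p%:R.
    apply: le_trans (_ : psi R p <= _); first by move: pl; lra.
    by apply: le_trans psi_u _; rewrite ler_wpM2r // ler_nat.
  have lpm : ln p%:R <= (1 + d) / (1 - d) * ln m%:R :> R.
    apply: hm1 => //; apply: le_trans bnd _; rewrite ler_wpM2r // ler_nat leq_add2r //.
  have pk : p%:R <= kap * ((i.+1 + a)%:R * ln m%:R).
    rewrite -(ler_pM2l d1); apply: le_trans bnd _.
    have -> : (1 - d) * (kap * ((i.+1 + a)%:R * ln m%:R)) =
       (i.+1 + a)%:R * ((1 + d) / (1 - d) * ln m%:R).
      by rewrite /kap; field; rewrite gt_eqF.
    by rewrite ler_wpM2l.
  apply: le_trans (ler_nroot k (ltW p0') pk) _.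
  have i0 := ler0n R (i.+1 + a).
  rewrite (nrootM k (le_trans ler01 kap1) (mulr_ge0 i0 lm0)) (nrootM k i0 lm0).
  by apply: ler_wpM2r; [rewrite mulr_ge0 ?nroot_ge0 | apply: nroot_le_of_ge1].
rewrite (big_nth 0%N) size_takel //.
apply: (@le_trans _ _ (\sum_(0 <= i < m) kap * (root (i.+1 + a)%:R * root (ln m%:R)))).
  by rewrite big_seq [leRHS]big_seq; apply: ler_sum => i; rewrite mem_index_iota; apply: nthb.
rewrite -mulr_sumr -mulr_suml mulrA ler_wpM2r ?nroot_ge0 //.
have S1 : k.+1%:R * \sum_(0 <= i < m) root (i.+1 + a)%:R <= k%:R * root (m + a.+1)%:R ^+ k.+1.
  have := @sum_root_le R k k0 (m + a.+1) (0 + a.+1).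
  rewrite big_addn addnK; under eq_bigr do rewrite addnS -addSn.
  by [].
have S2 : root (m + a.+1)%:R ^+ k.+1 <= (1 + d) ^+ 2 * root m%:R ^+ k.+1.
  have le : (m + a.+1)%:R <= (1 + d) * m%:R by rewrite natrD; move: h2; lra.
  have d1' : 1 <= 1 + d by rewrite lerDl ltW.
  rewrite !exprSr !nrootXn // expr0 mul1r mulrACA; apply: ler_pM; rewrite ?nroot_ge0 //.
  apply: le_trans (ler_nroot k (ler0n R _) le) _.
  rewrite (nrootM k (le_trans ler01 d1') (ltW m0')).
  by apply: ler_wpM2r; [exact: nroot_ge0 | apply: nroot_le_of_ge1].
have M0 : 0 <= root m%:R ^+ k.+1 by rewrite exprn_ge0 // nroot_ge0.
have kk : kap * (1 + d) ^+ 2 <= c.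
  apply: le_trans dc; rewrite /kap mulrAC ler_pdivrMr ?exprn_gt0 //.
  rewrite -subr_ge0; move: d0 d12; move: (d) => x x0 x12.
  have -> : (1 + 34 * x) * (1 - x) ^+ 2 - (1 + x) * (1 + x) ^+ 2 =
    x * (29 - 70 * x + 33 * x ^+ 2) by ring.
  by rewrite mulr_ge0 ?(ltW x0) //; have := sqr_ge0 x; nra.
have K0 : 0 < k.+1%:R :> R by [].
rewrite (_ : c * _ * _ = c * root m%:R ^+ k.+1 * k%:R / k.+1%:R); last by ring.
rewrite ler_pdivlMr // -[c * _ * _]mulrA (mulrC _ k.+1%:R) mulrCA.
apply: le_trans (ler_wpM2l (le_trans ler01 kap1) S1) _.
apply: le_trans (_ : kap * (k%:R * ((1 + d) ^+ 2 * root m%:R ^+ k.+1)) <= _).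
  by rewrite ler_wpM2l ?(le_trans _ kap1) // ler_wpM2l.
have -> : kap * (k%:R * ((1 + d) ^+ 2 * root m%:R ^+ k.+1)) =
  kap * (1 + d) ^+ 2 * (root m%:R ^+ k.+1 * k%:R) by ring.
by rewrite ler_wpM2r // mulr_ge0.
Qed.
End SmallPrimes.

(** * Essential subsets and primes *)

Section SumsetLists.
Local Open Scope nat_scope.
Local Open Scope classical_set_scope.

Lemma sumsetP h (A : set nat) n : sumset h A n <->
  exists l, [/\ size l = h, forall x, x \in l -> A x & sumn l = n].
Proof.
split=> [[f [fA ->]]|[l [sl lA <-]]].
  exists [seq f i | i <- enum 'I_h]; split; first by rewrite size_map size_enum_ord.
    by move=> x /mapP[i _ ->].
  by rewrite sumnE big_map big_enum.
exists (fun i => nth 0 l i); split; first by move=> i; apply: lA; rewrite mem_nth ?sl.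
by rewrite sumnE (big_nth 0) sl big_mkord.
Qed.

(** The summand 0 is traded for a shorter sum, which makes concatenation and translation of sums
    easy. *)
Lemma covers_ZNP N h s : 0 < N -> covers_ZN N h s <->
  forall x, exists l, [/\ size l <= h, {subset l <= s} & sumn l = x %[mod N]].
Proof.
move=> N0; split=> [cov x|cov x xN].
  have [f [fs xf]] := cov (x %% N) (ltn_pmod x N0).
  pose l := [seq f i | i <- enum 'I_h]; exists [seq y <- l | y \in s]; split.
  - by rewrite size_filter (leq_trans (count_size _ _)) // size_map size_enum_ord.
  - by move=> y; rewrite mem_filter => /andP[].
  rewrite xf; congr (_ %% _); rewrite sumnE big_filter big_mkcond big_map big_enum /=.
  by apply: eq_bigr => i _; case: ifP => // nfs; case: (fs i) => // fis; rewrite fis in nfs.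
have [l [lh ls lx]] := cov x; exists (fun i => nth 0 l i); split.
  move=> i; have [il|il] := ltnP i (size l); last by left; rewrite nth_default.
  by right; apply: ls; rewrite mem_nth.
rewrite -[LHS](modn_small xN) -lx; congr (_ %% _); rewrite sumnE (big_nth 0) big_mkord.
rewrite (big_ord_widen _ (fun i => nth 0 l i) lh) big_mkcond; apply: eq_bigr => i _.
by case: ltnP => // il; rewrite nth_default.
Qed.

Lemma sumn_eqmod (N : nat) (f : nat -> nat) l :
  (forall x, x \in l -> x = f x %[mod N]) -> sumn l = sumn (map f l) %[mod N].
Proof.
elim: l => //= x l IHl lf; rewrite -[LHS]modnDm (lf x) ?mem_head // IHl ?modnDm //.
by move=> y yl; apply: lf; rewrite inE yl orbT.
Qed.

Lemma sumn_const (c : nat) l : (forall x, x \in l -> x = c) -> sumn l = size l * c.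
Proof.
elim: l => //= x l IHl lc; rewrite IHl; last by move=> y yl; apply: lc; rewrite inE yl orbT.
by rewrite mulSn (lc x) ?mem_head.
Qed.

Lemma leq_sumn c l : (forall x, x \in l -> x <= c) -> sumn l <= size l * c.
Proof.
elim: l => //= x l IHl lc; rewrite mulSn leq_add ?lc ?mem_head //.
by apply: IHl => y yl; apply: lc; rewrite inE yl orbT.
Qed.

Lemma is_basisP (A : set nat) : is_basis A <-> exists h, cofinite_in_N (sumset h A).
Proof.
split=> [[h [cof _]]|exh]; first by exists h.
have exh' : exists h, `[< cofinite_in_N (sumset h A) >] by case: exh => h ?; exists h; apply/asboolP.
case: (ex_minnP exh') => h /asboolP cofh hmin; exists h; split=> // cof.
(* For [h = 0] the predecessor is again 0, so minimality alone is no contradiction; but the only sum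
   of no elements is 0. *)
have := hmin h.-1; rewrite asboolT // => /(_ isT) hh; have h0 : h = 0 by lia.
rewrite h0 in cofh; case: cofh => M /(_ M.+1 (leqnSn M)) /sumsetP[l [/size0nil -> _]] //.
Qed.

Lemma cofinite_infinite h (A : set nat) (E : seq nat) : cofinite_in_N (sumset h A) ->
  exists2 x, A x & x \notin E.
Proof.
case=> M cof; apply: contrapT => nex.
pose m := \max_(x <- E) x.
have /sumsetP[l [sl lA sn]] := cof (M + (h * m).+1) (leq_addr _ _).
have : sumn l <= size l * m.
  apply: leq_sumn => x xl; apply: leq_bigmax_seq => //.
  by apply/negPn/negP => xE; apply: nex; exists x => //; apply: lA.
by rewrite sn sl; lia.
Qed.

(** All sums of [h] elements lie in the single class of [h * a]. *)
Lemma eqmod_not_basis (A : set nat) p a : prime p -> (forall x, A x -> x = a %[mod p]) ->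
  ~ is_basis A.
Proof.
move=> pp Ap /is_basisP[h [M cof]]; have p1 := prime_gt1 pp.
have E n : M <= n -> n = h * a %[mod p].
  move=> /cof/sumsetP[l [sl lA <-]]; rewrite (@sumn_eqmod p (fun=> a)); last by move=> x /lA/Ap.
  by rewrite (@sumn_const a) ?size_map ?sl // => x /mapP[].
have := E M.+1 (leqnSn M); rewrite -(E M (leqnn M)) -addn1 -[in RHS](addn0 M) => /eqP.
by rewrite eqn_modDl mod0n modn_small.
Qed.

(** Differences of two sums with equally many summands. They are closed under subtraction, so the
    least positive one divides all of them and serves as the gcd of the differences of [B]. *)
Definition diff_in (B : set nat) d := exists m n, sumset m B n /\ sumset m B (n + d).

Lemma sumsetD (B : set nat) m1 m2 n1 n2 : sumset m1 B n1 -> sumset m2 B n2 ->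
  sumset (m1 + m2) B (n1 + n2).
Proof.
move=> /sumsetP[l1 [<- A1 <-]] /sumsetP[l2 [<- A2 <-]]; apply/sumsetP; exists (l1 ++ l2).
rewrite size_cat sumn_cat; split=> // x.
by rewrite mem_cat => /orP[/A1|/A2].
Qed.

Lemma diff_inB (B : set nat) d e : d <= e -> diff_in B d -> diff_in B e -> diff_in B (e - d).
Proof.
move=> de [m1 [n1 [h1 h2]]] [m2 [n2 [h3 h4]]]; exists (m1 + m2), (n1 + d + n2); split.
  exact: sumsetD.
have -> : n1 + d + n2 + (e - d) = n1 + (n2 + e) by lia.
exact: sumsetD.
Qed.

Lemma diff_in_dvd (B : set nat) d e : 0 < d -> diff_in B d ->
  (forall d', 0 < d' < d -> ~ diff_in B d') -> diff_in B e -> d %| e.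
Proof.
move=> d0 Bd dmin; elim/ltn_ind: e => e IHe Be.
have [->//|e0] := posnP e; have [de|ed] := leqP d e.
  have dv : d %| e - d by apply: IHe; [lia | apply: diff_inB].
  by rewrite -(subnK de) dvdn_addl.
by case: (dmin e); rewrite ?e0.
Qed.

Lemma sumset_interval (B : set nat) m n : sumset m B n -> sumset m B n.+1 ->
  forall L j, j <= L -> sumset (L * m) B (L * n + j).
Proof.
move=> h0 h1; elim=> [|L IHL] j jL.
  by apply/sumsetP; exists [::]; split => //=; lia.
rewrite !mulSn; case: j jL => [|j] jL.
  by rewrite -addnA; apply: sumsetD => //; apply: IHL.
rewrite (_ : n + L * n + j.+1 = n.+1 + (L * n + j)); last by lia.
by apply: sumsetD => //; apply: IHL.
Qed.

(* Erdos-Graham: if the differences of [A \ E] had no common prime factor, some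
   multiple of it would contain two consecutive integers, hence long intervals,
   which absorb the bounded contribution of [E] to a sum of [h] elements of [A]. *)
Lemma not_basis_eqmod (A : set nat) (E : seq nat) : is_basis A ->
  ~ is_basis (A `\` [set x | x \in E]) ->
  exists p a, prime p /\ forall x, A x -> x \notin E -> x = a %[mod p].
Proof.
move=> /is_basisP[h cofA] nB; set B := A `\` _ in nB *.
have [b0 Ab0 b0E] := cofinite_infinite E cofA.
have Bb0 : B b0 by split => //=; apply/negP.
have B1 x : B x -> sumset 1 B x.
  by move=> Bx; apply/sumsetP; exists [:: x]; split; rewrite /= ?addn0 // => y; rewrite inE => /eqP->.
have dB x : B x -> diff_in B (x - b0) /\ diff_in B (b0 - x).
  move=> Bx; case: (leqP x b0) => xb.
    rewrite (eqnP xb); split; [exists 1, b0|exists 1, x]; split; rewrite ?addn0 ?subnKC //; exact: B1.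
  rewrite (eqnP (ltnW xb)); split; [exists 1, b0|exists 1, x]; split; rewrite ?addn0 ?subnKC ?(ltnW xb) //; exact: B1.
apply: contrapT => nex; apply: nB; apply/is_basisP.
have exd : exists d, (0 < d) && `[< diff_in B d >].
  (* Without a positive difference [B] is a single point, and any prime will do. *)
  apply: contrapT => nd; apply: nex; exists 2, b0; split => // x Ax xE.
  have Bx : B x by split => //=; apply/negP.
  have [d1 d2] := dB x Bx; have [->//|xb] := eqVneq x b0.
  case: nd; case: (ltngtP x b0) xb => // xb _; [exists (b0 - x) | exists (x - b0)];
    by rewrite subn_gt0 xb; apply/asboolP.
case: (ex_minnP exd) => d /andP[d0 /asboolP Bd] dmin.
have dmin' d' : 0 < d' < d -> ~ diff_in B d'.
  move=> /andP[d'0 d'd] Bd'; have := dmin d'; rewrite d'0 asboolT // => /(_ isT); lia.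
have d1 : d = 1.
  apply: contrapT => dn1; apply: nex; exists (pdiv d), b0; split; first by apply: pdiv_prime; lia.
  move=> x Ax xE; have Bx : B x by split => //=; apply/negP.
  have [e1 e2] := dB x Bx.
  have f1 := dvdn_trans (pdiv_dvd d) (diff_in_dvd d0 Bd dmin' e1).
  have f2 := dvdn_trans (pdiv_dvd d) (diff_in_dvd d0 Bd dmin' e2).
  apply/eqP; case: (leqP x b0) => xb; first by rewrite eq_sym eqn_mod_dvd.
  by rewrite eqn_mod_dvd // ltnW.
rewrite d1 in Bd; case: Bd => m [n []]; rewrite addn1 => Bn Bn1.
case: cofA => M cofA.
(* Summands from [E] are replaced by copies of [b0]; [L] bounds the resulting discrepancy in either
   direction, to be corrected inside the interval. *)
pose e := \max_(x <- E) x; pose L := h * e + h * b0.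
exists (h + L * m); exists (M + L * n + h * b0) => x Mx.
pose y := x - (L * n + h * b0).
have /sumsetP[l [sl lA ly]] : sumset h A y by apply: cofA; rewrite /y; lia.
pose l1 := [seq z <- l | z \notin E]; pose l2 := [seq z <- l | z \in E].
have sz : size l1 + size l2 = h.
  by rewrite !size_filter addnC -sl count_predC.
have sm : sumn l1 + sumn l2 = y.
  by rewrite -ly !sumnE !big_filter [in RHS](bigID (mem E)) /= addnC.
have l2e : sumn l2 <= h * e.
  apply: leq_trans (_ : size l2 * e <= _); last by rewrite leq_mul2r; lia.
  apply: leq_sumn => z; rewrite mem_filter => /andP[zE _]; exact: leq_bigmax_seq.
have s2 : size l2 * b0 <= h * b0 by rewrite leq_mul2r; lia.
have H1 : sumset h B (sumn l1 + size l2 * b0).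
  apply/sumsetP; exists (l1 ++ nseq (size l2) b0).
  rewrite size_cat size_nseq sumn_cat sumn_nseq mulnC; split => // z.
  rewrite mem_cat mem_filter => /orP[/andP[zE zl]|/nseqP[-> _]//].
  by split; [apply: lA | apply/negP].
have := sumset_interval Bn Bn1 (_ : h * b0 + sumn l2 - size l2 * b0 <= L).
rewrite {1}/L => H2; have {}H2 := H2 ltac:(lia); have := sumsetD H1 H2.
by rewrite (_ : sumn l1 + _ + _ = x) //; move: sm Mx s2 ; rewrite /y; lia.
Qed.
End SumsetLists.

(** * Essential subsets as residue conditions *)

Section EssentialModuli.
Local Open Scope nat_scope.
Local Open Scope classical_set_scope.

Lemma essential_modulus (A : set nat) E : is_basis A -> essential A E ->
  exists p a, prime p /\ forall x, A x -> (x \in E) = (x != a %[mod p]).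
Proof.
move=> bA [_ [EA [nB Emin]]]; have [p [a [pp pa]]] := not_basis_eqmod bA nB.
exists p, a; split=> // x Ax; apply/idP/idP => [xE|]; last first.
  by apply: contraR => xE; apply/eqP; apply: pa.
apply/eqP => xa; have : is_basis (A `\` [set y | y \in [seq y <- E | y != x]]).
  apply: Emin; first by move=> y; rewrite mem_filter => /andP[].
  by exists x; rewrite // mem_filter eqxx.
apply: (eqmod_not_basis (a := a) pp) => y [Ay /=]; rewrite mem_filter => /negP yE.
by have [->//|yx] := eqVneq y x; apply: pa => //; apply: contra yE => ->; rewrite yx.
Qed.

(** An element of [A] outside both lists lies in both classes, which therefore coincide modulo [p];
    sorted lists with the same members are equal. *)
Lemma essential_inj (A : set nat) E E' p a a' : is_basis A -> essential A E -> essential A E' ->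
  (forall x, A x -> (x \in E) = (x != a %[mod p])) ->
  (forall x, A x -> (x \in E') = (x != a' %[mod p])) -> E = E'.
Proof.
move=> /is_basisP[h cof] [sE [EA _]] [sE' [EA' _]] HE HE'.
have [b Ab] := cofinite_infinite (E ++ E') cof; rewrite mem_cat negb_or.
rewrite HE // HE' // !negbK => /andP[/eqP ba /eqP ba'].
apply: (irr_sorted_eq ltn_trans ltnn sE sE') => x; apply/idP/idP => xE.
  by have Ax := EA x xE; rewrite HE' // -ba' ba -HE.
by have Ax := EA' x xE; rewrite HE // -ba ba' -HE'.
Qed.

(** [P E] is the prime attached to [E], and [a E] represents the class modulo [P E] that contains
    the rest of [A]. *)
Definition separates (A : set nat) (P a : seq nat -> nat) (s : seq (seq nat)) :=
  [/\ {in s &, injective P}, forall E, E \in s -> prime (P E),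
    forall E, E \in s -> (forall x, x \in E -> A x) &
    forall E, E \in s -> forall x, A x -> (x \in E) = (x != a E %[mod P E])].

Lemma exists_separates (A : set nat) s : is_basis A ->
  (forall E, E \in s -> essential A E) -> exists P a, separates A P a s.
Proof.
move=> bA sE.
have H E : exists pa : nat * nat, E \in s ->
    prime pa.1 /\ forall x, A x -> (x \in E) = (x != pa.2 %[mod pa.1]).
  have [Es|] := boolP (E \in s); last by exists (0, 0).
  by have [p [a pa]] := essential_modulus bA (sE E Es); exists (p, a).
have [f fP] := choice H; exists (fun E => (f E).1), (fun E => (f E).2); split.
- move=> E E' Es Es' /= PE; have [_ h] := fP E Es; have [_ h'] := fP E' Es'.
  by apply: (essential_inj bA (sE E Es) (sE E' Es') h); rewrite PE; exact: h'.
- by move=> E Es; have [] := fP E Es.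
- by move=> E /sE[_ []].
- by move=> E Es; have [] := fP E Es.
Qed.

Lemma separates_sub (A : set nat) P a s t : {subset t <= s} -> separates A P a s ->
  separates A P a t.
Proof.
move=> ts [h1 h2 h3 h4]; split; last 3 first.
- by move=> E /ts/h2.
- by move=> E /ts/h3.
- by move=> E /ts/h4.
by move=> E E' /ts Es /ts Es'; apply: h1.
Qed.

Section ChineseList.
Variables (T : eqType) (P : T -> nat).

Lemma chinese_list (s : seq T) (r : T -> nat) M : uniq s ->
  {in s &, injective P} -> (forall E, E \in s -> prime (P E)) ->
  exists2 x, M <= x & forall E, E \in s -> x = r E %[mod P E].
Proof.
elim: s => [|E s IHs] /=; first by exists M.
move=> /andP[Es us] Pinj pP.
have [||x Mx xr] := IHs us; first by move=> u v us' vs'; apply: Pinj; rewrite inE ?us' ?vs' orbT.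
  by move=> F Fs; apply: pP; rewrite inE Fs orbT.
pose Q := \prod_(F <- s) P F.
have pE : prime (P E) by rewrite pP ?mem_head.
have Q0 : 0 < Q.
  by rewrite /Q big_seq prodn_cond_gt0 // => F Fs; rewrite prime_gt0 // pP // inE Fs orbT.
have cop : coprime (P E) Q.
  rewrite prime_coprime // Euclid_dvd_prod // big_has; apply/hasPn => F Fs.
  have pF : prime (P F) by apply: pP; rewrite inE Fs orbT.
  rewrite dvdn_prime2 //; apply: contra Es => /eqP PEF.
  by rewrite (Pinj E F) ?mem_head ?inE ?Fs ?orbT.
pose y := chinese (P E) Q (r E) x; pose z := y + M * (P E * Q).
have Mz : M <= z by rewrite (leq_trans _ (leq_addl _ _)) // leq_pmulr // muln_gt0 prime_gt0.
exists z => // F; rewrite inE => /orP[/eqP ->|Fs].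
  by rewrite /z addnC mulnCA mulnC modnMDl chinese_modl.
have PQ : P F %| Q.
  by rewrite /Q (big_rem F) //= dvdn_mulr.
rewrite -(modn_dvdm z PQ) /z addnC mulnA modnMDl chinese_modr // modn_dvdm //.
exact: xr.
Qed.

Lemma eqmod_prod (s : seq T) x y : uniq s -> {in s &, injective P} ->
  (forall E, E \in s -> prime (P E)) -> (forall E, E \in s -> x = y %[mod P E]) ->
  x = y %[mod \prod_(E <- s) P E].
Proof.
move=> us Pinj pP xy; apply/eqP; wlog yx : x y xy / y <= x.
  move=> H; case: (leqP y x) => [|/ltnW] h; first exact: H.
  by rewrite eq_sym H // => E /xy.
rewrite eqn_mod_dvd // -(big_map P xpredT id); apply: prod_uniq_primes_dvd.
  by rewrite map_inj_in_uniq.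
move=> p /mapP[E Es ->]; split; first exact: pP.
by rewrite -eqn_mod_dvd //; apply/eqP/xy.
Qed.
End ChineseList.

Lemma perm_filter_mem (V l l' : seq nat) :
  (forall x, x \in V -> count_mem x l = count_mem x l') ->
  perm_eq [seq x <- l | x \in V] [seq x <- l' | x \in V].
Proof.
move=> H; apply/allP => x; rewrite mem_cat !mem_filter -andb_orr => /andP[xV _] /=.
rewrite !count_filter; apply/eqP.
rewrite (eq_count (a2 := pred1 x)) ?(eq_count (a1 := predI _ _) (a2 := pred1 x)) ?H //.
  by move=> y /=; case: eqP => // ->; rewrite xV.
by move=> y /=; case: eqP => // ->; rewrite xV.
Qed.

Lemma count_sum_leq (V l : seq nat) : uniq V ->
  \sum_(x <- V) count_mem x l <= size l.
Proof.
elim: l => [|y l IHl] uV; first by rewrite big1.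
rewrite /= big_split /= -add1n leq_add ?IHl //.
have [yV|yV] := boolP (y \in V); last first.
  rewrite big1_seq // => x /andP[_ xV]; case: eqP => // yx.
  by rewrite yx xV in yV.
rewrite (bigD1_seq y) //= eqxx big1_seq // => x /andP[xy _].
by rewrite eq_sym (negbTE xy).
Qed.

(* A representation as a sum of [h] elements is determined modulo every prime
   of [T] by the multiplicities of the elements of [V]. *)
Lemma prod_primes_leq_bin (A : set nat) h P a (T : seq (seq nat)) (V : seq nat) :
  cofinite_in_N (sumset h A) -> separates A P a T -> uniq T -> uniq V ->
  (forall E x, E \in T -> x \in E -> x \in V) ->
  \prod_(E <- T) P E <= 'C(size V + h, size V).
Proof.
move=> [M cof] [Pinj pP EA sep] uT uV TV; set Q := \prod_(E <- T) P E.
have Q0 : 0 < Q by rewrite /Q big_seq prodn_cond_gt0 // => F Fs; rewrite prime_gt0 // pP.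
pose rep x (l : seq nat) := [/\ size l = h, forall y, y \in l -> A y & sumn l = x %[mod Q]].
pose cnt l : seq 'I_h.+1 := [seq inord (count_mem y l) | y <- V].
have H (x : 'I_Q) : exists t : (size V).-tuple 'I_h.+1, exists2 l, rep x l & t = cnt l :> seq _.
  have /sumsetP[l [sl lA ls]] := cof (M * Q + x) ltac:(nia).
  have sz : size (cnt l) == size V by rewrite size_map.
  by exists (Tuple sz), l => //; split=> //; rewrite ls modnMDl.
have [f fP] := choice H.
have finj : injective f.
  move=> x y fxy; have [l [sl lA ls] tl] := fP x; have [l' [sl' lA' ls'] tl'] := fP y.
  apply: val_inj => /=; rewrite -(modn_small (ltn_ord x)) -(modn_small (ltn_ord y)) -ls -ls'.
  have cE : forall z, z \in V -> count_mem z l = count_mem z l'.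
    move=> z zV; have : cnt l = cnt l' by rewrite -tl -tl' fxy.
    move/eq_in_map/(_ z zV)/(congr1 val); rewrite /= !inordK // ltnS ?(leq_trans (count_size _ _)) ?sl ?sl' //.
  have pe := perm_filter_mem cE.
  apply: eqmod_prod => // E ET.
  have split_sum (u : seq nat) : size u = h -> (forall z, z \in u -> A z) ->
      sumn u = sumn [seq z <- u | z \in V] + (h - size [seq z <- u | z \in V]) * a E %[mod P E].
    move=> su uA; have -> : sumn u = sumn [seq z <- u | z \in V] + sumn [seq z <- u | z \notin V].
      by rewrite !sumnE !big_filter [in LHS](bigID (mem V)).
    apply/eqP; rewrite eqn_modDl; apply/eqP; rewrite (@sumn_eqmod _ (fun=> a E)).
      rewrite (@sumn_const (a E)); last by move=> z /mapP[].
      rewrite size_map; congr (_ * _ %% _); rewrite !size_filter -su -(count_predC (mem V) u).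
      by rewrite addKn.
    move=> z; rewrite mem_filter => /andP[zV zu]; apply/eqP; apply: contraNT zV => zE.
    by apply: (TV E) => //; rewrite (sep E ET z (uA z zu)).
  rewrite (split_sum l) // (split_sum l') // (perm_size pe).
  by rewrite !sumnE (perm_big _ pe).
have : #|'I_Q| <= #|[set t : (size V).-tuple 'I_h.+1 | \sum_(i <- t) i <= h]%SET|.
  rewrite -(card_imset _ finj); apply/subset_leq_card/fintype.subsetP => _ /imsetP[x _ ->].
  rewrite inE; have [l [sl lA ls] ->] := fP x.
  rewrite /cnt big_map -[leqRHS]sl; apply: leq_trans (count_sum_leq l uV).
  by apply: leq_sum => y _; rewrite inordK // ltnS -sl count_size.
by rewrite card_ord card_partial_ord_partitions.
Qed.
End EssentialModuli.

(** * Covering residues *)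

Section CoveringNumbers.
Local Open Scope nat_scope.
Local Open Scope classical_set_scope.

Definition residues_cover N k h (s : seq nat) :=
  [/\ uniq s, size s = k, forall a, a \in s -> 0 < a < N & covers_ZN N h s].

(** Relational form of [h(N, k)]. Positivity of [h] is automatic for [N > 1], since no summands only
    reach 0. *)
Definition is_min_cover N k h := (exists s, residues_cover N k h s) /\
  forall h', (exists s, residues_cover N k h' s) -> h <= h'.

Lemma covers0 N s : 1 < N -> ~ covers_ZN N 0 s.
Proof.
move=> N1 /covers_ZNP-/(_ (ltnW N1) 1)[l []].
by rewrite leqn0 => /eqP/size0nil -> _ /=; rewrite mod0n modn_small.
Qed.

(** A nonzero residue generates modulo a prime. This is what keeps a basis alive when a single
    element of an essential subset survives. *)
Lemma covers_ZN_unit N s a : prime N -> a \in s -> 0 < a < N -> covers_ZN N N s.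
Proof.
move=> pN as_ aN; have N0 := prime_gt0 pN; apply/(covers_ZNP _ _ N0) => x.
have cop : coprime a N.
  rewrite coprime_sym prime_coprime //; apply/negP => /dvdn_leq; lia.
case/andP: aN => a0 aN; have [u v uv _] := egcdnP N a0.
exists (nseq ((u * x) %% N) a); split.
- by rewrite size_nseq ltnW // ltn_pmod.
- by move=> y /nseqP[-> _].
rewrite sumn_nseq modnMmr mulnA [a * u]mulnC uv (eqP cop) mulnDl mul1n mulnAC.
by rewrite modnMDl.
Qed.

Lemma exists_residues_cover N k : 0 < k < N -> exists s, residues_cover N k N s.
Proof.
move=> /andP[k0 kN]; have N0 : 0 < N by lia.
exists (iota 1 k); split; rewrite ?iota_uniq ?size_iota //.
  by move=> a; rewrite mem_iota; lia.
apply/(covers_ZNP _ _ N0) => x; exists (nseq (x %% N) 1); split.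
- by rewrite size_nseq ltnW // ltn_pmod.
- by move=> y /nseqP[-> _]; rewrite mem_iota; lia.
- by rewrite sumn_nseq mul1n modn_mod.
Qed.

Lemma exists_min_cover N k : 0 < k < N -> exists h, is_min_cover N k h.
Proof.
move=> kN; have exh : exists h, `[< exists s, residues_cover N k h s >].
  by exists N; apply/asboolP; apply: exists_residues_cover.
case: (ex_minnP exh) => h /asboolP hs hmin; exists h; split=> // h' hs'.
by apply: hmin; apply/asboolP.
Qed.

Lemma min_cover_gt0 N k h : 1 < N -> is_min_cover N k h -> 0 < h.
Proof.
move=> N1 [[s [_ _ _ cov]] _]; rewrite lt0n; apply/eqP => h0.
by rewrite h0 in cov; apply: covers0 cov.
Qed.

Lemma hNk_min_cover (R : realType) N k h : 1 < N -> is_min_cover N k h -> hNk R N k = (h%:R)%R.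
Proof.
move=> N1 hm; have h0 := min_cover_gt0 N1 hm; case: hm => [[s hs] hmin].
rewrite /hNk; set S := [set _ | _ in _].
have Sh : S (h%:R)%R by exists h => //; split=> //; exists s.
have lb : lbound S (h%:R)%R.
  by move=> _ [h' [h'0 [s' hs']] <-]; rewrite ler_nat; apply: hmin; exists s'.
apply/eqP; rewrite eq_le; apply/andP; split; first by apply: ge_inf => //; exists (h%:R)%R.
by apply: lb_le_inf => //; exists (h%:R)%R.
Qed.

(** Elements of a [k]-element set may coincide modulo [N], while [h(N, k)] asks for exactly [k]
    residues. *)
Lemma pad_residues N k (D : seq nat) : k < N -> uniq D -> size D <= k ->
  (forall a, a \in D -> 0 < a < N) ->
  exists D', [/\ uniq D', size D' = k, {subset D <= D'} & forall a, a \in D' -> 0 < a < N].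
Proof.
move=> kN uD sD DN; pose F := [seq x <- iota 1 N.-1 | x \notin D].
have FN a : a \in F -> (a \notin D) && (0 < a < N) by rewrite mem_filter mem_iota; lia.
have sF : k - size D <= size F.
  have : size [seq x <- iota 1 N.-1 | x \in D] <= size D.
    rewrite uniq_leq_size ?filter_uniq ?iota_uniq // => x; by rewrite mem_filter => /andP[].
  have : size [seq x <- iota 1 N.-1 | x \in D] + size F = N.-1.
    by rewrite !size_filter -[RHS](size_iota 1) -(count_predC (mem D)).
  by move: (size _) (size _) (size _) sD kN => x y z; lia.
exists (D ++ take (k - size D) F); split.
- rewrite cat_uniq uD take_uniq ?filter_uniq ?iota_uniq // andbT.
  by apply/hasPn => x /mem_take/FN/andP[].
- by rewrite size_cat size_takel // subnKC.
- by move=> x xD; rewrite mem_cat xD.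
- by move=> a; rewrite mem_cat => /orP[/DN//|/mem_take/FN/andP[]].
Qed.

(** Translation by [- a] turns [E] into at most [k] nonzero residues and the other summands into 0.
    Some residue [t] is then out of reach of [h - 1] summands, and this [t] does not depend on the
    length of [l]. *)
Lemma min_cover_count N k h E a : 1 < N -> k < N -> is_min_cover N k h -> size E <= k ->
  (forall e, e \in E -> e != a %[mod N]) ->
  exists t, forall l, (forall x, x \in l -> x \notin E -> x = a %[mod N]) ->
    sumn l = t + size l * a %[mod N] -> h <= count (mem E) l.
Proof.
move=> N1 kN hm sE Ea; have N0 := ltnW N1; have h0 := min_cover_gt0 N1 hm.
apply: contrapT => nex.
have {nex} rep t : exists l, [/\ forall x, x \in l -> x \notin E -> x = a %[mod N],
    sumn l = t + size l * a %[mod N] & count (mem E) l <= h.-1].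
  apply: contrapT => nl; apply: nex; exists t => l l1 l2.
  by rewrite leqNgt; apply/negP => lt; apply: nl; exists l; split => //; lia.
pose d e := (e + (N - a %% N)) %% N.
have aN : a %% N < N by rewrite ltn_pmod.
have dP e : d e + a = e %[mod N].
  by rewrite /d modnDml -modnDmr -addnA subnK ?(ltnW aN) // modnDr.
pose D := undup (map d E).
have DN x : x \in D -> 0 < x < N.
  rewrite mem_undup => /mapP[e eE ->]; rewrite ltn_pmod // andbT lt0n.
  by apply: contra (Ea e eE) => /eqP de; rewrite -(dP e) de.
have sD : size D <= k by rewrite (leq_trans (size_undup _)) // size_map.
have [D' [uD' sD' DD' D'N]] := pad_residues kN (undup_uniq _) sD DN.
have cov : covers_ZN N h.-1 D'.
  apply/(covers_ZNP _ _ N0) => t; have [l [l1 l2 l3]] := rep t.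
  exists (map d [seq x <- l | x \in E]); split.
  - by rewrite size_map size_filter.
  - move=> x /mapP[e]; rewrite mem_filter => /andP[eE _] ->.
    by apply: DD'; rewrite mem_undup map_f.
  apply/eqP; rewrite -(eqn_modDr (size l * a)) -l2; apply/eqP.
  elim: l l1 {l2 l3} => //= x l IHl l1; rewrite mulSn.
  have {}IHl := IHl (fun y yl => l1 y (mem_behead (s := x :: l) yl)).
  have [xE|xE] /= := boolP (x \in E).
    by rewrite addnACA -modnDm dP IHl modnDm.
  by rewrite addnCA -modnDm IHl -(l1 x (mem_head _ _) xE) modnDm.
have := hm.2 h.-1; have [h1|h1] := posnP h.-1.
  by move: cov; rewrite h1 => /(covers0 N1).
by move=> /(_ (ex_intro _ D' (And4 uD' sD' D'N cov))); lia.
Qed.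

Lemma count_disjoint_leq (T : seq (seq nat)) (l : seq nat) : uniq T ->
  (forall E F x, E \in T -> F \in T -> x \in E -> x \in F -> E = F) ->
  \sum_(E <- T) count (mem E) l <= size l.
Proof.
move=> uT dis; elim: l => [|x l IHl]; first by rewrite big1.
rewrite /= big_split /= -add1n leq_add //.
have [/hasP[E ET xE]|/hasPn no] := boolP (has (fun E : seq nat => x \in E) T).
  rewrite (bigD1_seq E) //= xE big1_seq // => F /andP[FE FT].
  case: (boolP (x \in F)) => // xF; by rewrite (dis F E x) ?eqxx in FE.
by rewrite big1_seq // => E /andP[_ ET]; rewrite (negbTE (no E ET)).
Qed.

Lemma sum_min_cover_leq (A : set nat) h k P a (T : seq (seq nat)) (H : seq nat -> nat) :
  cofinite_in_N (sumset h A) -> separates A P a T -> uniq T ->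
  (forall E, E \in T -> size E = k /\ k < P E /\ is_min_cover (P E) k (H E)) ->
  (forall E F x, E \in T -> F \in T -> x \in E -> x \in F -> E = F) ->
  \sum_(E <- T) H E <= h.
Proof.
move=> [M cof] [Pinj pP EA sep] uT HT dis.
have ext E : exists t, E \in T -> forall l, (forall x, x \in l -> A x) ->
    sumn l = t + size l * a E %[mod P E] -> H E <= count (mem E) l.
  have [ET|] := boolP (E \in T); last by exists 0.
  have [sE [kP hm]] := HT E ET; have p1 := prime_gt1 (pP E ET).
  have [|t tP] := @min_cover_count (P E) k (H E) E (a E) p1 kP hm (eq_leq sE).
    by move=> e eE; rewrite -(sep E ET e (EA E ET e eE)).
  exists t => _ l lA ls; apply: tP => // x xl xE; apply/eqP; apply: contraNT xE => xa.
  by rewrite (sep E ET x (lA x xl)).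
have [t tP] := choice ext.
have [n Mn nr] := chinese_list (fun E => t E + h * a E) M uT Pinj pP.
have /sumsetP[l [sl lA ls]] := cof n Mn; rewrite -sl.
apply: leq_trans (count_disjoint_leq l uT dis).
rewrite big_seq [leqRHS]big_seq; apply: leq_sum => E ET; apply: tP => //.
by rewrite ls sl nr.
Qed.

Definition meets_other (s : seq (seq nat)) (E : seq nat) :=
  has (fun F : seq nat => (F != E) && has (mem E) F) s.

(** Let [deg x] be the number of members of [J] containing [x]. Counting degree 1 twice gives at
    least 2 for each element of the union. Every member shares some element with another one, so at
    most [k - 1] of its elements have degree 1, and the total is at most
    [(k + (k - 1)) * size J]. *)
Lemma size_union_meeting (s J : seq (seq nat)) k : 0 < k -> uniq s ->
  (forall E, E \in s -> uniq E /\ size E = k) ->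
  J = [seq E <- s | meets_other s E] ->
  2 * size (undup (flatten J)) <= (2 * k).-1 * size J.
Proof.
move=> k0 us sk JE; set V := undup _.
have uJ : uniq J by rewrite JE filter_uniq.
have memJ E : (E \in J) = meets_other s E && (E \in s) by rewrite JE mem_filter.
have Jk E : E \in J -> uniq E /\ size E = k by rewrite memJ => /andP[_ /sk].
pose deg x := \sum_(E <- J) (x \in E : nat).
have VE E x : E \in J -> x \in E -> x \in V.
  by move=> EJ xE; rewrite mem_undup; apply/flattenP; exists E.
have sumV (F : nat -> nat) : \sum_(x <- V) \sum_(E <- J) (x \in E) * F x = \sum_(E <- J) \sum_(x <- E) F x.
  rewrite exchange_big /=; apply: eq_big_seq => E EJ.
  rewrite (bigID (mem E)) /= [X in _ + X]big1 ?addn0; last by move=> x /negbTE->.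
  under eq_bigr => x xE do rewrite xE mul1n.
  rewrite -big_filter; apply: perm_big; apply: uniq_perm.
  - by rewrite filter_uniq // undup_uniq.
  - by case: (Jk E EJ).
  by move=> x; rewrite mem_filter; case: (boolP (x \in E)) => //= xE; rewrite (VE E).
have deg_sum : \sum_(x <- V) deg x = k * size J.
  have := sumV (fun=> 1); under eq_bigr do under eq_bigr do rewrite muln1.
  move=> ->; rewrite (eq_big_seq (fun=> k)); last first.
    by move=> E /Jk[_ <-]; rewrite sum1_size.
  by rewrite big_const_seq count_predT iter_addn_0.
have deg1_sum : \sum_(x <- V) deg x * (deg x == 1) <= k.-1 * size J.
  under eq_bigr do rewrite big_distrl /=.
  rewrite sumV; apply: leq_trans (_ : \sum_(E <- J) k.-1 <= _); last first.
    by rewrite big_const_seq count_predT iter_addn_0.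
  rewrite big_seq [leqRHS]big_seq; apply: leq_sum => E EJ.
  have [uE sE] := Jk E EJ; have := EJ; rewrite memJ => /andP[/hasP[F Fs /andP[FE /hasP[x xF xE]]] Es].
  have {}xE : x \in E by [].
  have FJ : F \in J.
    rewrite memJ Fs andbT; apply/hasP; exists E => //; rewrite eq_sym FE /=.
    by apply/hasP; exists x.
  have d2 : deg x != 1.
    have FJ' : F \in rem E J by rewrite mem_rem_uniq // inE FE.
    by rewrite /deg (big_rem E) //= xE (big_rem F) //= xF.
  rewrite (big_rem x) //= (negbTE d2) add0n.
  apply: leq_trans (_ : \sum_(y <- rem x E) 1 <= _).
    by apply: leq_sum => y _; case: (_ == _).
  by rewrite sum1_size size_rem // sE.
have Vdeg x : x \in V -> 2 <= deg x + deg x * (deg x == 1).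
  rewrite mem_undup => /flattenP[E EJ xE].
  have : 0 < deg x by rewrite /deg (big_rem E) //= xE.
  by case: (deg x) => [|[|n]].
have : 2 * size V <= \sum_(x <- V) (deg x + deg x * (deg x == 1)).
  rewrite mulnC -sum1_size big_distrl /= big_seq [leqRHS]big_seq.
  by apply: leq_sum => x xV; rewrite mul1n Vdeg.
rewrite big_split /= deg_sum => h; apply: leq_trans h _.
by apply: leq_trans (leq_add (leqnn _) deg1_sum) _; nia.
Qed.
End CoveringNumbers.

(** * Lower bound for the order *)

Section UpperBound.
Variables (R : realType) (k : nat).
Hypothesis k0 : (0 < k)%N.
Local Notation root := (@nroot R k).

Lemma fact_leq_prod (s : seq nat) : uniq s -> (forall p, p \in s -> (0 < p)%N) ->
  ((size s)`! <= \prod_(p <- s) p)%N.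
Proof.
move=> us s0; pose t := sort leq s.
have st : sorted ltn t by rewrite ltn_sorted_uniq_leq sort_uniq us sort_sorted //; exact: leq_total.
have t0 p : p \in t -> (0 < p)%N by rewrite mem_sort; apply: s0.
have -> : \prod_(p <- s) p = \prod_(p <- t) p by apply: perm_big; rewrite perm_sym perm_sort.
rewrite -(size_sort leq s) -/t (big_nth 0%N) fact_prod big_add1 /=.
rewrite big_seq [leqRHS]big_seq; apply: leq_prod => i; rewrite mem_index_iota /= => it.
exact: fact_leq_sorted.
Qed.

(** Combines [C(w + h, w) <= (w + h) ^ w / w!] with [w! >= (w / e) ^ w]. *)
Lemma ln_bin_le w h : (0 < w)%N ->
  ln ('C(w + h, w))%:R <= w%:R * (ln (1 + h%:R / w%:R) + 1) :> R.
Proof.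
move=> w0; have w0' : 0 < w%:R :> R by rewrite ltr0n.
have C0 : (0 < 'C(w + h, w))%N by rewrite bin_gt0 leq_addr.
have [fl _] := ln_fact_bounds R w0.
have : ln ('C(w + h, w))%:R + ln w`!%:R <= w%:R * ln (w + h)%:R :> R.
  rewrite -lnM ?posrE ?ltr0n ?fact_gt0 // -natrM bin_ffact mulr_natl -lnXn ?ltr0n ?addn_gt0 ?w0 //.
  rewrite -natrX ler_ln ?posrE ?ltr0n ?expn_gt0 ?ffact_gt0 ?leq_addr ?addn_gt0 ?w0 // ler_nat.
  rewrite ffact_prod; apply: leq_trans (_ : \prod_(i < w) (w + h) <= _)%N.
    by apply: leq_prod => i _; rewrite leq_subr.
  by rewrite prod_nat_const card_ord.
have -> : 1 + h%:R / w%:R = (w + h)%:R / w%:R :> R.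
  by rewrite natrD mulrDl divff // gt_eqF.
rewrite ln_div ?posrE ?ltr0n ?addn_gt0 ?w0 //; move: fl; lra.
Qed.

Lemma ln_nroot (x : R) : ln (root x) = k%:R^-1 * ln x.
Proof. exact: ln_powR. Qed.

Lemma ln_ln_le (d x : R) : 0 < d -> 0 < ln x -> ln (ln x) <= d * ln x - ln d.
Proof.
move=> d0 lx; have := @le_ln1Dx R (d * ln x - 1).
rewrite (addrC 1) subrK lnM ?posrE // => h.
by have := h ltac:(by rewrite ltrBrDr addNr mulr_gt0); lra.
Qed.

Lemma nroot_ge1 (x : R) : 1 <= x -> 1 <= root x.
Proof.
move=> x1; have <- : root 1 = 1 by rewrite /nroot powR1.
exact: ler_nroot.
Qed.

Lemma half_bounds (j : nat) : (4 <= j)%N -> let w := ((2 * k).-1 * j %/ 2)%N in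
  (j <= 4 * w)%N /\ (2 * w <= (2 * k).-1 * j)%N.
Proof.
move=> j4 w; split; last by rewrite mulnC /w leq_divM.
have h1 := ltn_ceil ((2 * k).-1 * j) (isT : (0 < 2)%N).
have h2 : (1 * j <= (2 * k).-1 * j)%N by rewrite leq_mul2r; case: (k) k0 => //=; lia.
by move: h1 h2 j4; rewrite -/w; move: (_ * j)%N; clear; lia.
Qed.

(* Overlapping subsets are few: [j] of them span at most [(k - 1/2) j] elements,
   so that covering all their residues would need about [j ^ (1 + 2 / (2 k - 1))] summands. *)
Lemma few_meeting (d K : R) : 0 < d < 1 -> 0 < K -> exists n0, forall n j v h, (n0 <= n)%N ->
  (2 * v <= (2 * k).-1 * j)%N -> (j`! <= 'C(v + h, v))%N ->
  h%:R <= K * (n%:R * root n%:R * root (ln n%:R)) -> j%:R <= d * n%:R.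
Proof.
move=> /andP[d0 d1] K0; have k0' : 0 < k%:R :> R by rewrite ltr0n.
have k1' : 1 <= k%:R :> R by rewrite ler1n.
pose L : R := ln (1 + 4 * K / d) + 1.
have Kd0 : 0 < 4 * K / d by rewrite divr_gt0 // mulr_gt0.
have L0 : 0 <= L by rewrite addr_ge0 // ln_ge0 // lerDl ltW.
pose C : R := k%:R * L + ln (4 * k%:R) + 1 - ln d.
have [n1 hn1] := @exists_nat_ln_ge R (4 * k%:R * (C + 1)).
have [n3 hn3] := @exists_nat_ln_ge R 1.
have [n4 hn4] := @exists_nat_ge R (4 / d).
exists (maxn n1 (maxn n3 n4)) => n j v h.
rewrite !geq_max => /and3P[/hn1 h1 /hn3 h3 /hn4 h4] vj jC hK.
rewrite leNgt; apply/negP => dj.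
have dn4 : 4 <= d * n%:R by move: h4; rewrite ler_pdivrMr // mulrC.
have j4 : (4 <= j)%N by rewrite -(ler_nat R); apply: le_trans dn4 (ltW dj).
have n0 : 0 < n%:R :> R by rewrite -(pmulr_rgt0 _ d0) (lt_le_trans _ dn4).
have n1' : 1 <= n%:R :> R by rewrite ler1n -(ltr0n R).
(* The union may be much smaller than its bound. The binomial coefficient grows with [v], and [w] is
   comparable to [j], which controls [h / w]. *)
have [] := half_bounds j4; set w := (_ %/ 2)%N => wj2 wj.
have vw : (v <= w)%N by rewrite leq_divRL // mulnC.
have w0 : (0 < w)%N by move: wj2 j4; clear; lia.
have w0' : 0 < w%:R :> R by rewrite ltr0n.
have j0' : 0 < j%:R :> R by rewrite ltr0n (leq_trans _ j4).
have kj : w%:R <= (k%:R - 1 / 2) * j%:R :> R.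
  move: wj; rewrite -(ler_nat R) !natrM => h5.
  have e2 : (2 * k).-1%:R = 2 * k%:R - 1 :> R.
    by rewrite -natrM -[in RHS](prednK (_ : 0 < 2 * k)%N) ?muln_gt0 // -natr1 addrK.
  by rewrite e2 in h5; move: h5; clear; lra.
have jC' : ln j`!%:R <= w%:R * (ln (1 + h%:R / w%:R) + 1) :> R.
  apply: le_trans (ln_bin_le h w0); rewrite ler_ln ?posrE ?ltr0n ?fact_gt0 ?bin_gt0 ?leq_addr // ler_nat.
  apply: leq_trans jC _; rewrite -[leqLHS]bin_sub ?leq_addr // -[leqRHS]bin_sub ?leq_addr // !addKn.
  by rewrite leq_bin2l // leq_add2r.
have fl : j%:R * ln j%:R - j%:R <= ln j`!%:R :> R.
  by have [+ _] := ln_fact_bounds R (leq_trans (isT : (0 < 4)%N) j4); apply: le_trans; rewrite lerDl.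
have lnj : ln d + ln n%:R <= ln j%:R.
  by rewrite -lnM ?posrE // ler_ln ?posrE ?mulr_gt0 // ltW.
pose r := root n%:R * root (ln n%:R).
have r1 : 1 <= r by rewrite mulr_ege1 // nroot_ge1.
have r0 : 0 < r by apply: lt_le_trans r1.
have lnr : ln r = k%:R^-1 * (ln n%:R + ln (ln n%:R)).
  by rewrite lnM ?posrE ?nroot_gt0 ?(lt_le_trans _ h3) // !ln_nroot mulrDr.
have hw : ln (1 + h%:R / w%:R) + 1 <= L + ln r.
  have -> : L + ln r = ln ((1 + 4 * K / d) * r) + 1.
    by rewrite lnM ?posrE ?addr_gt0 // /L addrAC.
  have p1 : 0 < 1 + 4 * K / d by rewrite addr_gt0.
  have p2 : 0 < 1 + h%:R / w%:R :> R by apply: ltr_pwDl => //; apply: divr_ge0.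
  rewrite lerD2r ler_ln ?posrE //; last exact: mulr_gt0.
  have : h%:R / w%:R <= 4 * K / d * r.
    rewrite ler_pdivrMr //; apply: le_trans hK _.
    have : d * n%:R <= 4 * w%:R by apply: le_trans (ltW dj) _; rewrite -natrM ler_nat.
    move=> h5; have h6 := ler_wpM2r (mulr_ge0 (ltW K0) (ltW r0)) h5.
    rewrite -(ler_pM2l d0).
    have -> : d * (K * (n%:R * root n%:R * root (ln n%:R))) = d * n%:R * (K * r) by rewrite /r; ring.
    have -> : d * (4 * K / d * r * w%:R) = 4 * w%:R * (K * r) by field; rewrite gt_eqF.
    by [].
  by move: r1; lra.
have lnln0 : 0 <= ln (ln n%:R : R) by rewrite ln_ge0.
have lr0 : 0 <= ln r by rewrite ln_ge0.
have : ln j%:R - 1 <= (k%:R - 1 / 2) * (L + ln r).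
  rewrite -(ler_pM2l j0') mulrBr mulr1; apply: le_trans fl _; apply: le_trans jC' _.
  apply: le_trans (ler_wpM2l (ltW w0') hw) _.
  have Lr0 : 0 <= L + ln r by apply: addr_ge0.
  by rewrite [leRHS]mulrA [in leRHS](mulrC j%:R); apply: ler_wpM2r.
have -> : (k%:R - 1 / 2) * (L + ln r) = (k%:R - 1 / 2) * L + (1 - (2 * k%:R)^-1) * (ln n%:R + ln (ln n%:R)).
  by rewrite lnr; field; rewrite gt_eqF.
(* The exponent [1 - 1 / (2 * k)] leaves a margin [ln n / (2 * k)]; one half of it pays for
   [ln (ln n)], the other for the constants. *)
have k4 : 0 < (4 * k%:R)^-1 :> R by rewrite invr_gt0 mulr_gt0.
have := @ln_ln_le (4 * k%:R)^-1 n%:R k4 (lt_le_trans ltr01 h3).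
rewrite lnV ?posrE ?mulr_gt0 // opprK.
have h1' : C + 1 <= (4 * k%:R)^-1 * ln n%:R by rewrite ler_pdivlMl // mulr_gt0.
have e4 : (2 * k%:R)^-1 = 2 * (4 * k%:R)^-1 :> R by field; rewrite gt_eqF.
rewrite e4; move: h1' lnj; rewrite /C.
have : 0 <= (4 * k%:R)^-1 * ln (ln n%:R) :> R by rewrite mulr_ge0 // ltW.
have : 0 <= 1 / 2 * L by rewrite mulr_ge0.
move: (ln n%:R) (ln (ln n%:R)) (ln (4 * k%:R)) (ln j%:R) (ln d) ((4 * k%:R)^-1) => x1 x2 x3 x4 x5 x6.
by clear; lra.
Qed.

Lemma order_lower_bound (rho c : R) : 0 < rho -> 0 < c < 1 ->
  (exists N0, forall N, (N0 <= N)%N -> rho * (k%:R * root N%:R) <= hNk R N k) ->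
  exists n0, forall (A : set nat) h n, basis_of_order h A -> at_least_ess A k n -> (n0 <= n)%N ->
  c * rho * (k%:R ^+ 2 / k.+1%:R) * (n%:R * root n%:R * root (ln n%:R)) <= h%:R.
Proof.
move=> rho0 /andP[c0 c1] [N0 HN0]; pose d : R := (1 - c) / 8.
have d0 : 0 < d by rewrite divr_gt0 // subr_gt0.
have d8 : d < 1 / 8 by rewrite /d; move: c0; clear; lra.
have d1 : 0 < 1 - d by move: d8; clear; lra.
have d2 : 0 < 1 - 2 * d by move: d8; clear; lra.
have k0' : 0 < k%:R :> R by rewrite ltr0n.
pose K := c * rho * (k%:R ^+ 2 / k.+1%:R).
have K0 : 0 < K by rewrite !mulr_gt0 // ?divr_gt0 ?exprn_gt0.
have d01 : 0 < d < 1 by rewrite d0 /=; move: d8; clear; lra.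
have d11 : 0 < 1 - d < 1 by rewrite d1 gtrBl d0.
have [n1 Hn1] := few_meeting d01 K0.
have [m0 Hm0] := sum_root_primes_ge k0 d11.
(* Below [N1] the assumed bound or the inequality [k < p] may fail. As the primes are distinct, this
   discards at most [N1] subsets. *)
pose N1 := (maxn N0 k).+1.
have [n2 hn2] := @exists_nat_ge R (N1%:R / d).
have [n3 hn3] := @exists_nat_ge R (m0.+1%:R / (1 - 2 * d)).
have [n4 hn4] := @exists_nat_ln_ge R (- ln (1 - 2 * d) / d).
have [n5 hn5] := @exists_nat_ln_ge R 1.
exists (maxn (maxn n1 n2) (maxn n3 (maxn n4 (maxn n5 1)))) => A h n [cof ncof] [s [us sn sE]].
rewrite !geq_max => /andP[/andP[nn1 /hn2 h2] /and4P[/hn3 h3 /hn4 h4 /hn5 h5 n0]].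
(* Assuming the claim false supplies the upper bound on [h] without which [few_meeting] does not
   apply. *)
rewrite -/K leNgt; apply/negP => hK.
have {}h2 : N1%:R <= d * n%:R by rewrite mulrC -ler_pdivrMr.
have {}h3 : m0.+1%:R <= (1 - 2 * d) * n%:R by rewrite mulrC -ler_pdivrMr.
have {}h4 : - ln (1 - 2 * d) <= d * ln n%:R by rewrite [leRHS]mulrC -ler_pdivrMr.
have n0' : 0 < n%:R :> R by rewrite ltr0n.
have bA : is_basis A by exists h.
have sess E : E \in s -> essential A E by move/sE => [].
have [P [a sep]] := exists_separates bA sess.
have [Pinj pP _ _] := sep.
have usz E : E \in s -> uniq E /\ size E = k.
  move=> Es; have [[sortE _] szE] := sE E Es; split=> //.
  exact: (sorted_uniq ltn_trans ltnn).
pose J := [seq E <- s | meets_other s E].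
pose I := [seq E <- s | ~~ meets_other s E].
have IJ : (size I + size J)%N = n by rewrite !size_filter addnC count_predC.
have sJ : {subset J <= s} by move=> E; rewrite mem_filter => /andP[].
have uJ : uniq J by rewrite filter_uniq.
have PJ : {in J &, injective P} by move=> E F /sJ Es /sJ Fs; apply: Pinj.
have Jd : (size J)%:R <= d * n%:R.
  apply: (Hn1 n (size J) (size (undup (flatten J))) h nn1); last exact: ltW.
    exact: (@size_union_meeting s J k k0 us usz erefl).
  apply: leq_trans (prod_primes_leq_bin cof (separates_sub sJ sep) uJ (undup_uniq (flatten J)) _).
    rewrite -(big_map P xpredT id) -(size_map P); apply: fact_leq_prod; first by rewrite map_inj_in_uniq.
    by move=> p /mapP[E /sJ Es ->]; rewrite prime_gt0 // pP.
  by move=> E x EJ xE; rewrite mem_undup; apply/flattenP; exists E.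
pose T := [seq E <- I | (N1 <= P E)%N].
have TI : {subset T <= I} by move=> E; rewrite mem_filter => /andP[].
have Is : {subset I <= s} by move=> E; rewrite mem_filter => /andP[].
have Ts : {subset T <= s} by move=> E /TI/Is.
have uI : uniq I by rewrite filter_uniq.
have uT : uniq T by rewrite filter_uniq.
have IT : (size I <= size T + N1)%N.
  rewrite -(count_predC (fun E => (N1 <= P E)%N) I) -size_filter -/T leq_add2l -size_filter.
  set U := [seq E <- I | _]; have Us : {subset U <= s} by move=> E; rewrite mem_filter => /andP[_ /Is].
  rewrite -(size_map P) -(size_iota 0 N1) uniq_leq_size //.
    by rewrite map_inj_in_uniq ?filter_uniq // => E F /Us Es /Us Fs; apply: Pinj.
  by move=> p /mapP[E]; rewrite mem_filter => /andP[EN _] ->; rewrite mem_iota add0n ltnNge.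
pose m := size T.
have mn : (1 - 2 * d) * n%:R <= m%:R.
  have : n%:R <= m%:R + N1%:R + (size J)%:R :> R.
    by rewrite -!natrD ler_nat -[in leqLHS]IJ leq_add2r.
  by move: h2 Jd; lra.
have mm0 : (m0 <= m)%N by rewrite -(ler_nat R) (le_trans _ mn) // (le_trans _ h3) // ler_nat.
have cover E : exists H, E \in T -> is_min_cover (P E) k H.
  have [ET|] := boolP (E \in T); last by exists 0%N.
  have [|H HH] := @exists_min_cover (P E) k; last by exists H.
  rewrite k0 /=; move: ET; rewrite mem_filter => /andP[+ _]; apply: leq_trans.
  by rewrite ltnS leq_maxr.
have [H HP] := choice cover.
have kP E : E \in T -> (k < P E)%N.
  by rewrite mem_filter => /andP[+ _]; apply: leq_trans; rewrite ltnS leq_maxr.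
have sumH : (\sum_(E <- T) H E <= h)%N.
  apply: (sum_min_cover_leq cof (separates_sub Ts sep) uT (k := k)).
    move=> E ET; split; first by case: (usz E (Ts E ET)).
    by split; [exact: kP | exact: HP].
  move=> E F x /TI EI /TI FI xE xF; apply/eqP; apply: contraT => EF.
  move: EI; rewrite mem_filter => /andP[/hasPn no _].
  have := no F (Is F FI); rewrite eq_sym EF /= => /hasPn/(_ x xF)/negP; case.
  exact: xE.
have : \sum_(E <- T) rho * (k%:R * root (P E)%:R) <= h%:R.
  apply: le_trans (_ : (\sum_(E <- T) H E)%:R <= _); last by rewrite ler_nat.
  rewrite natr_sum big_seq [leRHS]big_seq; apply: ler_sum => E ET.
  have p1 := prime_gt1 (pP E (Ts E ET)).
  rewrite -(hNk_min_cover R p1 (HP E ET)); apply: HN0.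
  by move: ET; rewrite mem_filter => /andP[+ _]; apply: leq_trans; rewrite leqW // leq_maxl.
rewrite -mulr_sumr -mulr_sumr mulrA => Hh.
have := Hm0 m [seq P E | E <- T] mm0; rewrite size_map big_map => Hs.
have {}Hs := Hs _ _ (leqnn _); have {}Hs := Hs ltac:(by rewrite map_inj_in_uniq // => E F /Ts Es /Ts Fs; apply: Pinj)
  ltac:(by move=> p /mapP[E /Ts Es ->]; apply: pP).
have rk0 : 0 < rho * k%:R by rewrite mulr_gt0.
have m0' : 0 < m%:R :> R by apply: lt_le_trans mn; rewrite mulr_gt0.
have ln0 : 0 <= ln n%:R :> R by apply: le_trans h5.
have rm : (1 - 2 * d) * root n%:R <= root m%:R.
  apply: le_trans (ler_nroot k (mulr_ge0 (ltW d2) (ltW n0')) mn).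
  rewrite nrootM ?(ltW d2) ?(ltW n0') // ler_wpM2r ?nroot_ge0 // nroot_ge_of_le1 //.
  by rewrite (ltW d2) /= gerBl mulr_ge0 // ltW.
have lm : (1 - d) * ln n%:R <= ln m%:R.
  apply: le_trans (_ : ln (1 - 2 * d) + ln n%:R <= _); first by move: h4; clear; lra.
  by rewrite -lnM ?posrE // ler_ln ?posrE // mulr_gt0.
have rl : (1 - d) * root (ln n%:R) <= root (ln m%:R).
  apply: le_trans (ler_nroot k (mulr_ge0 (ltW d1) ln0) lm).
  rewrite nrootM ?(ltW d1) // ler_wpM2r ?nroot_ge0 // nroot_ge_of_le1 //.
  by rewrite (ltW d1) /= gerBl ltW.
have mpow : (1 - 2 * d) ^+ 2 * (n%:R * root n%:R) <= root m%:R ^+ k.+1.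
  rewrite [root m%:R ^+ _]exprSr nrootXn // expr2 mulrACA.
  by apply: ler_pM; rewrite ?mulr_ge0 ?nroot_ge0 ?(ltW d2).
suff : K * (n%:R * root n%:R * root (ln n%:R)) <= h%:R by rewrite leNgt hK.
apply: le_trans Hh; apply: le_trans (ler_wpM2l (ltW rk0) Hs).
set X := n%:R * root n%:R in mpow *; set Y := root (ln n%:R) in rl *.
have X0 : 0 <= X by rewrite mulr_ge0 // nroot_ge0.
have Y0 : 0 <= Y by apply: nroot_ge0.
have kk : 0 < k%:R / k.+1%:R :> R by rewrite divr_gt0.
apply: le_trans (_ : rho * k%:R * ((1 - d) * (k%:R / k.+1%:R) * ((1 - 2 * d) ^+ 2 * X) * ((1 - d) * Y)) <= _).
  have -> : K * (X * Y) = rho * k%:R * (k%:R / k.+1%:R) * (X * Y) * c by rewrite /K; ring.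
  have -> : rho * k%:R * ((1 - d) * (k%:R / k.+1%:R) * ((1 - 2 * d) ^+ 2 * X) * ((1 - d) * Y)) =
     rho * k%:R * (k%:R / k.+1%:R) * (X * Y) * ((1 - d) ^+ 2 * (1 - 2 * d) ^+ 2) by ring.
  apply: ler_wpM2l.
    exact: mulr_ge0 (mulr_ge0 (ltW rk0) (ltW kk)) (mulr_ge0 X0 Y0).
  have -> : c = 1 - 8 * d by rewrite /d; field.
  move: d0 d8; move: (d) => x x0 x8; rewrite -subr_ge0.
  have -> : (1 - x) ^+ 2 * (1 - 2 * x) ^+ 2 - (1 - 8 * x) =
    x * (2 + 13 * x - 12 * x ^+ 2 + 4 * x ^+ 3) by ring.
  have x1 : x ^+ 2 <= x by rewrite expr2 ger_pMr //; apply: ltW; move: x8; clear; lra.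
  have x3 := exprn_ge0 3 (ltW x0); apply: mulr_ge0 (ltW x0) _.
  by move: x0 x1 x3; clear; lra.
have c1' : 0 <= (1 - d) * (k%:R / k.+1%:R) := mulr_ge0 (ltW d1) (ltW kk).
have dX0 : 0 <= (1 - 2 * d) ^+ 2 * X := mulr_ge0 (sqr_ge0 _) X0.
apply: ler_wpM2l (ltW rk0) _ _ _; apply: ler_pM (mulr_ge0 c1' dX0) (mulr_ge0 (ltW d1) Y0) _ rl.
exact: ler_wpM2l.
Qed.
End UpperBound.

(** * A basis with many essential subsets *)

Section LowerBoundConstruction.
Local Open Scope nat_scope.
Local Open Scope classical_set_scope.

(* [r] summands reach everything, while [r - 1] summands leave arbitrarily long gaps. *)
Definition blocks r : set nat :=
  [set c | exists j, (2 * r) ^ j <= c <= 2 * (2 * r) ^ j + r].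

Lemma interval_sums i a b c : a <= b -> i * a <= c <= i * b ->
  exists l, [/\ size l = i, forall x, x \in l -> a <= x <= b & sumn l = c].
Proof.
move=> ab; elim: i c => [|i IHi] c /andP[ca cb].
  by exists [::]; split => //=; lia.
rewrite !mulSn in ca cb.
pose x := minn b (c - i * a); have xle : a <= x <= b by rewrite leq_min geq_minl; lia.
have [|l [sl lx ls]] := IHi (c - x).
  have := leq_mul2l i a b; rewrite ab orbT /x => h.
  by case: (leqP b (c - i * a)) => h'; lia.
exists (x :: l); split=> /=; rewrite ?sl //.
  by move=> y; rewrite inE => /orP[/eqP->//|/lx].
rewrite ls; case/andP: xle => _ _; rewrite subnKC // /x.
by rewrite (leq_trans (geq_minr _ _)) // leq_subr.
Qed.

Lemma blocks1 r : blocks r 1.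
Proof. by exists 0; rewrite expn0; lia. Qed.

Lemma exp_bracket B x : 1 < B -> 0 < x -> exists j, B ^ j <= x < B ^ j.+1.
Proof.
move=> B1 x0; exists (trunc_log B x).
by rewrite trunc_logP //= trunc_log_ltn.
Qed.

(** With [i] summands from one block and [r' - i] copies of 1 the sums fill an interval. For
    [1 <= i <= r] these intervals overlap and reach the next power of [2 * r]; the largest [i] that
    is not too big works. *)
Lemma blocks_sum r r' c : 0 < r -> r <= r' -> r' <= c -> sumset r' (blocks r) c.
Proof.
move=> r0 rr rc; pose c1 := c - (r' - r); have rc1 : r <= c1 by rewrite /c1; lia.
have [j /andP[jl ju]] := @exp_bracket (2 * r) (c1 - r.-1) ltac:(lia) ltac:(lia).
rewrite expnS in ju; set N := (2 * r) ^ j in jl ju.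
have N0 : 0 < N by rewrite expn_gt0; lia.
pose Q i := (0 < i <= r) && (i * N + (r - i) <= c1).
have exQ : exists i, Q i by exists 1; rewrite /Q; lia.
have Qr i : Q i -> i <= r by move=> /andP[/andP[]].
case: (ex_maxnP exQ Qr) => i /andP[/andP[i0 ir] ic] imax.
have iu : c1 <= i * (2 * N + r) + (r - i).
  have [->|nir] := eqVneq i r; first by nia.
  have := imax i.+1; rewrite /Q /= => h.
  have : ~~ (i.+1 * N + (r - i.+1) <= c1).
    by apply/negP => h2; have := h ltac:(by rewrite h2 andbT; lia); lia.
  by rewrite -ltnNge mulSn; nia.
have [|l [sl lx ls]] := @interval_sums i N (2 * N + r) (c1 - (r - i)) ltac:(lia); first by lia.
apply/sumsetP; exists (l ++ nseq (r' - i) 1); split.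
- by rewrite size_cat size_nseq sl; lia.
- move=> x; rewrite mem_cat => /orP[/lx xl|/nseqP[-> _]]; last exact: blocks1.
  by exists j.
- by rewrite sumn_cat sumn_nseq ls mul1n; move: ic rr rc ir; rewrite /c1; clear; lia.
Qed.

(** A summand beyond block [j] already exceeds the gap. For fewer than [r] summands the two
    alternatives leave a true gap once [(2 * r) ^ j] is large. *)
Lemma blocks_gap r l j : 0 < r -> (forall x, x \in l -> blocks r x) ->
  sumn l <= size l * (2 * (2 * r) ^ j + r) \/ (2 * r) ^ j.+1 <= sumn l.
Proof.
move=> r0 lb; have [/allP al|/allPn[x xl xb]] := boolP (all (fun x => x <= 2 * (2 * r) ^ j + r) l).
  by left; apply: leq_sumn => x xl; apply: al.
right; have [j' /andP[j1 j2]] := lb x xl.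
have jj : j < j'.
  rewrite ltnNge; apply: contra xb => jj; apply: leq_trans j2 _.
  by rewrite leq_add2r leq_mul2l leq_pexp2l //; lia.
apply: (@leq_trans x); first by apply: leq_trans j1; rewrite leq_pexp2l //; lia.
by rewrite sumnE (big_rem x) //= leq_addr.
Qed.

Lemma gap_arith r B K M : 0 < r -> r * r + K + M + 2 < B ->
  r.-1 * (2 * B + r) + K + M + 1 < 2 * r * B.
Proof. by case: r => // r _ /=; nia. Qed.

Section Construction.
Variables (ps : seq nat) (k r : nat) (D : nat -> seq nat) (H : nat -> nat).
Hypotheses (ups : uniq ps) (pps : forall p, p \in ps -> prime p) (k0 : 0 < k) (r0 : 0 < r).
Hypothesis (DP : forall p, p \in ps -> residues_cover p k (H p) (D p)).
Hypothesis (HP : forall p, p \in ps -> is_min_cover p k (H p)).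

Let P := \prod_(p <- ps) p.
Let cof p := \prod_(q <- rem p ps) q.

Definition ess p := [seq d * cof p | d <- sort leq (D p)].

Definition ess_basis : set nat :=
  [set x | (exists2 c, blocks r c & x = P * c) \/ exists2 p, p \in ps & x \in ess p].

Lemma cofE p : p \in ps -> P = p * cof p.
Proof. by move=> pin; rewrite /P (big_rem p). Qed.

Lemma dvd_cof p q : p \in ps -> q \in ps -> p != q -> p %| cof q.
Proof.
move=> pin qin pq; have pr : p \in rem q ps by rewrite mem_rem_uniq // inE pq.
by rewrite /cof (big_rem p) //= dvdn_mulr.
Qed.

Lemma coprime_cof p : p \in ps -> coprime p (cof p).
Proof.
move=> pin; rewrite prime_coprime ?pps // /cof Euclid_dvd_prod ?pps // big_has.
apply/hasPn => q; rewrite mem_rem_uniq // inE => /andP[qp qin].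
by rewrite dvdn_prime2 ?pps // eq_sym.
Qed.

Lemma P_gt0 : 0 < P.
Proof. by rewrite /P big_seq prodn_cond_gt0 // => p /pps/prime_gt0. Qed.

Lemma eqmod_P x y : (forall p, p \in ps -> x = y %[mod p]) -> x = y %[mod P].
Proof. by apply: (@eqmod_prod _ id) => //; move=> p q _ _. Qed.

Lemma mem_ess p x : p \in ps -> x \in ess p ->
  exists d, [/\ d \in D p, 0 < d < p & x = d * cof p].
Proof.
move=> pin /mapP[d]; rewrite mem_sort => dD ->; exists d; split=> //.
by case: (DP pin) => _ _ /(_ d dD).
Qed.

Lemma ess_ndvd p x : p \in ps -> x \in ess p -> ~~ (p %| x).
Proof.
move=> pin /(mem_ess pin)[d [_ /andP[d0 dp] ->]].
rewrite Euclid_dvdM ?pps // negb_or; apply/andP; split.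
  by apply/negP => /(dvdn_leq d0); lia.
by rewrite -prime_coprime ?pps // coprime_cof.
Qed.

Lemma ess_dvd p q x : p \in ps -> q \in ps -> p != q -> x \in ess q -> p %| x.
Proof.
by move=> pin qin pq /(mem_ess qin)[d [_ _ ->]]; rewrite dvdn_mull // dvd_cof.
Qed.

Lemma ess_basis_pos : ess_basis `<=` [set m | 0 < m].
Proof.
move=> x [[c [j /andP[cl _]] ->]|[p pin xp]] /=.
  by rewrite muln_gt0 P_gt0 (leq_trans _ cl) // expn_gt0; lia.
by rewrite lt0n; apply/eqP => x0; have := ess_ndvd pin xp; rewrite x0 dvdn0.
Qed.

Lemma ess_basis_dvd p x : p \in ps -> ess_basis x -> x \notin ess p -> p %| x.
Proof.
move=> pin [[c _ ->] _|[q qin xq]]; first by rewrite (cofE pin) -mulnA dvdn_mulr.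
by have [->|pq] := eqVneq p q; [rewrite xq | move=> _; apply: (ess_dvd pin qin)].
Qed.

Lemma sumn_dvd d l : (forall x, x \in l -> d %| x) -> d %| sumn l.
Proof.
elim: l => [|x l IHl h] /=; first by rewrite dvdn0.
apply: dvdn_add; first by apply: h; rewrite mem_head.
by apply: IHl => y yl; apply: h; rewrite inE yl orbT.
Qed.

Lemma solve_mod p c x : prime p -> coprime p c -> exists y, y * c = x %[mod p].
Proof.
move=> pp pc; have c0 : 0 < c by rewrite lt0n; apply/eqP => c0; move: pc; rewrite c0 /coprime gcdn0; case: p pp => [|[]].
have [u v uv _] := egcdnP p c0; exists (u * x).
rewrite gcdnC (eqP pc) in uv.
by rewrite mulnAC uv mulnDl mul1n mulnAC modnMDl.
Qed.

Lemma eqmod_mulr p c x y : coprime p c -> x * c = y * c %[mod p] -> x = y %[mod p].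
Proof.
move=> pc /eqP xy; apply/eqP; wlog yx : x y xy / y <= x.
  by move=> W; case: (leqP y x) => [|/ltnW] h; [apply: W | rewrite eq_sym W // eq_sym].
by move: xy; rewrite !eqn_mod_dvd ?leq_mul2r ?yx ?orbT // -mulnBl Gauss_dvdl.
Qed.

(** The right residue modulo [P] is composed prime by prime; the remaining summands, at least [r] in
    number, are multiples of [P] and are supplied by [blocks_sum]. General [F] and [G] serve both
    the full basis and the one with part of an essential subset removed. *)
Lemma cofinite_sumset_cover (A : set nat) (F : nat -> seq nat) (G : nat -> nat) :
  (forall c, blocks r c -> A (P * c)) ->
  (forall p d, p \in ps -> d \in F p -> A (d * cof p)) ->
  (forall p, p \in ps -> covers_ZN p (G p) (F p)) ->
  cofinite_in_N (sumset (\sum_(p <- ps) G p + r) A).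
Proof.
move=> AC AF cov; set hT := \sum_(p <- ps) G p.
have rep x : exists l, [/\ size l <= hT, forall y, y \in l -> A y & sumn l = x %[mod P]].
  have H1 p : exists l, p \in ps -> [/\ size l <= G p, {subset l <= F p} &
      sumn l * cof p = x %[mod p]].
    have [pin|] := boolP (p \in ps); last by exists [::].
    have [y yx] := solve_mod x (pps pin) (coprime_cof pin).
    have [l [l1 l2 l3]] := (covers_ZNP _ _ (prime_gt0 (pps pin))).1 (cov p pin) y.
    by exists l => _; split=> //; rewrite -modnMml l3 modnMml.
  have [f fP] := choice H1.
  exists (flatten [seq [seq d * cof p | d <- f p] | p <- ps]); split.
  - rewrite size_flatten sumnE /shape -map_comp big_map /hT big_seq [leqRHS]big_seq.
    by apply: leq_sum => p pin; rewrite /= size_map; case: (fP p pin).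
  - move=> y /flatten_mapP[p pin /mapP[d dl ->]]; apply: AF => //.
    by case: (fP p pin) => _ /(_ d dl).
  have sumM (l : seq nat) c : sumn [seq d * c | d <- l] = sumn l * c.
    by rewrite !sumnE big_map big_distrl.
  apply: eqmod_P => p pin; rewrite sumn_flatten sumnE -map_comp big_map (big_rem p) //=.
  rewrite sumM -modnDmr (_ : (\sum_(_ <- _) _) %% p = 0) ?addn0; first by case: (fP p pin).
  apply/eqP; rewrite -/(dvdn _ _) big_seq; apply: dvdn_sum => q.
  rewrite mem_rem_uniq // inE => /andP[qp qin].
  by rewrite /= sumM dvdn_mull // dvd_cof // eq_sym.
have [f fP] := choice rep; pose K := \max_(x < P) sumn (f x).
exists (K + P * (hT + r)) => n nK.
have [l1 l2 l3] := fP (n %% P); set l := f (n %% P) in l1 l2 l3.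
have lK : sumn l <= K by apply: (leq_bigmax (Ordinal (ltn_pmod n P_gt0))).
have ln : sumn l <= n by move: nK lK; clear; lia.
have /dvdnP[c cE] : P %| n - sumn l by rewrite -eqn_mod_dvd //; apply/eqP; rewrite l3 modn_mod.
have cle : hT + r <= c.
  by rewrite -(leq_pmul2l P_gt0) (mulnC P c) -cE; move: nK lK; clear; lia.
have := @blocks_sum r (hT - size l + r) c r0 (leq_addl _ _).
rewrite (leq_trans _ cle) ?leq_add2r ?leq_subr // => /(_ isT).
move=> /sumsetP[l' [s1 s2 s3]]; apply/sumsetP; exists (l ++ map (muln P) l'); split.
- by rewrite size_cat size_map s1 addnA subnKC.
- by move=> y; rewrite mem_cat => /orP[/l2//|/mapP[z /s2 zC ->]]; apply: AC.
- rewrite sumn_cat (_ : sumn (map _ _) = c * P); last first.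
    by rewrite -s3 !sumnE big_map big_distrl; apply: eq_bigr => i _; rewrite mulnC.
  by rewrite -cE subnKC.
Qed.

Lemma cofinite_ess_basis : cofinite_in_N (sumset (\sum_(p <- ps) H p + r) ess_basis).
Proof.
apply: (cofinite_sumset_cover (F := D)).
- by move=> c Cc; left; exists c.
- by move=> p d pin dD; right; exists p => //; apply/mapP; exists d; rewrite ?mem_sort.
- by move=> p pin; case: (DP pin).
Qed.

Lemma essential_ess p : p \in ps -> essential ess_basis (ess p).
Proof.
move=> pin; have pp := pps pin; have c0 : 0 < cof p.
  by have := P_gt0; rewrite (cofE pin) muln_gt0 => /andP[].
have [uD sD DN _] := DP pin.
split; last split; last split.
- have : sorted ltn (sort leq (D p)).
    by rewrite ltn_sorted_uniq_leq sort_uniq uD sort_sorted //; exact: leq_total.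
  rewrite /fsub /ess sorted_map; apply: sub_sorted => x y /=.
  by rewrite ltn_pmul2r.
- by move=> x xp; right; exists p.
- apply: (eqmod_not_basis (a := 0) pp) => x [Ax /= /negP xp].
  by rewrite mod0n; apply/eqP; apply: ess_basis_dvd.
move=> E' E'p [x xp xE']; have [d [dD dp xE]] := mem_ess pin xp.
(* The surviving digit [d] alone covers the residues modulo [p], at the price of up to [p] summands
   instead of [H p]. *)
apply/is_basisP; exists (\sum_(q <- ps) (if q == p then p else H q) + r).
apply: (cofinite_sumset_cover (F := fun q => if q == p then [:: d] else D q)).
- move=> c Cc; split; first by left; exists c.
  move=> /= /E'p /(ess_ndvd pin); by rewrite (cofE pin) -mulnA dvdn_mulr.
- move=> q e qin; case: eqP => [->|qp] eD.
    by move: eD; rewrite inE => /eqP ->; rewrite -xE; split; [right; exists p|apply/negP].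
  have eq : e * cof q \in ess q by apply/mapP; exists e; rewrite ?mem_sort.
  split; first by right; exists q.
  move=> /= /E'p /(ess_ndvd pin) /negP; apply; apply: (ess_dvd pin qin) eq.
  by apply/eqP => pq; apply: qp.
- move=> q qin; case: eqP => [->|_]; last by case: (DP qin).
  by apply: (@covers_ZN_unit _ _ d); rewrite ?mem_head.
Qed.

Lemma size_ess p : p \in ps -> size (ess p) = k.
Proof. by move=> pin; rewrite size_map size_sort; case: (DP pin). Qed.

Lemma ess_inj : {in ps &, injective ess}.
Proof.
move=> p q pin qin pq; apply/eqP; apply: contraT => npq.
have : 0 < size (ess p) by rewrite size_ess.
rewrite -has_predT => /hasP[x xp _].
by have := ess_ndvd pin xp; rewrite (ess_dvd pin qin npq) // -pq.
Qed.

Lemma at_least_ess_basis : at_least_ess ess_basis k (size ps).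
Proof.
exists (map ess ps); split; rewrite ?size_map ?map_inj_in_uniq //; first exact: ess_inj.
by move=> _ /mapP[p pin ->]; split; [apply: essential_ess | apply: size_ess].
Qed.

(** A number in the worst class modulo every [p] uses at least [H p] elements of each [ess p], which
    leaves at most [r - 1] multiples of [P]; its size is chosen to fall into a gap of their sums. *)
Lemma order_ess_basis : ~ cofinite_in_N (sumset (\sum_(p <- ps) H p + r).-1 ess_basis).
Proof.
case=> M cofM; set hT := \sum_(p <- ps) H p in cofM.
have bad p : exists t, p \in ps -> forall l, {subset l <= D p} -> sumn l = t %[mod p] -> H p <= size l.
  have [pin|] := boolP (p \in ps); last by exists 0.
  have pp := pps pin; apply: contrapT => nt; have H0 := min_cover_gt0 (prime_gt1 pp) (HP pin).
  have [uD sD DN _] := DP pin; have [_ Hmin] := HP pin.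
  suff : residues_cover p k (H p).-1 (D p).
    by move=> rc; have := Hmin _ (ex_intro _ _ rc); move: H0; clear; case: (H p) => // h _; rewrite /= ltnn.
  split=> //; apply/(covers_ZNP _ _ (prime_gt0 pp)) => t; apply: contrapT => nl.
  apply: nt; exists t => _ l lD lt; rewrite leqNgt; apply/negP => small.
  by apply: nl; exists l; split=> //; move: small H0; clear; case: (H p).
have [t tP] := choice bad.
have [n0 _ n0t] := @chinese_list _ id ps (fun p => t p * cof p) 0 ups
  (fun p q _ _ pq => pq) pps.
pose mx := \max_(x <- flatten (map ess ps)) x.
have mxP p x : p \in ps -> x \in ess p -> x <= mx.
  by move=> pin xp; apply: leq_bigmax_seq => //; apply/flatten_mapP; exists p.
pose K := (hT + r) * mx.
pose j := r * r + K + M + 2.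
(* [K] bounds what the essential elements add to a sum, so [Z] lies above everything reachable
   without later blocks and, by the choice of [j], below the next one. The term [M] ensures
   [M <= n]. *)
pose Z := r.-1 * (2 * (2 * r) ^ j + r) + K + M + 1.
have Bj : j < (2 * r) ^ j by apply: ltn_expl; move: r0; clear; lia.
pose n := n0 %% P + P * Z.
have Mn : M <= n.
  apply: leq_trans (leq_addl _ _); apply: leq_trans (leq_pmull _ P_gt0).
  by rewrite /Z addn1 leqW // leq_addl.
have /sumsetP[l [sl lA ls]] := cofM n Mn.
pose l1 := [seq x <- l | has (fun p => x \in ess p) ps].
pose l2 := [seq x <- l | ~~ has (fun p => x \in ess p) ps].
have ss : size l1 + size l2 = size l by rewrite !size_filter count_predC.
have sm : sumn l1 + sumn l2 = n.
  by rewrite -ls !sumnE !big_filter [in RHS](bigID (fun x => has (fun p => x \in ess p) ps)).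
have cnt p : p \in ps -> H p <= count (mem (ess p)) l.
  move=> pin; have pp := pps pin.
  have c0 : 0 < cof p by have := P_gt0; rewrite (cofE pin) muln_gt0 => /andP[].
  pose le := [seq x <- l | x \in ess p].
  have lec x : x \in le -> x = (x %/ cof p) * cof p /\ x %/ cof p \in D p.
    by rewrite mem_filter => /andP[/(mem_ess pin)[d [dD _ ->]] _]; rewrite mulnK.
  have -> : count (mem (ess p)) l = size [seq x %/ cof p | x <- le] by rewrite size_map size_filter.
  apply: tP => //; first by move=> _ /mapP[x /lec[_ xD] ->].
  apply: (eqmod_mulr (coprime_cof pin)).
  have -> : sumn [seq x %/ cof p | x <- le] * cof p = sumn le.
    by rewrite !sumnE big_map big_distrl /=; apply: eq_big_seq => x /lec[<- _].
  have <- : sumn l = t p * cof p %[mod p].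
    rewrite ls /n -n0t // -modnDmr (_ : (P * Z) %% p = 0) ?addn0.
      by rewrite modn_dvdm // (cofE pin) dvdn_mulr.
    by apply/eqP; rewrite -/(dvdn _ _) (cofE pin) -mulnA dvdn_mulr.
  have -> : sumn l = sumn le + sumn [seq x <- l | x \notin ess p].
    by rewrite !sumnE !big_filter [in LHS](bigID (mem (ess p))).
  rewrite -[in RHS]modnDmr (_ : sumn [seq x <- l | x \notin ess p] %% p = 0) ?addn0 //.
  apply/eqP; rewrite -/(dvdn _ _); apply: sumn_dvd => x; rewrite mem_filter => /andP[xp xl].
  exact: ess_basis_dvd pin (lA x xl) xp.
have hT1 : hT <= size l1.
  rewrite /hT; apply: leq_trans (_ : \sum_(p <- ps) count (mem (ess p)) l <= _).
    by rewrite big_seq [leqRHS]big_seq; apply: leq_sum.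
  have -> : \sum_(p <- ps) count (mem (ess p)) l = \sum_(p <- ps) count (mem (ess p)) l1.
    apply: eq_big_seq => p pin; rewrite count_filter; apply: eq_count => x /=.
    by case: (boolP (x \in ess p)) => //= xp; apply/esym/hasP; exists p.
  rewrite -(big_map ess xpredT (fun E => count (mem E) l1)); apply: count_disjoint_leq.
    by rewrite map_inj_in_uniq //; exact: ess_inj.
  move=> _ _ x /mapP[p pin ->] /mapP[q qin ->] xp xq; congr ess; apply/eqP; apply: contraT => pq.
  by have := ess_ndvd pin xp; rewrite (ess_dvd pin qin pq xq).
have l2r : size l2 <= r.-1.
  have := sl; rewrite -ss => h; move: h hT1 r0; clear; move: (size l1) (size l2) hT; lia.
have e1 : sumn l1 <= K.
  apply: leq_trans (_ : size l1 * mx <= _).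
    apply: leq_sumn => x; rewrite mem_filter => /andP[/hasP[p pin xp] _]; exact: mxP xp.
  rewrite leq_mul2r /K; apply/orP; right; apply: leq_trans (leq_addr (size l2) _) _.
  by rewrite ss sl leq_pred.
have l2C x : x \in l2 -> exists2 c, blocks r c & x = P * c.
  rewrite mem_filter => /andP[/hasPn nx xl]; have [//|[p pin xp]] := lA x xl.
  by have := nx p pin; rewrite xp.
pose l3 := [seq x %/ P | x <- l2].
have l3C x : x \in l3 -> blocks r x.
  by move=> /mapP[y /l2C[c cC ->] ->]; rewrite mulKn ?P_gt0.
have l2E : sumn l2 = P * sumn l3.
  rewrite !sumnE big_map big_distrr /=; apply: eq_big_seq => x /l2C[c _ ->].
  by rewrite mulKn ?P_gt0.
have [gap|gap] := blocks_gap j r0 l3C.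
  have h1 : sumn l3 <= r.-1 * (2 * (2 * r) ^ j + r).
    by apply: leq_trans gap _; rewrite size_map leq_mul2r l2r orbT.
  have h2 : P * sumn l3 <= P * (r.-1 * (2 * (2 * r) ^ j + r)) by rewrite leq_mul2l h1 orbT.
  have h3 : K + M + 1 <= P * (K + M + 1) by rewrite leq_pmull ?P_gt0.
  have h4 : P * Z <= n by apply: leq_addl.
  move: h4; rewrite -sm l2E /Z -addnA -addnA (addnA K) mulnDr.
  by move: h2 h3 e1; move: (P * (r.-1 * _)) (P * sumn l3) (P * (K + M + 1)) => *; lia.
have : Z < sumn l3 by apply: leq_trans gap; rewrite expnS; apply: gap_arith.
move=> Z3; have : P * Z + P <= n.
  by rewrite -sm l2E -mulnSr; apply: leq_trans (leq_addl _ _); rewrite leq_mul2l Z3 orbT.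
by rewrite /n addnC leq_add2r leqNgt ltn_pmod ?P_gt0.
Qed.
End Construction.
End LowerBoundConstruction.

(** * Asymptotics *)

Section LimInfSup.
Variable R : realType.
Implicit Types (u : nat -> \bar R) (a b : \bar R).
Local Open Scope ereal_scope.

Lemma limn_einfE u : limn_einf u = ereal_sup (range (einfs u)).
Proof. by rewrite limn_einf_lim; apply/cvg_lim => //; apply: cvg_einfs_sup. Qed.

Lemma limn_esupE u : limn_esup u = ereal_inf (range (esups u)).
Proof. by rewrite limn_esup_lim; apply/cvg_lim => //; apply: cvg_esups_inf. Qed.

Lemma limn_einf_ge u a N0 : (forall n, (N0 <= n)%N -> a <= u n) -> a <= limn_einf u.
Proof.
move=> H; rewrite limn_einfE; apply: le_trans (_ : einfs u N0 <= _).
  by apply: le_ereal_inf_tmp => _ [n /= nn <-]; apply: H.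
by apply: ereal_sup_ubound; exists N0.
Qed.

Lemma limn_einf_le u b N0 : (forall n, (N0 <= n)%N -> u n <= b) -> limn_einf u <= b.
Proof.
move=> H; rewrite limn_einfE; apply: ge_ereal_sup => _ [n _ <-].
apply: le_trans (_ : u (maxn n N0) <= _); last by apply: H; rewrite leq_maxr.
by apply: ereal_inf_lbound; exists (maxn n N0); rewrite //= leq_maxl.
Qed.

Lemma limn_einf_gt u a : a < limn_einf u -> exists N0, forall n, (N0 <= n)%N -> a <= u n.
Proof.
rewrite limn_einfE => /ereal_sup_gt[_ [N0 _ <-]] aN; exists N0 => n nn.
apply: le_trans (ltW aN) _; apply: ereal_inf_lbound; by exists n.
Qed.

Lemma limn_esup_le u b N0 : (forall n, (N0 <= n)%N -> u n <= b) -> limn_esup u <= b.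
Proof.
move=> H; rewrite limn_esupE; apply: le_trans (_ : esups u N0 <= _).
  by apply: ereal_inf_lbound; exists N0.
by apply: ge_ereal_sup => _ [n /= nn <-]; apply: H.
Qed.
End LimInfSup.

(** * Upper and lower bounds for [h(N, k)] *)

Section CoverBounds.
Variables (R : realType) (k : nat).
Hypothesis k0 : (0 < k)%N.
Local Notation root := (@nroot R k).

Lemma digits_sum m j x : (0 < m)%N -> (x < m ^ j)%N ->
  exists l, [/\ (size l <= j * m.-1)%N, {subset l <= [seq m ^ i | i <- iota 0 j]%N} & sumn l = x].
Proof.
move=> m0; elim: j x => [|j IHj] x xm.
  by exists [::]; split => //=; move: xm; rewrite expn0 ltnS leqn0 => /eqP.
have [|l [l1 l2 l3]] := IHj (x %/ m)%N; first by rewrite ltn_divLR // mulnC -expnS.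
exists (nseq (x %% m) 1%N ++ [seq m * y | y <- l]%N); split.
- rewrite size_cat size_nseq size_map mulSn leq_add //.
  by have := ltn_pmod x m0; case: (m) => // m'; rewrite ltnS.
- move=> y; rewrite mem_cat => /orP[/nseqP[-> _]|/mapP[z /l2 /mapP[i]]].
    by apply/mapP; exists 0%N; rewrite // mem_iota.
  rewrite mem_iota => ij -> ->; apply/mapP; exists i.+1; last by rewrite expnS.
  by rewrite mem_iota; move: ij; lia.
- rewrite sumn_cat; have -> : sumn [seq m * y | y <- l]%N = (m * sumn l)%N.
    by rewrite !sumnE big_map big_distrr.
  by rewrite sumn_nseq mul1n l3 addnC mulnC -divn_eq.
Qed.

(** Base [m] expansions with the digit weights [m ^ i], [i < k]. Modulo [N] some weights may vanish
    or coincide, hence the padding. *)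
Lemma min_cover_le_digits N m h : (k < N)%N -> (N <= m ^ k)%N -> is_min_cover N k h ->
  (h <= k * m.-1)%N.
Proof.
move=> kN Nm [_ hmin]; have N0 : (0 < N)%N by apply: leq_ltn_trans kN.
have m0 : (0 < m)%N by move: Nm; case: (m) => //; rewrite exp0n // leqn0; case: (N) N0.
apply: hmin; pose D := undup [seq y <- [seq m ^ i %% N | i <- iota 0 k]%N | y != 0%N].
have [||D' [uD' sD' DD' D'N]] := pad_residues kN (undup_uniq [seq y <- [seq m ^ i %% N | i <- iota 0 k]%N | y != 0%N]).
- by rewrite (leq_trans (size_undup _)) // size_filter (leq_trans (count_size _ _)) // size_map size_iota.
- move=> a; rewrite mem_undup mem_filter lt0n => /andP[-> /mapP[i _ ->]] /=.
  by rewrite ltn_pmod.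
exists D'; split=> //; apply/(covers_ZNP _ _ N0) => x.
have [l [l1 l2 l3]] := digits_sum m0 (leq_trans (ltn_pmod x N0) Nm).
exists [seq y <- [seq y %% N | y <- l]%N | y != 0%N]; split.
- by rewrite size_filter (leq_trans (count_size _ _)) // size_map.
- move=> y; rewrite mem_filter => /andP[y0 /mapP[z /l2 /mapP[i ik ->] yE]].
  apply: DD'; rewrite mem_undup mem_filter y0 /= yE; apply/mapP; by exists i.
- rewrite -[RHS](modn_mod x) -l3; elim: (l) => //= y l' IHl.
  case: eqP => [y0|_] /=; first by rewrite -[in RHS]modnDml y0.
  by rewrite -modnDmr IHl modnDmr modnDml.
Qed.

Lemma min_cover_le_root N h : (k < N)%N -> is_min_cover N k h -> h%:R <= k%:R * root N%:R.
Proof.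
move=> kN hm; pose m := (Num.truncn (root N%:R)).+1.
have Nm : (N <= m ^ k)%N.
  rewrite -(ler_nat R) natrX -(nrootXn k0 (ler0n R N)) lerXn2r ?nnegrE ?nroot_ge0 //.
  by rewrite ltW // truncnS_gt.
have := min_cover_le_digits kN Nm hm; rewrite -(ler_nat R) => /le_trans; apply.
by rewrite natrM ler_pM2l ?ltr0n // truncn_le nroot_ge0.
Qed.

Lemma covers_leq_bin N h s : (0 < N)%N -> uniq s -> covers_ZN N h s ->
  (N <= 'C(size s + h, size s))%N.
Proof.
move=> N0 us /(covers_ZNP _ _ N0) cov.
pose cnt l : seq 'I_h.+1 := [seq inord (count_mem y l) | y <- s].
have H (x : 'I_N) : exists t : (size s).-tuple 'I_h.+1, exists2 l,
   [/\ size l <= h, {subset l <= s} & sumn l = x %[mod N]]%N & t = cnt l :> seq _.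
  have [l lP] := cov x; have sz : size (cnt l) == size s by rewrite size_map.
  by exists (Tuple sz), l.
have [f fP] := choice H.
have finj : injective f.
  move=> x y fxy; have [l [sl ls lx] tl] := fP x; have [l' [sl' ls' lx'] tl'] := fP y.
  apply: val_inj => /=; rewrite -(modn_small (ltn_ord x)) -(modn_small (ltn_ord y)) -lx -lx'.
  have cE z : z \in s -> count_mem z l = count_mem z l'.
    move=> zs; have : cnt l = cnt l' by rewrite -tl -tl' fxy.
    move/eq_in_map/(_ z zs)/(congr1 val); rewrite /= !inordK // ltnS.
      by rewrite (leq_trans (count_size _ _)).
    by rewrite (leq_trans (count_size _ _)).
  have pe := perm_filter_mem cE.
  move: pe; rewrite !(all_filterP _) => [pe||]; [|by apply/allP|by apply/allP].
  by rewrite !sumnE (perm_big _ pe).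
have : (#|'I_N| <= #|[set t : (size s).-tuple 'I_h.+1 | (\sum_(i <- t) i <= h)%N]%SET|)%N.
  rewrite -(card_imset _ finj); apply/subset_leq_card/fintype.subsetP => _ /imsetP[x _ ->].
  rewrite inE; have [l [sl ls lx] ->] := fP x.
  rewrite /cnt big_map; apply: leq_trans (leq_trans (count_sum_leq l us) sl).
  by apply: leq_sum => y _; rewrite inordK // ltnS (leq_trans (count_size _ _) sl).
by rewrite card_ord card_partial_ord_partitions.
Qed.

(** Counting multiplicities gives [N * k! <= (k + h) ^ k]. In [k! >= e * (k / e) ^ k] the extra [e]
    produces the factor [expR (1 / k)]. *)
Lemma min_cover_ge_root N h : (k < N)%N -> is_min_cover N k h ->
  k%:R * expR (k%:R^-1 - 1) * root N%:R <= h%:R + k%:R.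
Proof.
move=> kN [[s [us sk _ cov]] _]; have N0 : (0 < N)%N by apply: leq_ltn_trans kN.
have k0' : 0 < k%:R :> R by rewrite ltr0n.
have := covers_leq_bin N0 us cov; rewrite sk => NC.
have : (N * k`! <= (k + h) ^ k)%N.
  apply: leq_trans (_ : 'C(k + h, k) * k`! <= _)%N; first by rewrite leq_mul2r NC orbT.
  rewrite bin_ffact ffact_prod; apply: leq_trans (_ : \prod_(i < k) (k + h) <= _)%N.
    by apply: leq_prod => i _; rewrite leq_subr.
  by rewrite prod_nat_const card_ord.
rewrite -(ler_nat R) natrM natrX => h1.
rewrite -(@ler_pXn2r _ k) ?nnegrE ?addr_ge0 ?mulr_ge0 ?expR_ge0 ?nroot_ge0 //.
rewrite exprMn nrootXn // [in leRHS]addrC -natrD; apply: le_trans h1; rewrite mulrC ler_wpM2l //.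
rewrite -ler_ln ?posrE ?exprn_gt0 ?mulr_gt0 ?expR_gt0 ?ltr0n ?fact_gt0 //.
rewrite lnXn ?mulr_gt0 ?expR_gt0 // lnM ?posrE ?expR_gt0 // expRK.
apply: le_trans (ln_fact_bounds R k0).1; rewrite -mulr_natl le_eqVlt; apply/orP; left; apply/eqP.
by field; rewrite gt_eqF.
Qed.
End CoverBounds.

(** * Inversion of the relation between the order and the number of essential subsets *)

Section FinalAsymptotics.
Variables (R : realType) (k : nat).
Hypothesis k0 : (0 < k)%N.
Local Notation root := (@nroot R k).
Let k0' : 0 < k%:R :> R. Proof. by rewrite ltr0n. Qed.

Lemma hNk_ratioP N : (k < N)%N -> exists2 h, is_min_cover N k h & hNk R N k = h%:R.
Proof.
move=> kN; have [|h hm] := @exists_min_cover N k; first by rewrite k0.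
by exists h => //; apply: hNk_min_cover => //; apply: leq_ltn_trans kN.
Qed.

Lemma Rlow_le1 : (Rlow R k <= 1%:E)%E.
Proof.
apply: (@limn_einf_le _ _ _ k.+1) => N kN; have [h hm ->] := hNk_ratioP kN.
have N0 : (0 < N)%N by apply: leq_ltn_trans kN.
rewrite lee_fin ler_pdivrMr ?mul1r; first exact: min_cover_le_root.
by rewrite mulr_gt0 // powR_gt0 // ltr0n.
Qed.

Lemma Rlow_gt : (((expR 1)^-1)%:E < Rlow R k)%E.
Proof.
(* Any value strictly between [1/e] and [expR (1 / k - 1)] would serve; the difference [e] absorbs
   the additive [k] for large [N]. *)
pose b : R := expR (k.+1%:R^-1 - 1).
have kk : k.+1%:R^-1 < k%:R^-1 :> R by rewrite ltf_pV2 ?posrE ?ltr0n // ltr_nat.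
apply: (@lt_le_trans _ _ b%:E).
  by rewrite lte_fin -expRN ltr_expR ltrDr invr_gt0.
pose e : R := expR (k%:R^-1 - 1) - b.
have e0 : 0 < e by rewrite subr_gt0 ltr_expR ltrD2r.
have [n1 hn1] := @exists_nat_ge R ((1 / e) ^+ k).
apply: (@limn_einf_ge _ _ _ (maxn n1 k.+1)) => N; rewrite geq_max => /andP[/hn1 N1 kN].
have [h hm ->] := hNk_ratioP kN; have N0 : (0 < N)%N by apply: leq_ltn_trans kN.
have r0 : 0 < root N%:R by rewrite nroot_gt0 // ltr0n.
rewrite lee_fin ler_pdivlMr ?mulr_gt0 //.
have := min_cover_ge_root R k0 kN hm.
have r1 : 1 / e <= root N%:R.
  rewrite -(@ler_pXn2r _ k) ?nnegrE ?nroot_ge0 ?divr_ge0 ?(ltW e0) //.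
  by rewrite nrootXn.
have : k%:R <= k%:R * (e * root N%:R).
  by rewrite ler_peMr // ?(ltW k0') // mulrC -ler_pdivrMr.
rewrite /e mulrBl mulrBr -/(root _) => h1 h2.
have -> : b * (k%:R * root N%:R) = k%:R * (b * root N%:R) by ring.
by move: h1 h2; rewrite !mulrA; lra.
Qed.

(** [kap * T n] is the asymptotic value of [k] times the sum of the [k]-th roots of the first [n]
    primes. *)
Let T (n : nat) : R := n%:R * root n%:R * root (ln n%:R).
Let kap : R := k%:R ^+ 2 / k.+1%:R.

Let kap0 : 0 < kap. Proof. by rewrite divr_gt0 // exprn_gt0. Qed.

Lemma T_pow n : (0 < n)%N -> T n ^+ k = n%:R ^+ k.+1 * ln n%:R.
Proof.
move=> n0; rewrite /T !exprMn !nrootXn // -?exprSr // ln_ge0 // ler1n //.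
Qed.

Lemma exists_basis_many_essentials (c : R) : 1 < c -> exists s0, forall s h : nat, (s0 <= s)%N ->
  c * kap * T s < h%:R ->
  exists A : set nat, (A `<=` [set m | (0 < m)%N])%classic /\ basis_of_order h A /\ at_least_ess A k s.
Proof.
move=> c1; have [s0 Hs0] := exists_primes_sum_root_le k0 k c1.
exists s0 => s h ss sh; have [ps [ups pps sz sum]] := Hs0 s ss.
have cov p : exists HD : nat * seq nat, p \in ps -> is_min_cover p k HD.1 /\ residues_cover p k HD.1 HD.2.
  have [pin|] := boolP (p \in ps); last by exists (0%N, [::]).
  have [_ kp] := pps p pin; have [|H HM] := @exists_min_cover p k; first by rewrite k0.
  by have [[D DH] _] := HM; exists (H, D).
have [f fP] := choice cov.
pose H p := (f p).1; pose D p := (f p).2.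
have DP p : p \in ps -> residues_cover p k (H p) (D p) by move=> /fP[].
have HP p : p \in ps -> is_min_cover p k (H p) by move=> /fP[].
have sumH : (\sum_(p <- ps) H p < h)%N.
  rewrite -(ltr_nat R); apply: le_lt_trans sh; rewrite natr_sum.
  apply: le_trans (_ : k%:R * \sum_(p <- ps) root p%:R <= _).
    rewrite mulr_sumr big_seq [leRHS]big_seq; apply: ler_sum => p pin.
    by apply: min_cover_le_root (HP p pin) => //; case: (pps p pin).
  rewrite -(ler_pM2l k0') in sum; apply: le_trans sum _.
  rewrite exprSr nrootXn // /T /kap le_eqVlt; apply/orP; left; apply/eqP; ring.
(* The surplus goes to the blocks and makes the order exactly [h]. *)
pose r := (h - \sum_(p <- ps) H p)%N; have r0 : (0 < r)%N by rewrite subn_gt0.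
have hE : (\sum_(p <- ps) H p + r)%N = h by rewrite subnKC // ltnW.
have pr p : p \in ps -> prime p by move=> /pps[].
exists (ess_basis ps r D); split; first exact: ess_basis_pos DP.
split; last by rewrite -sz; apply: (at_least_ess_basis ups pr k0 r0 DP).
split; rewrite -hE; first exact: cofinite_ess_basis DP.
exact: order_ess_basis DP HP.
Qed.

Let C0 : R := (k.+1%:R / k%:R ^+ 2) ^+ k.+1 * k%:R.
Let C00 : 0 < C0. Proof. by rewrite mulr_gt0 // exprn_gt0 // divr_gt0 // exprn_gt0. Qed.

(** This identity makes [fhk] the asymptotic inverse of [kap * T]: the factor [(k + 1) / k] is
    compensated by [ln (fhk h) ~ k / (k + 1) * ln h]. *)
Lemma kap_C0 : kap ^+ k * C0 = k.+1%:R / k%:R.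
Proof.
have k1 : k.+1%:R != 0 :> R by rewrite pnatr_eq0.
have kn : k%:R != 0 :> R by rewrite gt_eqF.
rewrite /C0 (_ : k.+1%:R / k%:R ^+ 2 = kap^-1); last by rewrite /kap invf_div.
rewrite exprS exprVn; have x0 : kap ^+ k != 0 by rewrite expf_neq0 // gt_eqF.
have -> : kap ^+ k * (kap^-1 * (kap ^+ k)^-1 * k%:R) = kap^-1 * k%:R.
  by move: (kap ^+ k) x0 (kap^-1) => x x0 y; field.
by rewrite /kap invf_div expr2; field; rewrite kn.
Qed.

Lemma ln_natr_gt0 (n : nat) : 0 < ln n%:R :> R -> 0 < n%:R :> R.
Proof. by case: n => [|n] //; rewrite ln0 ?ltxx. Qed.

Lemma fhk_pow h : 0 < ln h%:R :> R -> fhk R h k ^+ k.+1 = C0 * (h%:R ^+ k / ln h%:R).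
Proof.
move=> lh; rewrite /fhk -!/(nroot k.+1 _) exprMn [X in X * _]exprMn.
by rewrite !nrootXn // divr_ge0 ?exprn_ge0 // ltW.
Qed.

Lemma fhk_gt0 h : 0 < ln h%:R :> R -> 0 < fhk R h k.
Proof.
move=> lh; have h0 : 0 < h%:R :> R := ln_natr_gt0 lh.
apply: mulr_gt0; last by rewrite powR_gt0 // divr_gt0 // exprn_gt0.
by apply: mulr_gt0; [rewrite divr_gt0 // exprn_gt0 | rewrite powR_gt0].
Qed.

Lemma ln_fhk h : 0 < ln h%:R :> R ->
  k.+1%:R * ln (fhk R h k) = ln C0 + k%:R * ln h%:R - ln (ln h%:R).
Proof.
move=> lh; have h0 : 0 < h%:R :> R := ln_natr_gt0 lh.
rewrite mulr_natl -lnXn ?fhk_gt0 // fhk_pow // lnM ?posrE ?divr_gt0 ?exprn_gt0 //.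
by rewrite ln_div ?posrE ?exprn_gt0 // lnXn // mulr_natl addrA.
Qed.

Lemma ln_fhk_le : exists h0, forall h, (h0 <= h)%N ->
  0 < ln h%:R :> R /\ k.+1%:R * ln (fhk R h k) <= k%:R * ln h%:R.
Proof.
have [h0 H] := @exists_nat_ln_ge R (1 + C0).
exists h0 => h /H hh; have lh : 0 < ln h%:R :> R by apply: lt_le_trans hh; rewrite addr_gt0.
split=> //; rewrite ln_fhk //; suff : ln C0 <= ln (ln h%:R) by lra.
by rewrite ler_ln ?posrE // (le_trans _ hh) // lerDr.
Qed.

(** The term [ln (ln h)] is absorbed by [e]. The constant [C] admits a fixed factor in front of
    [fhk]. *)
Lemma ln_fhk_ge (e C : R) : 0 < e -> exists h0, forall h, (h0 <= h)%N ->
  0 < ln h%:R :> R /\ (1 - e) * (k%:R * ln h%:R) <= k.+1%:R * ln (fhk R h k) + C.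
Proof.
move=> e0; pose d := e / 2; have d0 : 0 < d by rewrite divr_gt0.
have [h0 H] := @exists_nat_ln_ge R (Num.max 1 ((- ln C0 - ln d - C) / d)).
exists h0 => h /H; rewrite ge_max => /andP[h1 h2].
have lh : 0 < ln h%:R :> R by apply: lt_le_trans h1.
split=> //; rewrite ln_fhk //; have := ln_ln_le d0 lh.
rewrite ler_pdivrMr // in h2.
have k1 : 1 <= k%:R :> R by rewrite ler1n.
have : d * ln h%:R <= d * (k%:R * ln h%:R) by rewrite ler_pM2l // ler_peMl // ltW.
have -> : e = 2 * d by rewrite /d; field.
by move: h2; lra.
Qed.

Lemma fhk_unbounded (B : R) : exists h0, forall h, (h0 <= h)%N -> B <= fhk R h k.
Proof.
have [h0 H] := @ln_fhk_ge (1 / 2) 0 ltac:(by rewrite divr_gt0).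
have [h1 H1] := @exists_nat_ln_ge R (2 * k.+1%:R * ln (Num.max 1 B)).
exists (maxn h0 h1) => h; rewrite geq_max => /andP[/H[lh hh] /H1 hh1].
have B0 : 0 < Num.max 1 B by rewrite lt_max ltr01.
apply: le_trans (_ : Num.max 1 B <= _); first by rewrite le_max lexx orbT.
rewrite -ler_ln ?posrE ?fhk_gt0 // -(ler_pM2l (ltr0Sn R k)).
have k1 : 1 <= k%:R :> R by rewrite ler1n.
have : ln h%:R <= k%:R * ln h%:R :> R by rewrite ler_peMl // ltW.
by move: hh hh1; lra.
Qed.
Let Ess h : set R := [set (n%:R : R) | n in [set n : nat | exists A : set nat,
        (A `<=` [set m | (0 < m)%N]) /\ basis_of_order h A /\ at_least_ess A k n]]%classic.

Lemma Ess_le (rho c : R) : 0 < rho -> 0 < c < 1 -> (rho%:E < Rlow R k)%E ->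
  exists n0, forall h n, Ess h n%:R -> (n0 <= n)%N -> c * rho * kap * T n <= h%:R.
Proof.
move=> rho0 c01 /limn_einf_gt[N0 HN0].
have [|n0 Hn0] := order_lower_bound k0 rho0 c01.
  exists (maxn N0 1) => N; rewrite geq_max => /andP[/HN0 + N1].
  by rewrite lee_fin ler_pdivlMr ?mulr_gt0 ?powR_gt0 ?ltr0n.
exists n0 => h n [m [A [_ [bA aA]]] /eqP]; rewrite eqr_nat => /eqP <- n0m.
exact: Hn0 bA aA n0m.
Qed.

Lemma T_ge n : 1 <= ln n%:R :> R -> n%:R <= T n.
Proof.
move=> ln1; have n1 : 1 <= n%:R :> R.
  by case: n ln1 => [|n _]; rewrite ?ler1n // ln0 // ler10.
rewrite /T -mulrA ler_peMr // mulr_ege1 // nroot_ge1 //.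
Qed.

(** Needed because [sup] is only meaningful for bounded sets. The bound comes from [Ess_le] with
    [1/e] in place of [Rlow], as [T n >= n]. *)
Lemma Ess_bounded h : has_ubound (Ess h).
Proof.
have [n0 Hn0] := @Ess_le (expR 1)^-1 (1 / 2) ltac:(by rewrite invr_gt0 expR_gt0) ltac:(lra) Rlow_gt.
have [n1 Hn1] := @exists_nat_ln_ge R 1.
set c : R := _ * kap in Hn0.
have c0 : 0 < c by rewrite !mulr_gt0 // ?invr_gt0 ?expR_gt0 // divr_gt0.
exists (Num.max (maxn n0 n1)%:R (h%:R / c)) => x xE; have [n nE nx] := xE.
rewrite -nx in xE *; rewrite le_max; apply/orP.
have [nn|nn] := leqP n (maxn n0 n1); [by left; rewrite ler_nat | right].
move: nn; rewrite gtn_max => /andP[/ltnW nn0 /ltnW /Hn1 l1].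
rewrite ler_pdivlMr // mulrC; apply: le_trans (Hn0 h n xE nn0).
by rewrite ler_pM2l // T_ge.
Qed.

Lemma Eess_ge h n : Ess h n%:R -> n%:R <= Eess R h k.
Proof. by move=> nE; apply: ub_le_sup => //; apply: Ess_bounded. Qed.

Lemma Eess_le h (y : R) : 0 <= y -> (forall n : nat, Ess h n%:R -> n%:R <= y) -> Eess R h k <= y.
Proof.
move=> y0 H; rewrite /Eess -/(Ess h); have [->|/set0P E0] := eqVneq (Ess h) set0.
  by rewrite sup0.
by apply: ge_sup => // x xE; have [n nE nx] := xE; rewrite -nx in xE *; apply: H.
Qed.

Lemma asym_ge_Eess : asym_ge (fun h => Eess R h k) (fun h => fhk R h k).
Proof.
apply/lee_subgt0Pr => e e0; rewrite -EFinB.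
pose d : R := Num.min (e / 2) (1 / 2).
have d0 : 0 < d by rewrite lt_min !divr_gt0.
have d12 : d <= 1 / 2 by rewrite ge_min lexx orbT.
have de : d <= e / 2 by rewrite ge_min lexx.
have d1 : 0 < 1 - d by lra.
(* In the [k]-th power, [c ^ k] cancels [k] of the [k + 1] factors [1 - d]; the last one makes the
   inequality strict. *)
pose c : R := (1 - d)^-1.
have c1 : 1 < c by rewrite invf_gt1 //; lra.
have [s0 Hs0] := exists_basis_many_essentials c1.
have [h0 Hh0] := ln_fhk_le.
have [h1 Hh1] := @fhk_unbounded ((s0.+3)%:R / (1 - d)).
have [h2 Hh2] := @fhk_unbounded (1 / d).
apply: (@limn_einf_ge _ _ _ (maxn h0 (maxn h1 h2))) => h.
rewrite !geq_max => /and3P[/Hh0[lh lf] /Hh1 f1 /Hh2 f2].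
have f0 := fhk_gt0 lh; set f := fhk R h k in f0 f1 f2 lf *.
rewrite lee_fin ler_pdivlMr //.
pose s := Num.truncn ((1 - d) * f).
have df0 : 0 <= (1 - d) * f by rewrite mulr_ge0 // ltW.
have sle : s%:R <= (1 - d) * f by rewrite truncn_le.
have sgt : (1 - d) * f < s.+1%:R by apply: truncnS_gt.
rewrite ler_pdivrMr // mulrC in f1; rewrite ler_pdivrMr // in f2.
have ss : (s0 < s)%N by rewrite -ltnS -(ltr_nat R); apply: le_lt_trans sgt; apply: le_trans f1; rewrite ler_nat ltnS -addn2 leq_addr.
have s1 : (0 < s)%N by apply: leq_ltn_trans ss.
have s0' : 0 < s%:R :> R by rewrite ltr0n.
have h0' : 0 < h%:R :> R := ln_natr_gt0 lh.
have sh : c * kap * T s < h%:R.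
  rewrite -(@ltr_pXn2r _ k) ?nnegrE ?mulr_ge0 ?nroot_ge0 ?(ltW kap0) ?invr_ge0 ?(ltW d1) //.
  rewrite exprMn T_pow // exprMn.
  apply: le_lt_trans (_ : c ^+ k * kap ^+ k * (((1 - d) * f) ^+ k.+1 * (k%:R / k.+1%:R * ln h%:R)) < _).
    rewrite ler_wpM2l ?mulr_ge0 ?exprn_ge0 ?invr_ge0 ?(ltW kap0) ?(ltW d1) //.
    rewrite ler_pM ?exprn_ge0 ?ln_ge0 ?ler1n // ?lerXn2r ?nnegrE //.
    apply: le_trans (_ : ln f <= _).
      rewrite ler_ln ?posrE // (le_trans sle) // ler_piMl ?(ltW f0) //; lra.
    by rewrite mulrAC ler_pdivlMr ?ltr0n // mulrC.
  have fp := fhk_pow lh; rewrite -/f in fp; rewrite [((1 - d) * f) ^+ _]exprMn fp.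
  have -> : c ^+ k * kap ^+ k * ((1 - d) ^+ k.+1 * (C0 * (h%:R ^+ k / ln h%:R)) * (k%:R / k.+1%:R * ln h%:R))
     = (c * (1 - d)) ^+ k * (1 - d) * (kap ^+ k * C0) * (k%:R / k.+1%:R) * h%:R ^+ k * (ln h%:R / ln h%:R).
    rewrite [(1 - d) ^+ k.+1]exprSr [(c * (1 - d)) ^+ k]exprMn.
    by move: (c ^+ k) (kap ^+ k) ((1 - d) ^+ k) (h%:R ^+ k) C0 => x1 x2 x3 x4 x5; ring.
  rewrite kap_C0 divff ?gt_eqF // mulr1 mulVf ?gt_eqF // expr1n mul1r.
  have -> : (1 - d) * (k.+1%:R / k%:R) * (k%:R / k.+1%:R) = 1 - d.
    by field; rewrite !gt_eqF // ltr0n.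
  by rewrite gtr_pMl ?exprn_gt0 // gtrBl.
have [A [A0 [bA aA]]] := Hs0 s h (ltnW ss) sh.
apply: le_trans (Eess_ge (_ : Ess h s%:R)); last by exists s => //; exists A.
apply: le_trans (_ : (1 - 2 * d) * f <= _); first by rewrite ler_wpM2r ?(ltW f0) //; lra.
by move: sgt f2; rewrite -natr1; lra.
Qed.

Lemma asym_le_Eess : asym_le (fun h => Eess R h k)
  (fun h => powR (fine (Rlow R k))^-1 (k%:R / k.+1%:R) * fhk R h k).
Proof.
have [rl rlE] : exists rl : R, Rlow R k = rl%:E.
  move: Rlow_gt Rlow_le1; case: (Rlow R k) => [r _ _||]; first by exists r.
    by move=> _; rewrite leNgt ltry.
  by rewrite ltNge leNye.
have rl0 : 0 < rl.
  have := Rlow_gt; rewrite rlE lte_fin; apply: lt_trans; by rewrite invr_gt0 expR_gt0.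
rewrite rlE /=; set w := powR _ _.
have w0 : 0 < w by rewrite powR_gt0 // invr_gt0.
(* This power cancels the factor [rl ^ k] from the [k]-th power of the lower bound on the order. *)
have wk : w ^+ k.+1 = rl ^- k.
  rewrite -powR_mulrn ?powR_ge0 // -powRrM divfK ?pnatr_eq0 //.
  by rewrite powR_mulrn ?invr_ge0 ?(ltW rl0) // exprVn.
apply/lee_addgt0Pr => e' e'0; rewrite -EFinD.
pose e : R := Num.min e' 1.
have e0 : 0 < e by rewrite lt_min e'0 ltr01.
have e1 : e <= 1 by rewrite ge_min lexx orbT.
have ee : e <= e' by rewrite ge_min lexx.
have ee1 : 0 <= e * (1 - e) by rewrite mulr_ge0 ?subr_ge0 ?(ltW e0).
(* Two factors [c] are lost, one in [rho = c * rl] and one in [Ess_le]; [c * c * (1 + e) >= 1] makes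
   up for both, and the remaining [1 + e] beats the loss [1 - e / 4] in the logarithm. *)
pose c : R := (1 + e / 3)^-1.
have d3 : 0 < 1 + e / 3 by rewrite addr_gt0 // divr_gt0.
have c0 : 0 < c by rewrite invr_gt0.
have c1 : c < 1 by rewrite invf_lt1 // ltrDl divr_gt0.
have cc : (1 + e)^-1 <= c * c.
  have x0 : 0 < 1 + e by rewrite addr_gt0.
  rewrite /c -invfM lef_pV2 ?posrE ?mulr_gt0 //.
  by move: ee1 e0; lra.
have rho0 : 0 < c * rl by rewrite mulr_gt0.
have rho1 : ((c * rl)%:E < Rlow R k)%E by rewrite rlE lte_fin gtr_pMl.
have c01 : 0 < c < 1 by rewrite c0.
have [n0 Hn0] := Ess_le rho0 c01 rho1.
have q0 : 0 < e / 4 by rewrite divr_gt0.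
have [h0 Hh0] := @ln_fhk_ge (e / 4) (k.+1%:R * ln w) q0.
have [h1 Hh1] := @fhk_unbounded (n0.+1%:R / w).
have [h2 Hh2] := @fhk_unbounded (expR 1 / w).
apply: (@limn_esup_le _ _ _ (maxn h0 (maxn h1 h2))) => h.
rewrite !geq_max => /and3P[/Hh0[lh lf] /Hh1 f1 /Hh2 f2].
have f0 := fhk_gt0 lh; have fp := fhk_pow lh; set f := fhk R h k in f0 f1 f2 lf fp *.
have h0' : 0 < h%:R :> R := ln_natr_gt0 lh.
have wf0 : 0 < w * f by rewrite mulr_gt0.
rewrite lee_fin ler_pdivrMr //.
apply: le_trans (_ : (1 + e) * (w * f) <= _); last by rewrite ler_wpM2r ?(ltW wf0) // lerD2l.
have y0 : 0 < (1 + e) * (w * f) by rewrite mulr_gt0 // addr_gt0.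
apply: Eess_le (ltW y0) _ => n nE; rewrite leNgt; apply/negP => ny.
have wfn : w * f < n%:R.
  by apply: le_lt_trans ny; rewrite ler_peMl ?(ltW wf0) // lerDl ltW.
have nn0 : (n0 <= n)%N.
  apply: ltnW; rewrite -(ltr_nat R); apply: le_lt_trans wfn.
  by rewrite mulrC -ler_pdivrMr //; apply: le_trans f1; rewrite ler_pM2r ?invr_gt0 // ler_nat.
have wfe : expR 1 <= w * f by rewrite mulrC -ler_pdivrMr.
have lwf : 1 <= ln (w * f) by rewrite -[leLHS]expRK ler_ln ?posrE ?expR_gt0.
have n0' : 0 < n%:R :> R by apply: lt_trans wfn.
have n1 : (0 < n)%N by rewrite -(ltr0n R).
have := Hn0 h n nE nn0; apply/negP; rewrite -ltNge.
have T0 : 0 <= T n by rewrite /T !mulr_ge0 ?nroot_ge0.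
have K0 : 0 <= c * (c * rl) * kap by rewrite !mulr_ge0 ?(ltW c0) ?(ltW rl0) ?(ltW kap0).
have KT0 := mulr_ge0 K0 T0.
suff : h%:R ^+ k < (c * (c * rl) * kap * T n) ^+ k by rewrite ltr_pXn2r ?nnegrE.
rewrite [ltRHS]exprMn T_pow //.
have ln_n : (1 - e / 4) * (k%:R / k.+1%:R * ln h%:R) <= ln n%:R.
  apply: le_trans (_ : ln (w * f) <= _); last by rewrite ler_ln ?posrE // ltW.
  rewrite lnM ?posrE // -(ler_pM2l (ltr0Sn R k)).
  have -> : k.+1%:R * ((1 - e / 4) * (k%:R / k.+1%:R * ln h%:R)) = (1 - e / 4) * (k%:R * ln h%:R).
    have : k.+1%:R != 0 :> R by rewrite pnatr_eq0.
    by move: k.+1%:R => x x0; field.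
  by rewrite [leRHS]mulrDr [leRHS]addrC.
apply: lt_le_trans (_ : (c * (c * rl) * kap) ^+ k *
   (((1 + e) * (w * f)) ^+ k.+1 * ((1 - e / 4) * (k%:R / k.+1%:R * ln h%:R))) <= _); last first.
  apply: ler_wpM2l; first by rewrite exprn_ge0.
  apply: ler_pM; rewrite ?exprn_ge0 ?(ltW y0) //.
    by rewrite !mulr_ge0 ?divr_ge0 ?(ltW lh) //; move: e1; lra.
  by rewrite lerXn2r ?nnegrE ?(ltW y0) ?(ltW n0') // ltW.
have -> : (c * (c * rl) * kap) ^+ k *
   (((1 + e) * (w * f)) ^+ k.+1 * ((1 - e / 4) * (k%:R / k.+1%:R * ln h%:R))) =
   (c * c * (1 + e)) ^+ k * ((1 + e) * (1 - e / 4)) * h%:R ^+ k.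
  rewrite [((1 + e) * (w * f)) ^+ _]exprMn [(w * f) ^+ _]exprMn wk fp.
  rewrite [(c * (c * rl) * kap) ^+ k]exprMn [(c * (c * rl)) ^+ k]exprMn [(c * rl) ^+ k]exprMn.
  rewrite [(c * c * (1 + e)) ^+ k]exprMn [(c * c) ^+ k]exprMn [(1 + e) ^+ k.+1]exprSr.
  have kc := kap_C0; have ck : C0 = k.+1%:R / k%:R / kap ^+ k.
    by rewrite -kc mulrAC mulfV ?mul1r // expf_neq0 // gt_eqF.
  rewrite ck.
  have r1 : rl ^+ k != 0 by rewrite expf_neq0 // gt_eqF.
  have r2 : kap ^+ k != 0 by rewrite expf_neq0 // gt_eqF.
  have r3 : ln h%:R != 0 :> R by rewrite gt_eqF.
  have r4 : k%:R != 0 :> R by rewrite gt_eqF.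
  have r5 : k.+1%:R != 0 :> R by rewrite pnatr_eq0.
  move: (rl ^+ k) (kap ^+ k) (c ^+ k) (ln h%:R) (h%:R ^+ k) ((1 + e) ^+ k) k.+1%:R k%:R r1 r2 r3 r4 r5.
  by move=> x1 x2 x3 x4 x5 x6 x7 x8 r1 r2 r3 r4 r5; field; rewrite r1 r2 r3 r4 r5.
rewrite -[ltLHS]mul1r ltr_pM2r ?exprn_gt0 //.
have x0 : 0 < 1 + e by rewrite addr_gt0.
have a1 : 1 <= (c * c * (1 + e)) ^+ k.
  by apply: exprn_ege1; have := ler_wpM2r (ltW x0) cc; rewrite mulVf ?gt_eqF.
have a2 : 1 < (1 + e) * (1 - e / 4).
  by move: ee1 e0; lra.
by apply: (lt_le_trans a2); rewrite ler_peMl // (le_trans _ (ltW a2)).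
Qed.
End FinalAsymptotics.

Theorem theorem1p2 (R : realType) (k : nat) (hk : (0 < k)%N) :
  asym_ge (fun h => Eess R h k) (fun h => fhk R h k) /\
  ((((expR 1)^-1)%:E < Rlow R k)%E /\ (Rlow R k <= 1%:E)%E /\
   asym_le (fun h => Eess R h k)
     (fun h => powR (fine (Rlow R k))^-1 (k%:R / k.+1%:R) * fhk R h k)).
Proof.
by split; [exact: asym_ge_Eess | split; [exact: Rlow_gt | split; [exact: Rlow_le1 | exact: asym_le_Eess]]].
Qed.
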